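(* Let $\mathscr T$ be a small (ungraded) idempotent complete additive $k$-linear category such that the category $\operatorname{mod}(\mathscr T)$ of finitely presented right $\mathscr T$-modules is Frobenius abelian, and let $\Sigma\colon\mathscr T\to\mathscr T$ be an automorphism. Then the set of Puppe triangulated structures on $\mathscr T$ with suspension functor $\Sigma$ is in bijection (via the correspondence $\varphi\mapsto\{\varphi\text{-exact triangles}\}$ recalled in the context) with the set of units of the bigraded ring $HH^{0,*}(\operatorname{mod}(\mathscr T_\Sigma),\widehat{\operatorname{Ext}}^{\bullet,*}_{\mathscr T_\Sigma})$ which lie in $$HH^{0,-1}(\operatorname{mod}(\mathscr T_\Sigma),\widehat{\operatorname{Ext}}^{3,*}_{\mathscr T_\Sigma})$$ and whose image along $$i^*\colon HH^{0,-1}(\operatorname{mod}(\mathscr T_\Sigma),\widehat{\operatorname{Ext}}^{3,*}_{\mathscr T_\Sigma})\hookrightarrow HH^{0,-1}(\operatorname{mod}(\mathscr T),\widehat{\operatorname{Ext}}^{3,*}_{\mathscr T_\Sigma})$$ satisfies Heller's anticommutativity condition.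
   Context: $k$ is a commutative ground ring; ''graded'' means $\mathbb Z$-graded, with the Koszul sign rule. A graded category is a category enriched in graded $k$-modules; ungraded $k$-linear categories are regarded as concentrated in degree $0$. Essentially small categories are replaced by small equivalent ones. Hochschild cohomology: a bimodule $M$ over a graded category $\mathscr C$ is a family of graded modules $M(X,Y)$, contravariant in $X$ and covariant in $Y$, with associative unital degree $0$ actions $\mathscr C(Y,Y')\otimes M(X,Y)\otimes\mathscr C(X',X)\to M(X',Y')$. $HH^{\star,*}(\mathscr C,M)$ is the cohomology of $C^{n,*}(\mathscr C,M)=\prod_{X_0,\dots,X_n}\operatorname{Hom}_k^*(\mathscr C(X_1,X_0)\otimes\cdots\otimes\mathscr C(X_n,X_{n-1}),M(X_n,X_0))$ with $d(\varphi)(f_1,\dots,f_{n+1})=(-1)^{|\varphi||f_1|}f_1\cdot\varphi(f_2,\dots)+\sum_{i=1}^n(-1)^i\varphi(\dots,f_if_{i+1},\dots)+(-1)^{n+1}\varphi(f_1,\dots,f_n)\cdot f_{n+1}$. In particular $HH^{0,m}(\mathscr C,M)$ consists of families $\varphi(X)\in M(X,X)^m$ with $(-1)^{m|g|}g\cdot\varphi(X)=\varphi(Y)\cdot g$ for all $g\colon X\to Y$. $\mathscr T_\Sigma$ is the graded category with the objects of $\mathscr T$, $\mathscr T_\Sigma^n(X,Y)=\mathscr T(X,\Sigma^nY)$, and composition $fg:=(\Sigma^qf)g$ for $f\in\mathscr T_\Sigma^p(Y,Z)$, $g\in\mathscr T_\Sigma^q(X,Y)$. $\operatorname{mod}(\mathscr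 T)$ is the category of finitely presented right $\mathscr T$-modules (functors $\mathscr T^{op}\to k$-modules which are cokernels of maps between representables), and $\operatorname{mod}(\mathscr T_\Sigma)$ the graded category of finitely presented graded right $\mathscr T_\Sigma$-modules, with morphisms of all degrees. $\Sigma$ extends through the Yoneda embedding to an exact automorphism of $\operatorname{mod}(\mathscr T)$, $\Sigma M=M(\Sigma^{-1}-)$, and $\operatorname{mod}(\mathscr T_\Sigma)=\operatorname{mod}(\mathscr T)_\Sigma$, i.e. $\operatorname{mod}(\mathscr T)$ is its degree $0$ part and $\operatorname{Hom}^n_{\mathscr T_\Sigma}(M,N)=\operatorname{Hom}_{\mathscr T}(M,\Sigma^nN)$. The inclusion is $i\colon\operatorname{mod}(\mathscr T)\subset\operatorname{mod}(\mathscr T_\Sigma)$, and $i^*$ is restriction. An abelian category is Frobenius if it has enough projectives and enough injectives and these classes coincide. Then $\underline{\operatorname{mod}}(\mathscr T)$ is the quotient of $\operatorname{mod}(\mathscr T)$ by the maps factoring through representables, with morphism sets $\underline{\operatorname{Hom}}_{\mathscr T}$; $S$ is the cosyzygy functor on it, defined by chosen short exact sequences $M\hookrightarrow\mathscr T(-,X_M)\twoheadrightarrow SM$. $\Sigma$ induces an endofunctor of $\underline{\operatorname{mod}}(\mathscr T)$ and there is a natural isomorphism $\sigma\colon\Sigma S\cong S\Sigma$ induced by maps of short exact sequences, from $\Sigma M\hookrightarrow\mathscr T(-,\Sigma X_M)\twoheadrightarrow\Sigma SM$ to $\Sigma M\hookrightarrow\mathscr T(-,X_{\Sigma M})\twoheadrightarrow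 S\Sigma M$, which are the identity on $\Sigma M$. $\widehat{\operatorname{Ext}}^n_{\mathscr T}(M,N)=\underline{\operatorname{Hom}}_{\mathscr T}(M,S^nN)$, $n\in\mathbb Z$, is Tate's Ext (equal to $\operatorname{Ext}^n_{\mathscr T}$ for $n>0$), and $\widehat{\operatorname{Ext}}^{n,m}_{\mathscr T_\Sigma}(M,N)=\widehat{\operatorname{Ext}}^n_{\mathscr T}(M,\Sigma^mN)$. The extended Yoneda product makes $HH^{0,*}(\operatorname{mod}(\mathscr T_\Sigma),\widehat{\operatorname{Ext}}^{\bullet,*}_{\mathscr T_\Sigma})$ a bigraded ring (multiplication objectwise); a unit is an invertible homogeneous element. Heller's anticommutativity condition: an element $\varphi\in HH^{0,-1}(\operatorname{mod}(\mathscr T),\widehat{\operatorname{Ext}}^{3,*}_{\mathscr T_\Sigma})=HH^0(\operatorname{mod}(\mathscr T),\widehat{\operatorname{Ext}}^3_{\mathscr T}(-,\Sigma^{-1}))$ corresponds (applying $\Sigma$ and using $\sigma$) to a natural transformation $\delta\colon\Sigma\to S^3$ of endofunctors of $\underline{\operatorname{mod}}(\mathscr T)$, i.e. an element of $HH^0(\underline{\operatorname{mod}}(\mathscr T),\underline{\operatorname{Hom}}_{\mathscr T}(\Sigma,S^3))$. The condition is $(S\delta)\sigma+\delta S=0$. A Puppe triangulated structure is a class of exact triangles satisfying all axioms of a triangulated category except possibly the octahedral axiom. Correspondence: given $\varphi$, a diagram $X\xrightarrow{f}Y\xrightarrow{i}C_f\xrightarrow{q}\Sigma X$ in $\mathscr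 T$ is a $\varphi$-exact triangle if, with $M=\operatorname{Im}\mathscr T(-,q)$ and $\mathscr T(-,q)=(\Sigma\alpha)\lambda$, where $\lambda\colon\mathscr T(-,C_f)\twoheadrightarrow M$ and $\Sigma\alpha\colon M\hookrightarrow\mathscr T(-,\Sigma X)$, the sequence $\Sigma^{-1}M\xrightarrow{\alpha}\mathscr T(-,X)\xrightarrow{\mathscr T(-,f)}\mathscr T(-,Y)\xrightarrow{\mathscr T(-,i)}\mathscr T(-,C_f)\xrightarrow{\lambda}M$ is an extension representing $\varphi(M)\in\widehat{\operatorname{Ext}}^3_{\mathscr T}(M,\Sigma^{-1}M)$. *)

(* Defs.v *)
From HB Require Import structures.
From mathcomp Require Import all_boot all_order all_algebra.
From mathcomp Require Import generic_quotient ring_quotient zify.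
From mathcomp Require Import boolp classical_sets functions.

Set Implicit Arguments.
Unset Strict Implicit.
Unset Printing Implicit Defensive.
Import GRing.Theory.
Local Open Scope ring_scope.
Local Open Scope quotient_scope.

(* The type of objects is a parameter, not a field, so that the same record
   serves for a small category and for its (larger) category of modules. *)
Record klincat (k : comPzRingType) (Ob : Type) := Klincat {
  hom :> Ob -> Ob -> lmodType k;
  idm : forall X, hom X X;
  comp : forall X Y Z, hom Y Z -> hom X Y -> hom X Z;
  compA : forall X Y Z W (h : hom Z W) (g : hom Y Z) (f : hom X Y),
    comp h (comp g f) = comp (comp h g) f;
  comp1m : forall X Y (f : hom X Y), comp (idm Y) f = f;
  compm1 : forall X Y (f : hom X Y), comp f (idm X) = f;
  comp_linl : forall X Y Z (f : hom X Y) a (g g' : hom Y Z),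
    comp (a *: g + g') f = a *: comp g f + comp g' f;
  comp_linr : forall X Y Z (g : hom Y Z) a (f f' : hom X Y),
    comp g (a *: f + f') = a *: comp g f + comp g f'
}.
Arguments idm {k Ob} k0 X : rename.
Notation "g \oc f" := (comp g f) (at level 40, left associativity).

Section CategoricalNotions.
Variables (k : comPzRingType) (Ob : Type) (C : klincat k Ob).

Definition is_iso X Y (f : C X Y) :=
  exists g : C Y X, g \oc f = idm C X /\ f \oc g = idm C Y.

Definition is_zero_object Z := idm C Z = 0.

Definition is_biproduct X Y B (i1 : C X B) (i2 : C Y B) (p1 : C B X) (p2 : C B Y) :=
  [/\ p1 \oc i1 = idm C X, p2 \oc i2 = idm C Y, p1 \oc i2 = 0, p2 \oc i1 = 0
    & i1 \oc p1 + i2 \oc p2 = idm C B].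

Definition is_additive :=
  (exists Z, is_zero_object Z) /\
  (forall X Y, exists B i1 i2 p1 p2, @is_biproduct X Y B i1 i2 p1 p2).

Definition idempotent_complete :=
  forall X (e : C X X), e \oc e = e ->
  exists Y (r : C X Y) (s : C Y X), r \oc s = idm C Y /\ s \oc r = e.

Definition is_monic X Y (f : C X Y) :=
  forall W (g h : C W X), f \oc g = f \oc h -> g = h.

Definition is_epic X Y (f : C X Y) :=
  forall W (g h : C Y W), g \oc f = h \oc f -> g = h.

Definition is_kernel X Y (f : C X Y) K (i : C K X) :=
  f \oc i = 0 /\
  forall W (g : C W X), f \oc g = 0 -> exists! u : C W K, i \oc u = g.

Definition is_cokernel X Y (f : C X Y) Q (p : C Y Q) :=
  p \oc f = 0 /\
  forall W (g : C Y W), g \oc f = 0 -> exists! u : C Q W, u \oc p = g.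

Definition is_abelian :=
  [/\ is_additive,
      forall X Y (f : C X Y), exists K (i : C K X), is_kernel f i,
      forall X Y (f : C X Y), exists Q (p : C Y Q), is_cokernel f p,
      forall X Y (f : C X Y), is_monic f -> exists Z (g : C Y Z), is_kernel g f
    & forall X Y (f : C X Y), is_epic f -> exists Z (g : C Z X), is_cokernel g f].

Definition is_projective P :=
  forall X Y (e : C X Y) (f : C P Y), is_epic e -> exists g : C P X, e \oc g = f.

Definition is_injective I :=
  forall X Y (m : C X Y) (f : C X I), is_monic m -> exists g : C Y I, g \oc m = f.

Definition is_frobenius :=
  [/\ forall X, exists P (e : C P X), is_projective P /\ is_epic e,
      forall X, exists I (m : C X I), is_injective I /\ is_monic m
    & forall X, is_projective X <-> is_injective X].

(* The identity of X, regarded as a morphism between equal objects. *)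
Definition eqm X Y (e : X = Y) : C X Y :=
  match e in _ = Y return C X Y with erefl => idm C X end.

Lemma eqmK X Y (e : X = Y) : eqm (esym e) \oc eqm e = idm C X.
Proof. by case: _ / e; rewrite /= comp1m. Qed.

Lemma eqmVK X Y (e : X = Y) : eqm e \oc eqm (esym e) = idm C Y.
Proof. by case: _ / e; rewrite /= comp1m. Qed.

Lemma comp0m X Y Z (f : C X Y) : (0 : C Y Z) \oc f = 0.
Proof. by have := comp_linl f (-1) 0 (0 : C Y Z); rewrite scaler0 addr0 scaleN1r addNr. Qed.

Lemma compm0 X Y Z (g : C Y Z) : g \oc (0 : C X Y) = 0.
Proof. by have := comp_linr g (-1) 0 (0 : C X Y); rewrite scaler0 addr0 scaleN1r addNr. Qed.

End CategoricalNotions.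

Record addcat (k : comPzRingType) (Ob : Type) := Addcat {
  addcat_lin :> klincat k Ob;
  addcatP : is_additive addcat_lin
}.

Record klfunctor k ObC ObD (C : klincat k ObC) (D : klincat k ObD) := Klfunctor {
  fob :> ObC -> ObD;
  fmor : forall X Y, C X Y -> D (fob X) (fob Y);
  fmor1 : forall X, fmor (idm C X) = idm D (fob X);
  fmorM : forall X Y Z (g : C Y Z) (f : C X Y), fmor (g \oc f) = fmor g \oc fmor f;
  fmor_lin : forall X Y a (f g : C X Y), fmor (a *: f + g) = a *: fmor f + fmor g
}.

(* An automorphism in the strict sense: both composites are equal to the identity functor,
   on objects and (along these equalities) on morphisms. *)
Record automorphism k Ob (C : klincat k Ob) := Automorphism {
  autf :> klfunctor C C;
  auti : klfunctor C C;
  autK : forall X, auti (autf X) = X;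
  autiK : forall X, autf (auti X) = X;
  autKm : forall X Y (f : C X Y),
    eqm C (autK Y) \oc fmor auti (fmor autf f) = f \oc eqm C (autK X);
  autiKm : forall X Y (f : C X Y),
    eqm C (autiK Y) \oc fmor autf (fmor auti f) = f \oc eqm C (autiK X)
}.

Definition autV k Ob (C : klincat k Ob) (A : automorphism C) : automorphism C :=
  Automorphism (@autiKm _ _ _ A) (@autKm _ _ _ A).

Record rmod k Ob (T : klincat k Ob) := Rmod {
  mob :> Ob -> lmodType k;
  mact : forall X Y, T X Y -> mob Y -> mob X;
  mact1 : forall X x, mact (idm T X) x = x;
  mactM : forall X Y Z (g : T Y Z) (f : T X Y) z, mact (g \oc f) z = mact f (mact g z);
  mact_linl : forall X Y a (f g : T X Y) y,
    mact (a *: f + g) y = a *: mact f y + mact g y;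
  mact_linr : forall X Y (f : T X Y) a y z,
    mact f (a *: y + z) = a *: mact f y + mact f z
}.

Record mhom k Ob (T : klincat k Ob) (M N : rmod T) := Mhom {
  mfun :> forall X, M X -> N X;
  mfun_lin : forall X a (x y : M X), mfun (a *: x + y) = a *: mfun x + mfun y;
  mfun_nat : forall X Y (f : T X Y) y, mfun (mact f y) = mact f (mfun y)
}.

Section ModuleMorphisms.
Variables (k : comPzRingType) (Ob : Type) (T : klincat k Ob).
Implicit Types M N P : rmod T.

Lemma mhomP M N (f g : mhom M N) : (forall X x, f X x = g X x) -> f = g.
Proof.
case: f g => [f f1 f2] [g g1 g2] /= fg.
have e : f = g by apply: functional_extensionality_dep => X; exact: funext (fg X).
by case: _ / e in g1 g2 fg *; congr Mhom; exact: Prop_irrelevance.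
Qed.

Lemma mhom_app M N (f g : mhom M N) : f = g -> forall X x, f X x = g X x.
Proof. by move->. Qed.

Lemma mhom0_subproof M N : (forall X a (x y : M X), 0 = a *: 0 + 0 :> N X) *
  (forall X Y (f : T X Y) (y : M Y), 0 = mact f 0 :> N X).
Proof.
split=> [X a x y|X Y f y]; first by rewrite scaler0 addr0.
by have := mact_linr f (-1) 0 (0 : N Y); rewrite scaler0 addr0 scaleN1r addNr.
Qed.
Definition mhom0 M N : mhom M N :=
  Mhom (fst (mhom0_subproof M N)) (snd (mhom0_subproof M N)).

Lemma mactD M X Y (f : T X Y) (y z : M Y) : mact f (y + z) = mact f y + mact f z.
Proof. by have := mact_linr f 1 y z; rewrite !scale1r. Qed.

Lemma mactZ M X Y (f : T X Y) a (y : M Y) : mact f (a *: y) = a *: mact f y.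
Proof.
by have := mact_linr f a y 0; rewrite addr0 -(snd (mhom0_subproof M M) _ _ f 0) addr0.
Qed.

Lemma mhom_comb_subproof M N a (f g : mhom M N) :
  (forall X b (x y : M X), a *: f X (b *: x + y) + g X (b *: x + y) =
     b *: (a *: f X x + g X x) + (a *: f X y + g X y)) *
  (forall X Y (h : T X Y) (y : M Y), a *: f X (mact h y) + g X (mact h y) =
     mact h (a *: f Y y + g Y y)).
Proof.
split=> [X b x y|X Y h y]; last by rewrite !mfun_nat mact_linr.
by rewrite !mfun_lin !scalerDr !scalerA mulrC addrACA.
Qed.
Definition mhom_comb M N a (f g : mhom M N) : mhom M N :=
  Mhom (fst (mhom_comb_subproof a f g)) (snd (mhom_comb_subproof a f g)).

HB.instance Definition _ M N := gen_eqMixin (mhom M N).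
HB.instance Definition _ M N := gen_choiceMixin (mhom M N).

Definition mhom_add M N (f g : mhom M N) := mhom_comb 1 f g.
Definition mhom_opp M N (f : mhom M N) := mhom_comb (-1) f (mhom0 M N).
Definition mhom_scale M N a (f : mhom M N) := mhom_comb a f (mhom0 M N).

Fact mhom_addA M N : associative (@mhom_add M N).
Proof. by move=> f g h; apply: mhomP => X x /=; rewrite !scale1r addrA. Qed.
Fact mhom_addC M N : commutative (@mhom_add M N).
Proof. by move=> f g; apply: mhomP => X x /=; rewrite !scale1r addrC. Qed.
Fact mhom_add0 M N : left_id (mhom0 M N) (@mhom_add M N).
Proof. by move=> f; apply: mhomP => X x /=; rewrite scaler0 add0r. Qed.
Fact mhom_addN M N : left_inverse (mhom0 M N) (@mhom_opp M N) (@mhom_add M N).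
Proof. by move=> f; apply: mhomP => X x /=; rewrite scale1r addr0 scaleN1r addNr. Qed.
HB.instance Definition _ M N := GRing.isZmodule.Build (mhom M N)
  (@mhom_addA M N) (@mhom_addC M N) (@mhom_add0 M N) (@mhom_addN M N).

Lemma mhom_addE M N (f g : mhom M N) X (x : M X) : (f + g) X x = f X x + g X x.
Proof. by rewrite [LHS]/= scale1r. Qed.

Lemma mhom_oppE M N (f : mhom M N) X (x : M X) : (- f) X x = - f X x.
Proof. by rewrite [LHS]/= addr0 scaleN1r. Qed.

Lemma mfunD M N (f : mhom M N) X (x y : M X) : f X (x + y) = f X x + f X y.
Proof. by have := mfun_lin f 1 x y; rewrite !scale1r. Qed.

Lemma mhom_scaleE M N a (f : mhom M N) X (x : M X) : mhom_scale a f X x = a *: f X x.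
Proof. by rewrite /= addr0. Qed.

Fact mhom_scaleA M N a b (f : mhom M N) :
  mhom_scale a (mhom_scale b f) = mhom_scale (a * b) f.
Proof. by apply: mhomP => X x; rewrite !mhom_scaleE scalerA. Qed.
Fact mhom_scale1 M N : left_id 1 (@mhom_scale M N).
Proof. by move=> f; apply: mhomP => X x; rewrite mhom_scaleE scale1r. Qed.
Fact mhom_scaleDr M N : right_distributive (@mhom_scale M N) +%R.
Proof.
by move=> a f g; apply: mhomP => X x; rewrite mhom_addE !mhom_scaleE mhom_addE scalerDr.
Qed.
Fact mhom_scaleDl M N (f : mhom M N) : {morph (@mhom_scale M N)^~ f : a b / a + b}.
Proof. by move=> a b; apply: mhomP => X x; rewrite mhom_addE !mhom_scaleE scalerDl. Qed.
HB.instance Definition _ M N := GRing.Zmodule_isLmodule.Build k (mhom M N)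
  (@mhom_scaleA M N) (@mhom_scale1 M N) (@mhom_scaleDr M N) (@mhom_scaleDl M N).

Lemma mhom_combE M N a (f g : mhom M N) X (x : M X) :
  (a *: f + g) X x = a *: f X x + g X x.
Proof. by rewrite mhom_addE mhom_scaleE. Qed.

Definition mid M : mhom M M :=
  @Mhom k Ob T M M (fun X x => x) (fun _ _ _ _ => erefl) (fun _ _ _ _ => erefl).

Lemma mcomp_subproof M N P (g : mhom N P) (f : mhom M N) :
  (forall X a (x y : M X), g X (f X (a *: x + y)) = a *: g X (f X x) + g X (f X y)) *
  (forall X Y (h : T X Y) (y : M Y), g X (f X (mact h y)) = mact h (g Y (f Y y))).
Proof. by split=> *; rewrite ?mfun_lin ?mfun_nat. Qed.
Definition mcomp M N P (g : mhom N P) (f : mhom M N) : mhom M P :=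
  Mhom (fst (mcomp_subproof g f)) (snd (mcomp_subproof g f)).

Definition surjectivem M N (f : mhom M N) := forall X (y : N X), exists x, f X x = y.
Definition injectivem M N (f : mhom M N) := forall X, injective (f X).
Definition exactm M N P (f : mhom M N) (g : mhom N P) :=
  forall X (y : N X), g X y = 0 <-> exists x, f X x = y.

End ModuleMorphisms.

Notation "g \mo f" := (mcomp g f) (at level 40, left associativity).

Section Yoneda.
Variables (k : comPzRingType) (Ob : Type) (T : klincat k Ob).

Definition yo_rmod (X : Ob) : rmod T :=
  @Rmod k Ob T (fun Z => T Z X) (fun Z W f g => g \oc f)
    (fun Z g => compm1 g) (fun A B C g f z => compA z g f)
    (fun A B a f g y => comp_linr y a f g) (fun A B f a y z => comp_linl f a y z).

Definition yom_rmod X Y (f : T X Y) : mhom (yo_rmod X) (yo_rmod Y) :=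
  @Mhom k Ob T (yo_rmod X) (yo_rmod Y) (fun Z g => f \oc g)
    (fun Z a g h => comp_linr f a g h) (fun A B g h => compA f h g).

Definition fin_presented (M : rmod T) := exists X Y (f : T X Y) (p : mhom (yo_rmod Y) M),
  surjectivem p /\ exactm (yom_rmod f) p.

Record fpmod := Fpmod { fp_mod :> rmod T; fp_modP : fin_presented fp_mod }.

Fact yo_subproof X : fin_presented (yo_rmod X).
Proof.
exists X, X, 0, (mid (yo_rmod X)); split=> [Z y|Z y]; first by exists y.
by split=> [/= ->|[x <-]]; [exists 0 => /=|rewrite /=]; rewrite comp0m.
Qed.
Definition yo X : fpmod := Fpmod (yo_subproof X).

Definition yom X Y (f : T X Y) : mhom (yo X) (yo Y) := yom_rmod f.

Fact mcompA (M N P Q : fpmod) (h : mhom P Q) (g : mhom N P) (f : mhom M N) :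
  h \mo (g \mo f) = (h \mo g) \mo f.
Proof. exact: mhomP. Qed.
Fact mcomp1m (M N : fpmod) (f : mhom M N) : mid N \mo f = f.
Proof. exact: mhomP. Qed.
Fact mcompm1 (M N : fpmod) (f : mhom M N) : f \mo mid M = f.
Proof. exact: mhomP. Qed.
Fact mcomp_linl (M N P : fpmod) (f : mhom M N) a (g g' : mhom N P) :
  (a *: g + g') \mo f = a *: (g \mo f) + g' \mo f.
Proof. by apply: mhomP => X x; rewrite mhom_combE [LHS]mhom_combE. Qed.
Fact mcomp_linr (M N P : fpmod) (g : mhom N P) a (f f' : mhom M N) :
  g \mo (a *: f + f') = a *: (g \mo f) + g \mo f'.
Proof. by apply: mhomP => X x; rewrite mhom_combE /= -mfun_lin -mhom_combE. Qed.

Definition modcat : klincat k fpmod :=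
  @Klincat k fpmod (fun M N => mhom M N : lmodType k) (fun M => mid M)
    (fun M N P g f => g \mo f) mcompA mcomp1m mcompm1 mcomp_linl mcomp_linr.

End Yoneda.

Section Suspension.
Variables (k : comPzRingType) (Ob : Type) (T : klincat k Ob).
Implicit Type A : automorphism T.

(* The extension of A to modules, A M = M(A^-1 -). *)
Definition sus_rmod A (M : rmod T) : rmod T :=
  @Rmod k Ob T (fun X => M (auti A X)) (fun X Y f y => mact (fmor (auti A) f) y)
    (fun X x => etrans (congr1 (fun f => mact f x) (fmor1 (auti A) X)) (mact1 x))
    (fun X Y Z g f z => etrans (congr1 (fun h => mact h z) (fmorM (auti A) g f))
                               (mactM (fmor (auti A) g) (fmor (auti A) f) z))
    (fun X Y a f g y => etrans (congr1 (fun h => mact h y) (fmor_lin (auti A) a f g))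
                               (mact_linl a (fmor (auti A) f) (fmor (auti A) g) y))
    (fun X Y f a y z => mact_linr (fmor (auti A) f) a y z).

Definition susm A (M N : rmod T) (f : mhom M N) : mhom (sus_rmod A M) (sus_rmod A N) :=
  @Mhom k Ob T (sus_rmod A M) (sus_rmod A N) (fun X x => f (auti A X) x)
    (fun X a x y => mfun_lin f a x y)
    (fun X Y g y => mfun_nat f (fmor (auti A) g) y).

Lemma sus_yo_subproof A X :
  (forall Z a (x y : T (auti A Z) X),
     fmor A (a *: x + y) \oc eqm T (esym (autiK A Z)) =
     a *: (fmor A x \oc eqm T (esym (autiK A Z))) + fmor A y \oc eqm T (esym (autiK A Z))) *
  (forall Z W (f : T Z W) (y : T (auti A W) X),
     fmor A (y \oc fmor (auti A) f) \oc eqm T (esym (autiK A Z)) =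
     fmor A y \oc eqm T (esym (autiK A W)) \oc f).
Proof.
split=> [Z a x y|Z W f y]; first by rewrite fmor_lin comp_linl.
rewrite fmorM -!compA; congr (_ \oc _).
have := autiKm A f => /(congr1 (fun h => eqm T (esym (autiK A W)) \oc h)).
rewrite compA eqmK comp1m => ->.
by rewrite -!compA eqmVK compm1.
Qed.

(* The canonical isomorphism A T(-,X) = T(A^-1 -,X) -> T(-,A X). *)
Definition sus_yo A X : mhom (sus_rmod A (yo T X)) (yo T (A X)) :=
  @Mhom k Ob T (sus_rmod A (yo T X)) (yo T (A X))
    (fun Z (g : T (auti A Z) X) => fmor A g \oc eqm T (esym (autiK A Z)))
    (fst (sus_yo_subproof A X)) (snd (sus_yo_subproof A X)).
End Suspension.

Section SuspensionFp.
Variables (k : comPzRingType) (Ob : Type) (T : klincat k Ob).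
Implicit Type A : automorphism T.

Lemma eqm_trans X Y Z (e : X = Y) (e' : Y = Z) :
  eqm T e' \oc eqm T e = eqm T (etrans e e').
Proof. by case: _ / e'; rewrite /= comp1m. Qed.

Lemma fmor_eqm (F : klfunctor T T) X Y (e : X = Y) :
  fmor F (eqm T e) = eqm T (congr1 F e).
Proof. by case: _ / e; rewrite /= fmor1. Qed.

Lemma sus_yoV_subproof A X :
  (forall Z a (x y : T Z (A X)),
     eqm T (autK A X) \oc fmor (auti A) (a *: x + y) =
     a *: (eqm T (autK A X) \oc fmor (auti A) x) + eqm T (autK A X) \oc fmor (auti A) y) *
  (forall Z W (f : T Z W) (y : T W (A X)),
     eqm T (autK A X) \oc fmor (auti A) (y \oc f) =
     eqm T (autK A X) \oc fmor (auti A) y \oc fmor (auti A) f).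
Proof. by split=> *; rewrite ?fmor_lin ?comp_linr // fmorM compA. Qed.

Definition sus_yoV A X : mhom (yo T (A X)) (sus_rmod A (yo T X)) :=
  @Mhom k Ob T (yo T (A X)) (sus_rmod A (yo T X))
    (fun Z (g : T Z (A X)) => eqm T (autK A X) \oc fmor (auti A) g)
    (fst (sus_yoV_subproof A X)) (snd (sus_yoV_subproof A X)).

Lemma sus_yoK A X : sus_yo A X \mo sus_yoV A X = mid _.
Proof.
apply: mhomP => Z g /=; rewrite fmorM fmor_eqm.
rewrite (Prop_irrelevance (congr1 _ _) (autiK A (A X))) autiKm -compA eqmVK.
exact: compm1.
Qed.

Lemma sus_yoVK A X : sus_yoV A X \mo sus_yo A X = mid _.
Proof.
apply: mhomP => Z g /=; rewrite fmorM fmor_eqm compA autKm -compA eqm_trans.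
by rewrite (Prop_irrelevance (etrans _ _) erefl) compm1.
Qed.

Lemma sus_yoKE A X Z (g : T Z (A X)) : sus_yo A X Z (sus_yoV A X Z g) = g.
Proof. exact: (mhom_app (sus_yoK A X) g). Qed.

Lemma sus_yoVKE A X Z (x : T (auti A Z) X) : sus_yoV A X Z (sus_yo A X Z x) = x.
Proof. exact: (mhom_app (sus_yoVK A X) x). Qed.

Lemma sus_yo_nat A X Y (f : T X Y) : sus_yo A Y \mo susm A (yom f) = yom (fmor A f) \mo sus_yo A X.
Proof. by apply: mhomP => Z g /=; rewrite fmorM compA. Qed.

Fact sus_subproof A (M : fpmod T) : fin_presented (sus_rmod A M).
Proof.
case: M => M /= [X [Y [f [p [sp ep]]]]].
exists (A X), (A Y), (fmor A f), (susm A p \mo sus_yoV A Y); split=> [Z z|Z g].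
  have [x xz] := sp _ z; exists (sus_yo A Y Z x).
  by rewrite -xz; congr (p _ _); exact: (mhom_app (sus_yoVK A Y) x).
split=> [/= /ep [x xz]|[x <-]].
  exists (sus_yo A X Z x).
  by rewrite -[RHS](mhom_app (sus_yoK A Y) g) /= -xz /= fmorM compA.
apply/ep; exists (sus_yoV A X Z x) => /=.
by rewrite fmorM !compA autKm.
Qed.

Definition sus A (M : fpmod T) : fpmod T := Fpmod (sus_subproof A M).

Definition susf A (M N : fpmod T) (f : mhom M N) : mhom (sus A M) (sus A N) := susm A f.

(* The canonical isomorphism A A^-1 M -> M. *)
Definition susK A (M : fpmod T) : mhom (sus A (sus (autV A) M)) M.
Proof.
apply: (@Mhom k Ob T (sus A (sus (autV A) M)) M
  (fun X (x : M (A (auti A X))) => mact (eqm T (esym (autiK A X))) x)).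
- by move=> X a x y; rewrite mact_linr.
- move=> X Y f y /=; rewrite -!mactM; congr mact.
  have := autiKm A f => /(congr1 (fun h => eqm T (esym (autiK A Y)) \oc h)).
  rewrite compA eqmK comp1m => ->.
  by rewrite -!compA eqmVK compm1.
Defined.

End SuspensionFp.

Section Stable.
Variables (k : comPzRingType) (Ob : Type) (T : addcat k Ob).
Implicit Types M N P : fpmod T.

Definition null M N : {pred mhom M N} := fun f =>
  `[< exists X (a : mhom M (yo T X)) (b : mhom (yo T X) N), f = b \mo a >].

Lemma null_closed M N : zmod_closed (@null M N).
Proof.
have [[Z _] bip] := addcatP T.
split=> [|f g /asboolP[X [a [b ->]]] /asboolP[Y [c [d ->]]]]; apply/asboolP.
  by exists Z, 0, 0; apply: mhomP.
have [B [i1 [i2 [p1 [p2 [e1 e2 e12 e21 _]]]]]] := bip X Y.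
exists B, (yom i1 \mo a + yom i2 \mo c), (b \mo yom p1 - d \mo yom p2).
apply: mhomP => W x.
rewrite [RHS]/= !mhom_addE !mhom_oppE /= !comp_linr !scale1r addr0 scaleN1r.
by rewrite !compA e1 e2 e12 e21 !comp1m !comp0m addr0 add0r.
Qed.

HB.instance Definition _ M N :=
  GRing.isZmodClosed.Build (mhom M N) (@null M N) (@null_closed M N).

(* Morphisms of the stable category, the quotient of mod(T) by null. *)
Definition sHom M N := Quotient.quot (@null M N).

Definition scl M N (f : mhom M N) : sHom M N := \pi_(sHom M N) f.
Definition sid M : sHom M M := scl (mid M).
Definition scomp M N P (g : sHom N P) (f : sHom M N) : sHom M P :=
  scl (repr g \mo repr f).

(* Short exact sequences M >-> T(-,X) ->> N. *)
Record ses M N := Ses {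
  ses_ob : Ob;
  ses_i : mhom M (yo T ses_ob);
  ses_p : mhom (yo T ses_ob) N;
  ses_inj : injectivem ses_i;
  ses_exact : exactm ses_i ses_p;
  ses_surj : surjectivem ses_p
}.

(* f and h are the ends of a map of short exact sequences s -> s'. *)
Definition ses_map M N M' N' (s : ses M N) (s' : ses M' N')
    (f : sHom M M') (h : sHom N N') :=
  exists f0 g h0, [/\ scl f0 = f, scl h0 = h,
    g \mo ses_i s = ses_i s' \mo f0 & h0 \mo ses_p s = ses_p s' \mo g].

(* If mod(T) is Frobenius abelian, f and h determine each other. *)
Definition ses_push M N M' N' (s : ses M N) (s' : ses M' N') (f : sHom M M') :
  sHom N N' := xget 0 [set h | ses_map s s' f h].
Definition ses_pull M N M' N' (s : ses M N) (s' : ses M' N') (h : sHom N N') :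
  sHom M M' := xget 0 [set f | ses_map s s' f h].

(* Every choice of cosyzygies, and of syzygies for the negative powers of S, is
   allowed; choices exist when mod(T) is Frobenius abelian and T idempotent
   complete, since every object is then a quotient and a subobject of a
   representable. *)
Definition cosyzygies := forall M, {SM : fpmod T & ses M SM}.
Definition syzygies := forall M, {OM : fpmod T & ses OM M}.

End Stable.

Notation "g \so f" := (scomp g f) (at level 40, left associativity).

Section IntegerPowers.
Variables (k : comPzRingType) (Ob : Type) (T : addcat k Ob).
Implicit Types M N P : fpmod T.

(* A self-equivalence F with a quasi-inverse G: F is indexed by false, G by true. *)
Record sequiv := Sequiv {
  sob :> bool -> fpmod T -> fpmod T;
  smor : forall s M N, sHom M N -> sHom (sob s M) (sob s N);
  scancel : forall s M, sHom (sob s (sob (~~ s) M)) M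
}.
Arguments smor F s {M N} : rename.

Definition zneg (n : int) : bool := if n is Negz _ then true else false.

Definition spow (F : sequiv) (n : int) M : fpmod T := iter (absz n) (F (zneg n)) M.

Fixpoint smor_iter (F : sequiv) s p M N (f : sHom M N) :
    sHom (iter p (F s) M) (iter p (F s) N) :=
  match p return sHom (iter p (F s) M) (iter p (F s) N) with
  | 0%N => f
  | q.+1 => smor F s (smor_iter F s q f)
  end.

Definition smor_pow F n M N (f : sHom M N) : sHom (spow F n M) (spow F n N) :=
  smor_iter F (zneg n) (absz n) f.
Arguments smor_pow F n {M N} : rename.

(* n + 1 if s = false, n - 1 if s = true; defined by cases so that
   F s (spow F n M) -> spow F (zstep s n) M below needs no cast. *)
Definition zstep (s : bool) (n : int) : int :=
  match s, n with
  | false, Posz p => Posz p.+1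
  | false, Negz 0 => Posz 0
  | false, Negz p.+1 => Negz p
  | true, Posz 0 => Negz 0
  | true, Posz p.+1 => Posz p
  | true, Negz p => Negz p.+1
  end.

Lemma zstepE s n : zstep s n = n + (-1) ^+ s.
Proof. by case: s n => [] [[|p]|[|p]] //=; rewrite ?expr1 ?expr0; lia. Qed.

Lemma iter_zstepE n m : iter (absz m) (zstep (zneg m)) n = m + n.
Proof.
have H s p : iter p (zstep s) n = n + (-1) ^+ s *+ p.
  by elim: p => [|p IH]; rewrite ?addr0 // iterS IH zstepE mulrSr addrA.
by case: m => p; rewrite H /= ?expr0 ?expr1; lia.
Qed.

Definition sstep (F : sequiv) s n M : sHom (F s (spow F n M)) (spow F (zstep s n) M) :=
  match s, n return sHom (F s (spow F n M)) (spow F (zstep s n) M) with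
  | false, Posz p => sid _
  | false, Negz 0 => scancel F false M
  | false, Negz p.+1 => scancel F false (spow F (Negz p) M)
  | true, Posz 0 => sid _
  | true, Posz p.+1 => scancel F true (spow F (Posz p) M)
  | true, Negz p => sid _
  end.

Fixpoint spow_iter (F : sequiv) s p n M :
    sHom (iter p (F s) (spow F n M)) (spow F (iter p (zstep s) n) M) :=
  match p return sHom (iter p (F s) (spow F n M)) (spow F (iter p (zstep s) n) M) with
  | 0%N => sid _
  | q.+1 => sstep F s (iter q (zstep s) n) M \so smor F s (spow_iter F s q n M)
  end.

(* The canonical isomorphism F^m F^n -> F^(m + n). *)
Definition spowD F m n M : sHom (spow F m (spow F n M)) (spow F (m + n) M) :=
  ecast l (sHom (spow F m (spow F n M)) (spow F l M)) (iter_zstepE n m)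
    (spow_iter F (zneg m) (absz m) n M).

(* Given natural morphisms F G -> G F for two self-equivalences and their
   quasi-inverses, the induced F^m G^n -> G^n F^m. *)
Section Commutation.
Variables (F G : sequiv) (c : forall s t M, sHom (F s (G t M)) (G t (F s M))).

Fixpoint scomm_iter1 s t q M : sHom (F s (iter q (G t) M)) (iter q (G t) (F s M)) :=
  match q return sHom (F s (iter q (G t) M)) (iter q (G t) (F s M)) with
  | 0%N => sid _
  | r.+1 => smor G t (scomm_iter1 s t r M) \so c s t (iter r (G t) M)
  end.

Fixpoint scomm_iter s t p q M :
    sHom (iter p (F s) (iter q (G t) M)) (iter q (G t) (iter p (F s) M)) :=
  match p return
    sHom (iter p (F s) (iter q (G t) M)) (iter q (G t) (iter p (F s) M)) with
  | 0%N => sid _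
  | r.+1 => scomm_iter1 s t q (iter r (F s) M) \so smor F s (scomm_iter s t r q M)
  end.

Definition spow_comm m n M : sHom (spow F m (spow G n M)) (spow G n (spow F m M)) :=
  scomm_iter (zneg m) (zneg n) (absz m) (absz n) M.
End Commutation.

End IntegerPowers.

Section TateExt.
Variables (k : comPzRingType) (Ob : Type) (T : addcat k Ob).
Variables (A : automorphism T) (cs : cosyzygies T) (sy : syzygies T).
Implicit Types M N P : fpmod T.

Fact ses_sus_inj (B : automorphism T) M N (s : ses M N) :
  injectivem (sus_yo B (ses_ob s) \mo susm B (ses_i s)).
Proof.
move=> Z x y /(congr1 (sus_yoV B (ses_ob s) Z)).
move/(etrans (esym (sus_yoVKE (ses_i s (auti B Z) x)))) => e.
exact: (ses_inj (etrans e (sus_yoVKE _))).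
Qed.

Fact ses_sus_exact (B : automorphism T) M N (s : ses M N) :
  exactm (sus_yo B (ses_ob s) \mo susm B (ses_i s))
    (susm B (ses_p s) \mo sus_yoV B (ses_ob s)).
Proof.
move=> Z g; split=> [/ses_exact [x xg]|[x <-]].
  by exists x; rewrite -[RHS]sus_yoKE -xg.
apply: etrans (congr1 (ses_p s _) (sus_yoVKE _)) _.
by apply/ses_exact; exists x.
Qed.

Fact ses_sus_surj (B : automorphism T) M N (s : ses M N) :
  surjectivem (susm B (ses_p s) \mo sus_yoV B (ses_ob s)).
Proof.
move=> Z y; have [x xy] := ses_surj s (y : N (auti B Z)).
exists (sus_yo B (ses_ob s) Z x); rewrite -xy.
exact: (congr1 (ses_p s _) (sus_yoVKE _)).
Qed.

(* B M >-> B T(-,X) = T(-,B X) ->> B N *)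
Definition ses_sus (B : automorphism T) M N (s : ses M N) : ses (sus B M) (sus B N) :=
  @Ses k Ob T (sus B M) (sus B N) (B (ses_ob s))
    (sus_yo B (ses_ob s) \mo susm B (ses_i s)) (susm B (ses_p s) \mo sus_yoV B (ses_ob s))
    (@ses_sus_inj B M N s) (@ses_sus_exact B M N s) (@ses_sus_surj B M N s).

Definition auts (s : bool) : automorphism T := if s then autV A else A.

Definition Sigma : sequiv T := @Sequiv k Ob T
  (fun s M => sus (auts s) M)
  (fun s M N f => scl (susf (auts s) (repr f)))
  (fun s M => match s return sHom (sus (auts s) (sus (auts (~~ s)) M)) M with
              | false => scl (susK A M)
              | true => scl (susK (autV A) M : mhom (sus (autV A) (sus A M)) M)
              end).

(* S on objects, its morphism part, and S S^-1 M -> M, S^-1 S M -> M; the latter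
   are induced by maps of short exact sequences which are the identity on
   S^-1 M, respectively on S M. *)
Definition Sob (s : bool) M : fpmod T := if s then projT1 (sy M) else projT1 (cs M).

Definition Scosyz : sequiv T := @Sequiv k Ob T Sob
  (fun s M N => match s return sHom M N -> sHom (Sob s M) (Sob s N) with
     | false => fun f => ses_push (projT2 (cs M)) (projT2 (cs N)) f
     | true => fun f => ses_pull (projT2 (sy M)) (projT2 (sy N)) f
     end)
  (fun s M => match s return sHom (Sob s (Sob (~~ s) M)) M with
     | false => ses_push (projT2 (cs (Sob true M))) (projT2 (sy M)) (sid _)
     | true => ses_pull (projT2 (sy (Sob false M))) (projT2 (cs M)) (sid _)
     end).

(* The isomorphism sigma : Sigma S M -> S Sigma M, together with its analogues
   for Sigma^-1 and S^-1. *)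
Definition sigma (s t : bool) M : sHom (Sigma s (Scosyz t M)) (Scosyz t (Sigma s M)) :=
  match t return sHom (Sigma s (Scosyz t M)) (Scosyz t (Sigma s M)) with
  | false => ses_push (ses_sus (auts s) (projT2 (cs M))) (projT2 (cs (Sigma s M))) (sid _)
  | true => ses_pull (ses_sus (auts s) (projT2 (sy M))) (projT2 (sy (Sigma s M))) (sid _)
  end.

(* Tate's Ext^{n,m}(M,N) = stable Hom(M, S^n Sigma^m N). *)
Definition Ext (n m : int) M N := sHom M (spow Scosyz n (spow Sigma m N)).

Definition ext_cast n n' m m' (en : n = n') (em : m = m') M N (e : Ext n m M N) :
    Ext n' m' M N :=
  ecast l (Ext l m' M N) en (ecast l (Ext n l M N) em e).

(* Extended Yoneda product: for g : L -> S^q Sigma^b M and f : M -> S^p Sigma^a N,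
   L -> S^q Sigma^b M -> S^q Sigma^b S^p Sigma^a N = S^(q+p) Sigma^(b+a) N. *)
Definition yprod p a q b L M N (f : Ext p a M N) (g : Ext q b L M) :
    Ext (p + q) (a + b) L N :=
  ext_cast (addrC q p) (addrC b a)
    (spowD Scosyz q p (spow Sigma (b + a) N)
     \so smor_pow Scosyz q (smor_pow Scosyz p (spowD Sigma b a N))
     \so smor_pow Scosyz q (spow_comm sigma b p (spow Sigma a N))
     \so smor_pow Scosyz q (smor_pow Sigma b f) \so g).

Definition ext1 M : Ext 0 0 M M := sid M.

(* Morphisms of degree n in mod(T_Sigma) = mod(T)_Sigma. *)
Definition gHom (n : int) M N := mhom M (spow Sigma n N).

(* The bimodule structure of Ext^{n,*} over mod(T_Sigma). *)
Definition ext_lact n m q L M N (g : gHom q M N) (e : Ext n m L M) : Ext n (q + m) L N :=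
  ext_cast (add0r n) erefl (yprod (scl g : Ext 0 q M N) e).
Definition ext_ract n m q L M N (e : Ext n m M N) (g : gHom q L M) : Ext n (m + q) L N :=
  ext_cast (addr0 n) erefl (yprod e (scl g : Ext 0 q L M)).

(* HH^{0,m}(mod(T_Sigma), Ext^{n,*}), with the Koszul sign (-1)^(m q). *)
Record HH0_graded (n m : int) := HH0Graded {
  hhg :> forall M, Ext n m M M;
  hhgP : forall q M N (g : gHom q M N),
    ext_lact g (hhg M) *~ (-1) ^+ absz (m * q) =
    ext_cast erefl (addrC m q) (ext_ract (hhg N) g)
}.

(* HH^{0,m}(mod(T), Ext^{n,*}), mod(T) being concentrated in degree 0. *)
Record HH0_deg0 (n m : int) := HH0Deg0 {
  hh :> forall M, Ext n m M M;
  hhP : forall M N (g : mhom M N),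
    ext_lact (g : gHom 0 M N) (hh M) =
    ext_cast erefl (addrC m 0) (ext_ract (hh N) (g : gHom 0 M N))
}.

Fact istar_subproof n m (phi : HH0_graded n m) M N (g : mhom M N) :
  ext_lact (g : gHom 0 M N) (phi M) =
  ext_cast erefl (addrC m 0) (ext_ract (phi N) (g : gHom 0 M N)).
Proof. by rewrite -hhgP mulr0 expr0. Qed.

Definition istar n m (phi : HH0_graded n m) : HH0_deg0 n m :=
  HH0Deg0 (@istar_subproof n m phi).

Lemma istar_inj n m : injective (@istar n m).
Proof.
move=> [f fP] [g gP] /(congr1 (@hh n m)) /= e.
by case: _ / e in gP *; congr HH0Graded; exact: Prop_irrelevance.
Qed.

(* Invertible homogeneous elements of the bigraded ring HH^{0,*}(mod(T_Sigma), Ext),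
   whose multiplication is objectwise. *)
Definition hh_unit n m (phi : HH0_graded n m) :=
  exists psi : HH0_graded (- n) (- m), forall M,
    ext_cast (addrN n) (addrN m) (yprod (phi M) (psi M)) = ext1 M /\
    ext_cast (addNr n) (addNr m) (yprod (psi M) (phi M)) = ext1 M.

Notation S := (Scosyz false).
Notation "'Smap' f" := (smor Scosyz false f) (at level 10, f at level 9).

(* The transformation delta_M : Sigma M -> S^3 M corresponding to
   phi_M : M -> S^3 Sigma^-1 M: the composite
   Sigma M -> Sigma S S S Sigma^-1 M -> S S S Sigma Sigma^-1 M -> S S S M. *)
Definition delta (phi : HH0_deg0 3%:Z (Negz 0)) M : sHom (Sigma false M) (S (S (S M))) :=
  let N := Sigma true M in
  Smap (Smap (Smap (scancel Sigma false M)))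
  \so Smap (Smap (sigma false false N))
  \so Smap (sigma false false (S N))
  \so sigma false false (S (S N))
  \so smor Sigma false (phi M).

Definition heller (phi : HH0_deg0 3%:Z (Negz 0)) := forall M,
  Smap (delta phi M) \so sigma false false M + delta phi (S M) = 0.

Record triangle := Triangle {
  triX : Ob; triY : Ob; triC : Ob;
  trif : T triX triY;
  trii : T triY triC;
  triq : T triC (A triX)
}.

Definition triangle_iso (t t' : triangle) :=
  exists (a : T (triX t) (triX t')) (b : T (triY t) (triY t')) (c : T (triC t) (triC t')),
  [/\ is_iso a, is_iso b & is_iso c] /\
  [/\ trif t' \oc a = b \oc trif t, trii t' \oc b = c \oc trii t
    & triq t' \oc c = fmor A a \oc triq t].

Definition rotate (t : triangle) : triangle :=
  @Triangle (triY t) (triC t) (A (triX t)) (trii t) (triq t) (- fmor A (trif t)).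

(* All the axioms of a triangulated category but the octahedral one. *)
Definition is_puppe (D : set triangle) :=
  [/\ forall t t', triangle_iso t t' -> D t -> D t',
      forall X Z, is_zero_object T Z -> D (@Triangle X X Z (idm T X) 0 0),
      forall X Y (f : T X Y), exists C (i : T Y C) (q : T C (A X)), D (Triangle f i q),
      forall t, D t <-> D (rotate t)
    & forall t t' (a : T (triX t) (triX t')) (b : T (triY t) (triY t')),
        D t -> D t' -> trif t' \oc a = b \oc trif t ->
        exists c : T (triC t) (triC t'),
          trii t' \oc b = c \oc trii t /\ triq t' \oc c = fmor A a \oc triq t].

(* The exact sequence N >-> E1 -> E2 -> E3 ->> M represents the stable class
   e : M -> S^3 N: the identity of N extends to a map into the splicing of the
   chosen short exact sequences starting at N, S N and S^2 N, inducing e. *)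
Definition represents M N E1 E2 E3 (a : mhom N E1) (f : mhom E1 E2) (g : mhom E2 E3)
    (l : mhom E3 M) (e : sHom M (S (S (S N)))) :=
  [/\ injectivem a, exactm a f, exactm f g, exactm g l & surjectivem l] /\
  let s1 := projT2 (cs N) in let s2 := projT2 (cs (S N)) in
  let s3 := projT2 (cs (S (S N))) in
  exists h1 h2 h3 (h : mhom M (S (S (S N)))),
  [/\ h1 \mo a = ses_i s1,
      h2 \mo f = ses_i s2 \mo ses_p s1 \mo h1,
      h3 \mo g = ses_i s3 \mo ses_p s2 \mo h2,
      h \mo l = ses_p s3 \mo h3
    & scl h = e].

(* l and b are a factorization of T(-,q) through its image M; the condition on a
   says that b is Sigma a, under Sigma T(-,X) = T(-,Sigma X). *)
Definition phi_exact (phi : HH0_deg0 3%:Z (Negz 0)) (t : triangle) :=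
  exists (M : fpmod T) (l : mhom (yo T (triC t)) M) (b : mhom M (yo T (A (triX t))))
         (a : mhom (Sigma true M) (yo T (triX t))),
  [/\ surjectivem l, injectivem b, yom (triq t) = b \mo l,
      forall Z (z : M (A Z)), fmor A (a Z z) = b (A Z) z
    & represents a (yom (trif t)) (yom (trii t)) l (phi M)].

End TateExt.

(* Main.v *)
(** Write S for the cosyzygy functor and theta_K : Sigma K -> S^3 K for the
    transformation corresponding to phi_(Sigma K).

    A triangle with f : X -> Y and K = Ker T(-,f) is spliced from three short
    exact sequences K >-> X ->> B, B >-> Y ->> Q, Q >-> C ->> M with M = Sigma K
    and classes c1, c2, c3 in the stable category, and it is phi-exact when
    phi(M) = S^2(c1) S(c2) c3.  Given f, the third sequence is the pullback of
    Q >-> I ->> S Q along the stable isomorphism (S^2(c1) S(c2))^-1 phi(M), and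
    its middle term is stably zero, hence representable.  Morphisms of triangles
    exist because phi is natural.  The rotated triangle is spliced from the last
    two sequences and from Sigma K >-> Sigma X ->> Sigma B with its epimorphism
    negated, whose class is - sigma Sigma(c1); hence closure under rotation in
    both directions amounts to theta_(SK) = - S(theta_K) sigma.  Conversely a
    Puppe structure defines phi(M) as the class of any of its triangles over M.

    The graded condition in degree 1 says delta = - theta, and it implies the one
    in all degrees.  It is automatic for a natural isomorphism theta with
    theta_S = - S(theta) sigma: naturality of theta at theta_N gives
    theta_(Sigma N) = - sigma^3 Sigma(theta_N), which is - delta_(Sigma N). *)
From HB Require Import structures.
From mathcomp Require Import all_boot all_order all_algebra.
From mathcomp Require Import generic_quotient ring_quotient zify.
From mathcomp Require Import boolp classical_sets functions.
Require Import Defs.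

Set Implicit Arguments.
Unset Strict Implicit.
Unset Printing Implicit Defensive.
Import GRing.Theory.
Local Open Scope ring_scope.
Local Open Scope quotient_scope.

(** * Modules and their cokernels *)

(** The graded condition involves all integer powers of Sigma, while S has only a quasi-inverse, so
    products in the bigraded ring are composites with many canonical isomorphisms. The way around
    these is to replace a class M -> S^n Sigma^m N by the family of all its shifts S^i Sigma^j M ->
    S^(i+n) Sigma^(j+m) N. Products become composites of families, and identities are checked at i =
    j = 0 only.

    Two transformations Sigma M -> S^3 M come from phi: theta evaluates phi at Sigma M, whereas
    delta suspends phi(M) and then moves Sigma past S^3. Triangles and their rotations see theta,
    Heller's condition is stated for delta. The Koszul sign of the bidegree (3, -1) in degree 1 is
    what separates the two. It matches the sign (-1)^3 produced by moving theta past three copies of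
    S, and this is why the graded condition and anticommutativity are consistent. Both
    transformations satisfy Heller's condition together, since that condition is homogeneous. *)

Section ModuleBasics.
Variables (k : comPzRingType) (Ob : Type) (T : klincat k Ob).
Implicit Types M N P : rmod T.

Lemma mfun0 M N (f : mhom M N) X : f X 0 = 0.
Proof. by have := mfun_lin f (-1) 0 (0 : M X); rewrite scaler0 addr0 scaleN1r addNr. Qed.

Lemma mfunN M N (f : mhom M N) X x : f X (- x) = - f X x.
Proof. by apply: (addrI (f X x)); rewrite -mfunD !subrr mfun0. Qed.

Lemma mfunB M N (f : mhom M N) X x y : f X (x - y) = f X x - f X y.
Proof. by rewrite mfunD mfunN. Qed.

Lemma mact0 M X Y (f : T X Y) : mact f (0 : M Y) = 0.
Proof. exact: esym (snd (mhom0_subproof M M) _ _ f 0). Qed.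

Lemma injectivemP M N (f : mhom M N) :
  (forall X x, f X x = 0 -> x = 0) <-> injectivem f.
Proof.
split=> [f0 X x y e|fI X x e]; last by apply: (fI X); rewrite e mfun0.
by apply: subr0_eq; apply: f0; rewrite mfunB e subrr.
Qed.

(** Preimages are chosen pointwise; injectivity of [i] makes them unique, so linearity and
    naturality of the lift are automatic. *)
Lemma lift_inj M N P (i : mhom N P) (f : mhom M P) : injectivem i ->
  (forall X x, exists y, i X y = f X x) -> exists u : mhom M N, i \mo u = f.
Proof.
move=> iI fi; have [h hE] : {h : forall X, M X -> N X | forall X x, i X (h X x) = f X x}.
  by exists (fun X x => sval (cid (fi X x))) => X x; case: cid.
have l X a x y : h X (a *: x + y) = a *: h X x + h X y.
  by apply: (iI X); rewrite mfun_lin !hE mfun_lin.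
have n X Y (g : T X Y) y : h X (mact g y) = mact g (h Y y).
  by apply: (iI X); rewrite mfun_nat !hE mfun_nat.
by exists (Mhom l n); apply: mhomP => X x; exact: hE.
Qed.

(** The section [h] of [p] is arbitrary, neither linear nor natural; since [f] kills the kernel of
    [p], the composite of [f] with [h] is both. *)
Lemma desc_surj M N P (p : mhom M N) (f : mhom M P) : surjectivem p ->
  (forall X x, p X x = 0 -> f X x = 0) -> exists u : mhom N P, u \mo p = f.
Proof.
move=> pS fp; have [h hE] : {h : forall X, N X -> M X | forall X y, p X (h X y) = y}.
  by exists (fun X y => sval (cid (pS X y))) => X y; case: cid.
have fE X x y : p X x = p X y -> f X x = f X y.
  by move=> e; apply: subr0_eq; rewrite -mfunB fp // mfunB e subrr.
have l X a x y : f X (h X (a *: x + y)) =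
   a *: f X (h X x) + f X (h X y).
  by rewrite -mfun_lin; apply: fE; rewrite mfun_lin !hE.
have n X Y (g : T X Y) y : f X (h X (mact g y)) = mact g (f Y (h Y y)).
  by rewrite -mfun_nat; apply: fE; rewrite mfun_nat !hE.
by exists (Mhom l n); apply: mhomP => X x; apply: fE; rewrite hE.
Qed.

Lemma surj_epi M N P (p : mhom M N) (f g : mhom N P) : surjectivem p ->
  f \mo p = g \mo p -> f = g.
Proof.
move=> pS e; apply: mhomP => X y; have [x <-] := pS X y.
exact: (mhom_app e x).
Qed.

Lemma inj_mono M N P (i : mhom N P) (f g : mhom M N) : injectivem i ->
  i \mo f = i \mo g -> f = g.
Proof. by move=> iI e; apply: mhomP => X y; apply: (iI X); exact: (mhom_app e y). Qed.

Lemma mcomp_assoc M N P Q (h : mhom P Q) (g : mhom N P) (f : mhom M N) :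
  h \mo (g \mo f) = (h \mo g) \mo f.
Proof. exact: mhomP. Qed.
Lemma mcomp_idl M N (f : mhom M N) : mid N \mo f = f.
Proof. exact: mhomP. Qed.
Lemma mcomp_idr M N (f : mhom M N) : f \mo mid M = f.
Proof. exact: mhomP. Qed.
Lemma mcompDl M N P (f : mhom M N) (g g' : mhom N P) :
  (g + g') \mo f = g \mo f + g' \mo f.
Proof. by apply: mhomP => X x; rewrite [LHS]mhom_addE [RHS]mhom_addE. Qed.
Lemma mcompDr M N P (f f' : mhom M N) (g : mhom N P) :
  g \mo (f + f') = g \mo f + g \mo f'.
Proof. by apply: mhomP => X x; rewrite -[LHS]/(g X ((f + f') X x)) !mhom_addE mfunD. Qed.
Lemma mcompNl M N P (f : mhom M N) (g : mhom N P) : (- g) \mo f = - (g \mo f).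
Proof. by apply: mhomP => X x; rewrite [LHS]mhom_oppE [RHS]mhom_oppE. Qed.
Lemma mcompNr M N P (f : mhom M N) (g : mhom N P) : g \mo (- f) = - (g \mo f).
Proof. by apply: mhomP => X x; rewrite -[LHS]/(g X ((- f) X x)) !mhom_oppE mfunN. Qed.
Lemma mcomp0l M N P (f : mhom M N) : (0 : mhom N P) \mo f = 0.
Proof. exact: mhomP. Qed.
Lemma mcomp0r M N P (g : mhom N P) : g \mo (0 : mhom M N) = 0.
Proof. by apply: mhomP => X x; rewrite [LHS]mfun0. Qed.

(** The map that the Yoneda lemma attaches to the element [x]. *)
Definition yel M X (x : M X) : mhom (yo_rmod T X) M :=
  @Mhom k Ob T (yo_rmod T X) M (fun Z g => mact g x)
    (fun Z a g h => mact_linl a g h x) (fun A B h g => mactM g h x).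

Lemma yelE M X (f : mhom (yo_rmod T X) M) : f = yel (f X (idm T X)).
Proof. by apply: mhomP => Z g /=; rewrite -mfun_nat /= comp1m. Qed.

Lemma yel1 M X (x : M X) : yel x X (idm T X) = x.
Proof. exact: mact1. Qed.

Lemma yo_ext M X (f g : mhom (yo_rmod T X) M) : f X (idm T X) = g X (idm T X) -> f = g.
Proof. by move=> e; rewrite (yelE f) e -yelE. Qed.

Lemma yo_full X Y (f : mhom (yo_rmod T X) (yo_rmod T Y)) :
  f = yom_rmod (f X (idm T X) : T X Y).
Proof. by apply: yo_ext; rewrite /= compm1. Qed.

Lemma yo_proj M N X (p : mhom M N) (f : mhom (yo_rmod T X) N) : surjectivem p ->
  exists g : mhom (yo_rmod T X) M, p \mo g = f.
Proof.
move=> /(_ _ (f X (idm T X))) [x xE]; exists (yel x).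
by apply: yo_ext; rewrite -xE [LHS]/= mact1.
Qed.

Lemma yom_comp X Y Z (g : T Y Z) (f : T X Y) : yom_rmod (g \oc f) = yom_rmod g \mo yom_rmod f.
Proof. by apply: mhomP => W h; rewrite /= compA. Qed.
Lemma yom_id X : yom_rmod (idm T X) = mid (yo_rmod T X).
Proof. by apply: mhomP => W h; rewrite /= comp1m. Qed.
Lemma yom_inj X Y (f g : T X Y) : yom_rmod f = yom_rmod g -> f = g.
Proof. by move=> /mhom_app /(_ X (idm T X)) /=; rewrite !compm1. Qed.

Definition im_pred M N (f : mhom M N) X : {pred N X} := fun y => `[< exists x, f X x = y >].

Lemma im_closed M N (f : mhom M N) X : zmod_closed (@im_pred M N f X).
Proof.
split=> [|x y /asboolP[a <-] /asboolP[b <-]]; apply/asboolP.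
  by exists 0; rewrite mfun0.
by exists (a - b); rewrite mfunB.
Qed.
HB.instance Definition _ M N (f : mhom M N) X :=
  GRing.isZmodClosed.Build (N X) (@im_pred M N f X) (@im_closed M N f X).

(** Cokernels are built by hand because [is_abelian] supplies abstract ones, not known to be
    computed pointwise. That epimorphisms are surjective is deduced from this construction. *)
Definition coker_at M N (f : mhom M N) X := Quotient.quot (@im_pred M N f X).
HB.instance Definition _ M N (f : mhom M N) X := GRing.Zmodule.on (coker_at f X).

Section CokernelAt.
Variables (M N : rmod T) (f : mhom M N).
Notation Q X := (coker_at f X).
Notation pQ X x := (\pi_(Q X) x).

Lemma cok_eq X (x y : N X) : (pQ X x = pQ X y) <-> exists z, f X z = x - y.
Proof.
split=> [/eqP|[z e]]; last apply/eqP; rewrite piE Quotient.equivE.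
  by move/asboolP.
by apply/asboolP; exists z.
Qed.

Lemma cok_piD X (x y : N X) : pQ X (x + y) = pQ X x + pQ X y.
Proof. by rewrite !piE. Qed.

Lemma cok_pi0 X : pQ X 0 = 0.
Proof. by rewrite !piE. Qed.

Lemma cok_piP X (q : Q X) : exists x, q = pQ X x.
Proof. by exists (repr q); rewrite reprK. Qed.

Definition cok_scale X (a : k) (q : Q X) : Q X := pQ X (a *: repr q).

Lemma cok_scaleE X a (x : N X) : cok_scale a (pQ X x) = pQ X (a *: x).
Proof.
apply/cok_eq; have /cok_eq [z ze] : pQ X (repr (pQ X x)) = pQ X x by rewrite reprK.
by exists (a *: z); rewrite -scalerBr -ze; have := mfun_lin f a z 0; rewrite mfun0 !addr0.
Qed.

Lemma cok_scale_ax X :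
 [/\ forall a b (q : Q X), cok_scale a (cok_scale b q) = cok_scale (a * b) q,
     left_id 1 (@cok_scale X), right_distributive (@cok_scale X) +%R
   & forall q : Q X, {morph (@cok_scale X)^~ q : a b / a + b}].
Proof.
split.
- by move=> a b q; have [x ->] := cok_piP q; rewrite !cok_scaleE scalerA.
- by move=> q; have [x ->] := cok_piP q; rewrite cok_scaleE scale1r.
- move=> a q r; have [[x ->] [y ->]] := (cok_piP q, cok_piP r).
  by rewrite -cok_piD !cok_scaleE -cok_piD scalerDr.
- by move=> q a b; have [x ->] := cok_piP q; rewrite !cok_scaleE -cok_piD scalerDl.
Qed.
End CokernelAt.

HB.instance Definition _ M N (f : mhom M N) X :=
  GRing.Zmodule_isLmodule.Build k (coker_at f X)
    (let: And4 a _ _ _ := cok_scale_ax f X in a) (let: And4 _ a _ _ := cok_scale_ax f X in a)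
    (let: And4 _ _ a _ := cok_scale_ax f X in a) (let: And4 _ _ _ a := cok_scale_ax f X in a).

Section CokernelModule.
Variables (M N : rmod T) (f : mhom M N).
Notation Q X := (coker_at f X).
Notation pQ X x := (\pi_(Q X) x).

Lemma cok_piZ X a (x : N X) : pQ X (a *: x) = a *: (pQ X x : coker_at f X).
Proof. by rewrite -cok_scaleE. Qed.

Definition cok_act X Y (g : T X Y) (q : Q Y) : Q X := pQ X (mact g (repr q)).

Lemma cok_actE X Y (g : T X Y) (y : N Y) : cok_act g (pQ Y y) = pQ X (mact g y).
Proof.
apply/cok_eq; have /cok_eq [z ze] : pQ Y (repr (pQ Y y)) = pQ Y y by rewrite reprK.
exists (mact g z); rewrite mfun_nat ze mactD; congr (_ + _).
by apply: (addrI (mact g y)); rewrite -mactD !subrr mact0.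
Qed.

Definition coker_rmod : rmod T.
Proof.
apply: (@Rmod k Ob T (fun X => coker_at f X : lmodType k) cok_act).
- by move=> X q; have [x ->] := cok_piP q; rewrite cok_actE mact1.
- by move=> X Y Z g h q; have [x ->] := cok_piP q; rewrite !cok_actE mactM.
- move=> X Y a g h q; have [x ->] := cok_piP q.
  by rewrite !cok_actE mact_linl cok_piD cok_piZ.
- move=> X Y g a q r; have [[x ->] [y ->]] := (cok_piP q, cok_piP r).
  by rewrite -cok_piZ -cok_piD !cok_actE mact_linr cok_piD cok_piZ.
Defined.

Definition coker_pi : mhom N coker_rmod.
Proof.
apply: (@Mhom k Ob T N coker_rmod (fun X x => pQ X x)).
- by move=> X a x y; rewrite cok_piD cok_piZ.
- by move=> X Y g y; rewrite -[RHS]/(cok_act g (pQ Y y)) cok_actE.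
Defined.

Lemma coker_pi_surj : surjectivem coker_pi.
Proof. by move=> X y; exists (repr y); rewrite /= reprK. Qed.

Lemma coker_pi_exact : exactm f coker_pi.
Proof.
move=> X y; split.
  rewrite [coker_pi X y]/= -[RHS](cok_pi0 f X) => /cok_eq [z ze].
  by exists z; rewrite ze subr0.
move=> [x <-]; rewrite [LHS]/= -[RHS](cok_pi0 f X); apply/cok_eq.
by exists x; rewrite subr0.
Qed.
End CokernelModule.

End ModuleBasics.

(** * The abelian category of finitely presented modules *)

Section Abelian.
Variables (k : comPzRingType) (Ob : Type) (T : addcat k Ob).
Hypothesis hidem : idempotent_complete T.
Hypothesis hab : is_abelian (modcat T).
Hypothesis hfrob : is_frobenius (modcat T).
Implicit Types M N P Q : fpmod T.

(** Let [h] present [N] on the generators [Y1], and let [g0 : Y2 -> Y1] lift the images of the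
    generators [Y2] of [M]. The cokernel then has generators [Y1] and relations [h], [g0] on the
    biproduct of [X1] and [Y2]. *)
Lemma coker_fp M N (f : mhom M N) : fin_presented (coker_rmod f).
Proof.
have [[Z _] bip] := addcatP T.
have [X1 [Y1 [h [p [pS pE]]]]] := fp_modP N.
have [X2 [Y2 [h2 [p2 [p2S _]]]]] := fp_modP M.
have [g gE] := yo_proj (f \mo p2) pS.
rewrite (yo_full g) in gE; set g0 : T Y2 Y1 := g _ _ in gE.
have [B [i1 [i2 [q1 [q2 [e1 e2 e12 e21 e]]]]]] := bip X1 Y2.
exists B, Y1, (h \oc q1 + g0 \oc q2), (coker_pi f \mo p); split.
  move=> X y; have [n nE] := coker_pi_surj (y : coker_rmod f X).
  by have [x xE] := pS X n; exists x; rewrite -nE -xE.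
have linD A1 A2 A3 (u v : T A2 A3) (w : T A1 A2) : (u + v) \oc w = u \oc w + v \oc w.
  by have := comp_linl w 1 u v; rewrite !scale1r.
have linDr A1 A2 A3 (u v : T A1 A2) (w : T A2 A3) : w \oc (u + v) = w \oc u + w \oc v.
  by have := comp_linr w 1 u v; rewrite !scale1r.
move=> X y; split.
  move=> /(coker_pi_exact f) [m mE]; have [z zE] := p2S X m.
  have [x xE] : exists x : T X X1, h \oc x = (y : T X Y1) - g0 \oc (z : T X Y2).
    apply/(pE X); rewrite mfunB.
    by have /= -> := mhom_app gE z; rewrite zE mE subrr.
  exists (i1 \oc x + i2 \oc z) => /=.
  rewrite linD !linDr -!compA !(compA q1) !(compA q2) e1 e2 e12 e21 !comp0m !comp1m !compm0.
  by rewrite addr0 add0r xE subrK.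
move=> [x <-]; apply/(coker_pi_exact f).
exists (p2 X (q2 \oc x)); have /= <- := mhom_app gE (q2 \oc x).
rewrite /= linD mfunD -!compA.
suff -> : p X (h \oc (q1 \oc x)) = 0 by rewrite add0r.
by apply/(pE X); exists (q1 \oc x).
Qed.

Definition coker M N (f : mhom M N) : fpmod T := Fpmod (coker_fp f).

Lemma epic_surj M N (f : mhom M N) : @is_epic _ _ (modcat T) M N f -> surjectivem f.
Proof.
move=> fe X y.
have e : coker_pi f = 0 :> mhom N (coker f).
  apply: (fe (coker f)) => /=; apply: mhomP => Y x.
  rewrite [RHS]/=; apply/(coker_pi_exact f); first by exists x.
have /(coker_pi_exact f) [x xE] : coker_pi f X y = 0 by rewrite e.
by exists x.
Qed.

Lemma yo_projective X : @is_projective _ _ (modcat T) (yo T X).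
Proof. by move=> M N e f /epic_surj es; exact: (yo_proj (f : mhom (yo T X) N) es). Qed.

(** Representables are projective, hence injective by the Frobenius property. *)
Lemma yo_inj M N X (i : mhom M N) (f : mhom M (yo T X)) : injectivem i ->
  exists g : mhom N (yo T X), g \mo i = f.
Proof.
move=> iI; have [_ _ /(_ (yo T X)) [h _]] := hfrob.
apply: (h (@yo_projective X)); move=> W g h' /=; exact: inj_mono.
Qed.

(** Elements of [M X] are maps from a representable, so testing the abstract kernel on
    representables shows that it is the pointwise kernel. *)
Lemma kernel_ex M N (f : mhom M N) :
  exists (K : fpmod T) (i : mhom K M), injectivem i /\ exactm i f.
Proof.
have [_ /(_ M N f) [K [i [fi iu]]] _ _ _] := hab.
have iI : injectivem i.
  apply/injectivemP => X x e.
  have z : (f : modcat T M N) \oc (0 : modcat T (yo T X) M) = 0 by exact: compm0.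
  have [u [_ uu]] := iu (yo T X) 0 z.
  have e0 := uu (0 : mhom (yo T X) K) (compm0 _ _).
  have ex : (i : modcat T K M) \oc (yel x : modcat T (yo T X) K) = 0.
    by apply: yo_ext => /=; rewrite mact1 e.
  by have := uu (yel x) ex; rewrite e0 => /mhom_app /(_ X (idm T X)) /=; rewrite mact1.
exists K, i; split=> // X y; split=> [fy|[x <-]]; last exact: (mhom_app fi x).
have z : (f : modcat T M N) \oc (yel y : modcat T (yo T X) M) = 0.
  by apply: yo_ext => /=; rewrite mact1 fy.
have [u [/= uE _]] := iu (yo T X) (yel y) z.
by exists (u X (idm T X)); have := mhom_app uE (idm T X); rewrite yel1.
Qed.

Lemma image_ex M N (f : mhom M N) :
  exists (B : fpmod T) (r : mhom M B) (j : mhom B N),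
    [/\ surjectivem r, injectivem j & f = j \mo r].
Proof.
have [B [j [jI jE]]] := @kernel_ex N (coker f) (coker_pi f).
have [r rE] : exists r, j \mo r = f.
  by apply: lift_inj => // X x; apply/(jE X)/(coker_pi_exact f); exists x.
exists B, r, j; split=> // X b.
have /(coker_pi_exact f) [x xE] : coker_pi f X (j X b) = 0 by apply/(jE X); exists b.
by exists x; apply: (jI X); rewrite -xE -rE.
Qed.

Lemma pullback_ex M N P (f : mhom M N) (g : mhom P N) :
  exists (E : fpmod T) (e : mhom E M) (j : mhom E P), [/\ f \mo e = g \mo j,
    forall X x y, e X x = e X y -> j X x = j X y -> x = y
  & forall (W : fpmod T) (m : mhom W M) (p : mhom W P), f \mo m = g \mo p ->
      exists u, e \mo u = m /\ j \mo u = p].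
Proof.
have [[_ bip] _ _ _ _] := hab.
have [B [i1 [i2 [p1 [p2 [/= e1 e2 e12 e21 e3]]]]]] := bip M P.
have [E [i [iI iE]]] := @kernel_ex B N (f \mo p1 - g \mo p2).
have app X b : (f \mo p1 - g \mo p2) X b = f X (p1 X b) - g X (p2 X b).
  by rewrite mhom_addE mhom_oppE.
have bE X (b : B X) : b = i1 X (p1 X b) + i2 X (p2 X b).
  by have := mhom_app e3 b; rewrite mhom_addE.
exists E, (p1 \mo i), (p2 \mo i); split.
- apply: mhomP => X x /=; apply: subr0_eq; rewrite -app.
  by apply/(iE X); exists x.
- by move=> X x y /= e e'; apply: (iI X); rewrite (bE _ (i X x)) (bE _ (i X y)) e e'.
move=> W m p mp; have [|u uE] := @lift_inj _ _ _ _ _ _ i (i1 \mo m + i2 \mo p) iI.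
  move=> X x; apply/(iE X); rewrite app mhom_addE /= (mfunD p1) (mfunD p2).
  have p11 y : p1 X (i1 X y) = y := mhom_app e1 y.
  have p22 y : p2 X (i2 X y) = y := mhom_app e2 y.
  have p12 y : p1 X (i2 X y) = 0 := mhom_app e12 y.
  have p21 y : p2 X (i1 X y) = 0 := mhom_app e21 y.
  rewrite p11 p22 p12 p21 addr0 add0r; have /= -> := mhom_app mp x; exact: subrr.
exists u; rewrite -!mcomp_assoc uE !mcompDr !mcomp_assoc; split.
  by move: e1 e12 => /= -> ->; rewrite mcomp_idl mcomp0l addr0.
by move: e2 e21 => /= -> ->; rewrite mcomp_idl mcomp0l add0r.
Qed.

(** The idempotent [a \mo b] comes from an idempotent of [X] by full faithfulness, and the splitting
    of the latter in [T] represents [E]. This is where idempotent completeness enters. *)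
Lemma summand_yo E X (a : mhom E (yo T X)) (b : mhom (yo T X) E) : b \mo a = mid E ->
  exists C (u : mhom E (yo T C)) (v : mhom (yo T C) E), u \mo v = mid _ /\ v \mo u = mid _.
Proof.
move=> ba; pose e : T X X := (a \mo b) X (idm T X).
have eE : yom_rmod e = a \mo b by rewrite /e -yo_full.
have ee : e \oc e = e.
  apply: yom_inj; rewrite yom_comp eE.
  by rewrite mcomp_assoc -(mcomp_assoc a b a) ba mcomp_idr.
have [C [r [s [rs sr]]]] := hidem ee.
exists C, (yom r \mo a), (b \mo yom s); split.
  rewrite mcomp_assoc -(mcomp_assoc _ a b) -eE -sr yom_comp mcomp_assoc -yom_comp rs.
  by rewrite -mcomp_assoc -yom_comp rs yom_id mcomp_idr.
rewrite mcomp_assoc -(mcomp_assoc b) -yom_comp sr eE mcomp_assoc ba mcomp_idl.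
by rewrite ba.
Qed.

End Abelian.

(** * The stable category and maps of short exact sequences *)

Section StableCat.
Variables (k : comPzRingType) (Ob : Type) (T : addcat k Ob).
Implicit Types M N P Q : fpmod T.

Lemma scl_eqP M N (f g : mhom M N) : scl f = scl g <->
  exists X (a : mhom M (yo T X)) (b : mhom (yo T X) N), f = b \mo a + g.
Proof.
split=> [/eqP|[X [a [b ->]]]]; last apply/eqP; rewrite piE Quotient.equivE.
  move/asboolP=> [X [a [b e]]]; exists X, a, b.
  by rewrite -e subrK.
by apply/asboolP; exists X, a, b; rewrite addrK.
Qed.

Lemma sclD M N (f g : mhom M N) : scl (f + g) = scl f + scl g.
Proof. by rewrite /scl !piE. Qed.
Lemma sclN M N (f : mhom M N) : scl (- f) = - scl f.
Proof. by rewrite /scl !piE. Qed.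
Lemma scl0 M N : scl (0 : mhom M N) = 0.
Proof. by rewrite /scl !piE. Qed.
Lemma sclB M N (f g : mhom M N) : scl (f - g) = scl f - scl g.
Proof. by rewrite sclD sclN. Qed.

Lemma scl_eq0 M N (f : mhom M N) : scl f = 0 <->
  exists X (a : mhom M (yo T X)) (b : mhom (yo T X) N), f = b \mo a.
Proof.
rewrite -scl0 scl_eqP; split=> -[X [a [b e]]]; exists X, a, b; first by rewrite e addr0.
by rewrite addr0.
Qed.

Lemma sclP M N (x : sHom M N) : exists f, x = scl f.
Proof. by exists (repr x); rewrite /scl reprK. Qed.

(** [scomp] composes chosen representatives; another choice changes the composite by maps through
    representables. *)
Lemma scl_comp M N P (g : mhom N P) (f : mhom M N) : scl g \so scl f = scl (g \mo f).
Proof.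
rewrite /scomp; have /scl_eqP [X [a [b ->]]] : scl (repr (scl g)) = scl g by rewrite /scl reprK.
have /scl_eqP [Y [c [d ->]]] : scl (repr (scl f)) = scl f by rewrite /scl reprK.
rewrite mcompDl (mcompDr _ _ g) 2!sclD -[RHS]add0r; congr (_ + _).
  by apply/scl_eq0; exists X, (a \mo (d \mo c + f)), b; rewrite mcomp_assoc.
rewrite -[RHS]add0r; congr (_ + _).
by apply/scl_eq0; exists Y, c, (g \mo d); rewrite mcomp_assoc.
Qed.

Lemma scompA M N P Q (h : sHom P Q) (g : sHom N P) (f : sHom M N) :
  h \so (g \so f) = h \so g \so f.
Proof.
have [[f' ->] [g' ->]] := (sclP f, sclP g); have [h' ->] := sclP h.
by rewrite !scl_comp mcomp_assoc.
Qed.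
Lemma scomp1m M N (f : sHom M N) : sid N \so f = f.
Proof. by have [f' ->] := sclP f; rewrite scl_comp mcomp_idl. Qed.
Lemma scompm1 M N (f : sHom M N) : f \so sid M = f.
Proof. by have [f' ->] := sclP f; rewrite scl_comp mcomp_idr. Qed.
Lemma scompDr M N P (g : sHom N P) (f f' : sHom M N) : g \so (f + f') = g \so f + g \so f'.
Proof.
have [[h ->] [h' ->]] := (sclP f, sclP f'); have [g' ->] := sclP g.
by rewrite -sclD !scl_comp -sclD mcompDr.
Qed.
Lemma scompNl M N P (g : sHom N P) (f : sHom M N) : (- g) \so f = - (g \so f).
Proof.
have [[f' ->] [h ->]] := (sclP f, sclP g).
by rewrite -sclN !scl_comp -sclN mcompNl.
Qed.
Lemma scompNr M N P (g : sHom N P) (f : sHom M N) : g \so (- f) = - (g \so f).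
Proof.
have [[f' ->] [h ->]] := (sclP f, sclP g).
by rewrite -sclN !scl_comp -sclN mcompNr.
Qed.

Definition siso M N (f : sHom M N) := exists g : sHom N M, g \so f = sid M /\ f \so g = sid N.

Lemma siso_id M : siso (sid M).
Proof. by exists (sid M); rewrite scomp1m. Qed.

Lemma siso_comp M N P (g : sHom N P) (f : sHom M N) : siso g -> siso f -> siso (g \so f).
Proof.
move=> [g' [g1 g2]] [f' [f1 f2]]; exists (f' \so g'); split.
  by rewrite scompA -(scompA f') g1 scompm1.
by rewrite scompA -(scompA g) f2 scompm1.
Qed.

Lemma siso_monic M N P (f : sHom N P) (g h : sHom M N) : siso f -> f \so g = f \so h -> g = h.
Proof. by move=> [f' [e _]] /(congr1 (scomp f')); rewrite !scompA e !scomp1m. Qed.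

Lemma siso_epic M N P (f : sHom M N) (g h : sHom N P) : siso f -> g \so f = h \so f -> g = h.
Proof.
by move=> [f' [_ e]] /(congr1 (fun x => x \so f')); rewrite -!scompA e !scompm1.
Qed.

Lemma siso_cancell M N P (g : sHom N P) (f : sHom M N) : siso g -> siso (g \so f) -> siso f.
Proof.
move=> [g' [e1 e2]] gf; have -> : f = g' \so (g \so f) by rewrite scompA e1 scomp1m.
by apply: siso_comp => //; exists g.
Qed.

Lemma siso_cancelr M N P (g : sHom N P) (f : sHom M N) : siso f -> siso (g \so f) -> siso g.
Proof.
move=> [g' [e1 e2]] gf; have -> : g = g \so f \so g' by rewrite -scompA e2 scompm1.
by apply: siso_comp => //; exists f.
Qed.

Lemma scl_siso M N (f : mhom M N) g : g \mo f = mid M -> f \mo g = mid N -> siso (scl f).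
Proof. by move=> e1 e2; exists (scl g); rewrite !scl_comp e1 e2. Qed.

Lemma inj_surj_iso M N (f : mhom M N) : injectivem f -> surjectivem f ->
  exists g, g \mo f = mid M /\ f \mo g = mid N.
Proof.
move=> fI fS; have [g gE] := @lift_inj _ _ _ _ _ _ f (mid N) fI (fun X x => fS X x).
by exists g; split=> //; apply: (inj_mono fI); rewrite mcomp_assoc gE mcomp_idl mcomp_idr.
Qed.

End StableCat.

Section SesFacts.
Variables (k : comPzRingType) (Ob : Type) (T : addcat k Ob).
Implicit Types M N P Q : fpmod T.
Lemma sesI M N (s : ses M N) : injectivem (ses_i s). Proof. exact: ses_inj. Qed.
Lemma sesE M N (s : ses M N) : exactm (ses_i s) (ses_p s). Proof. exact: ses_exact. Qed.
Lemma sesS M N (s : ses M N) : surjectivem (ses_p s). Proof. exact: ses_surj. Qed.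

End SesFacts.
Arguments sesI {k Ob T M N} s {X} [x1 x2] : rename.
Arguments sesE {k Ob T M N} s {X} y : rename.
Arguments sesS {k Ob T M N} s {X} y : rename.

(** * Maps of short exact sequences: each end determines the other stably *)

Section SesMaps.
Variables (k : comPzRingType) (Ob : Type) (T : addcat k Ob).
Hypothesis hfrob : is_frobenius (modcat T).
Implicit Types M N P Q : fpmod T.

Let yo_inj := @yo_inj k Ob T hfrob.

Lemma ses_pi M N (s : ses M N) : ses_p s \mo ses_i s = 0.
Proof.
by apply: mhomP => X x; have [_ h] := sesE s (ses_i s X x); apply: h; exists x.
Qed.

Lemma ses_fwd M N M' N' (s : ses M N) (s' : ses M' N') (f : mhom M M') :
  exists g h, g \mo ses_i s = ses_i s' \mo f /\ h \mo ses_p s = ses_p s' \mo g.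
Proof.
have [g gE] := yo_inj (ses_i s' \mo f) (fun X => sesI s).
have [|h hE] := @desc_surj _ _ _ _ _ _ (ses_p s) (ses_p s' \mo g) (fun X => sesS s).
  move=> X x /(sesE s) [y <-].
  have /= -> := mhom_app gE y; exact: (mhom_app (ses_pi s')).
by exists g, h.
Qed.

Lemma ses_bwd M N M' N' (s : ses M N) (s' : ses M' N') (h : mhom N N') :
  exists f g, g \mo ses_i s = ses_i s' \mo f /\ h \mo ses_p s = ses_p s' \mo g.
Proof.
have [g gE] := yo_proj (h \mo ses_p s) (fun X => sesS s').
have [|f fE] := @lift_inj _ _ _ _ _ _ (ses_i s') (g \mo ses_i s) (fun X => sesI s').
  move=> X x; apply/(sesE s').
  have /= -> := mhom_app gE (ses_i s X x).
  by have /= -> := mhom_app (ses_pi s) x; rewrite mfun0.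
by exists f, g.
Qed.

(** If [f = b \mo a], extend [a] along [ses_i s] to [c]. Then [g - ses_i s' \mo b \mo c] kills [M],
    so it descends to [N], and [h] factors through the descended map. The converse is dual, with
    projectivity in place of injectivity. *)
Lemma ses_null M N M' N' (s : ses M N) (s' : ses M' N') f g h :
  g \mo ses_i s = ses_i s' \mo f -> h \mo ses_p s = ses_p s' \mo g ->
  (scl f = 0 <-> scl h = 0).
Proof.
move=> gi hp; rewrite !scl_eq0; split=> -[X [a [b e]]].
  have [c cE] := yo_inj a (fun X => sesI s).
  have [|t tE] := @desc_surj _ _ _ _ _ _ (ses_p s) (g - ses_i s' \mo b \mo c)
                   (fun X => sesS s).
    move=> Z x /(sesE s) [y <-]; rewrite mhom_addE mhom_oppE.
    have /= -> := mhom_app gi y; rewrite e /=.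
    by have /= -> := mhom_app cE y; rewrite subrr.
  exists _, t, (ses_p s'); apply: (surj_epi (fun X => sesS s)).
  rewrite hp -mcomp_assoc tE mcompDr mcompNr -!mcomp_assoc [_ \mo (ses_i s' \mo _)]mcomp_assoc.
  by rewrite ses_pi mcomp0l subr0.
have [c cE] := yo_proj b (fun X => sesS s').
have [|t tE] := @lift_inj _ _ _ _ _ _ (ses_i s') (g - c \mo (a \mo ses_p s))
                  (fun X => sesI s').
  move=> Z x; apply/(sesE s'); rewrite mhom_addE mhom_oppE mfunB.
  have /= <- := mhom_app hp x; rewrite e /=.
  by have /= -> := mhom_app cE (a Z (ses_p s Z x)); rewrite subrr.
exists _, (ses_i s), t; apply: (inj_mono (fun X => sesI s')).
rewrite mcomp_assoc tE mcompDl mcompNl -!mcomp_assoc ses_pi !mcomp0r subr0.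
by rewrite gi.
Qed.

Lemma ses_map_comp M N M' N' M'' N'' (s : ses M N) (s' : ses M' N') (s'' : ses M'' N'') f h f'
  h' :
  ses_map s s' f h -> ses_map s' s'' f' h' -> ses_map s s'' (f' \so f) (h' \so h).
Proof.
move=> [f0 [g [h0 [<- <- e1 e2]]]] [f0' [g' [h0' [<- <- e1' e2']]]].
exists (f0' \mo f0), (g' \mo g), (h0' \mo h0); rewrite !scl_comp; split=> //.
  by rewrite -mcomp_assoc e1 mcomp_assoc e1' mcomp_assoc.
by rewrite -mcomp_assoc e2 mcomp_assoc e2' mcomp_assoc.
Qed.

Lemma ses_map_id M N (s : ses M N) : ses_map s s (sid M) (sid N).
Proof. by exists (mid M), (mid _), (mid N); split=> //; rewrite mcomp_idl mcomp_idr. Qed.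

Lemma ses_mapD M N M' N' (s : ses M N) (s' : ses M' N') f h f' h' :
  ses_map s s' f h -> ses_map s s' f' h' -> ses_map s s' (f + f') (h + h').
Proof.
move=> [f0 [g [h0 [<- <- e1 e2]]]] [f0' [g' [h0' [<- <- e1' e2']]]].
exists (f0 + f0'), (g + g'), (h0 + h0'); rewrite !sclD; split=> //.
  by rewrite mcompDl e1 e1' mcompDr.
by rewrite mcompDl e2 e2' mcompDr.
Qed.

Lemma ses_mapN M N M' N' (s : ses M N) (s' : ses M' N') f h :
  ses_map s s' f h -> ses_map s s' (- f) (- h).
Proof.
move=> [f0 [g [h0 [<- <- e1 e2]]]]; exists (- f0), (- g), (- h0); rewrite !sclN; split=> //.
  by rewrite mcompNl e1 mcompNr.
by rewrite mcompNl e2 mcompNr.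
Qed.

(** With [ses_map_funl] this makes [ses_push] and [ses_pull], defined by choice, equal to any end
    found by hand. Later identities between stable maps are proved by exhibiting two maps of
    sequences with a common end. *)
Lemma ses_map_funr M N M' N' (s : ses M N) (s' : ses M' N') f h h' :
  ses_map s s' f h -> ses_map s s' f h' -> h = h'.
Proof.
move=> m1 /ses_mapN m2; have := ses_mapD m1 m2; rewrite subrr => -[f0 [g [h0 [f0E h0E e1 e2]]]].
apply: subr0_eq; rewrite -h0E; exact/(ses_null e1 e2).
Qed.

Lemma ses_map_funl M N M' N' (s : ses M N) (s' : ses M' N') f f' h :
  ses_map s s' f h -> ses_map s s' f' h -> f = f'.
Proof.
move=> m1 /ses_mapN m2; have := ses_mapD m1 m2; rewrite subrr => -[f0 [g [h0 [f0E h0E e1 e2]]]].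
apply: subr0_eq; rewrite -f0E; exact/(ses_null e1 e2).
Qed.

Lemma ses_pushP M N M' N' (s : ses M N) (s' : ses M' N') f : ses_map s s' f (ses_push s s' f).
Proof.
apply: (xgetPex 0); have [f0 ->] := sclP f; have [g [h [e1 e2]]] := ses_fwd s s' f0.
by exists (scl h), f0, g, h.
Qed.

Lemma ses_pullP M N M' N' (s : ses M N) (s' : ses M' N') h : ses_map s s' (ses_pull s s' h) h.
Proof.
apply: (@xgetPex _ 0 [set f | ses_map s s' f h]).
have [h0 ->] := sclP h; have [f [g [e1 e2]]] := ses_bwd s s' h0.
by exists (scl f), f, g, h0.
Qed.

Lemma ses_pushE M N M' N' (s : ses M N) (s' : ses M' N') f h :
  ses_map s s' f h -> ses_push s s' f = h.
Proof. exact: ses_map_funr (ses_pushP _ _ _). Qed.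

Lemma ses_pullE M N M' N' (s : ses M N) (s' : ses M' N') f h :
  ses_map s s' f h -> ses_pull s s' h = f.
Proof. exact: ses_map_funl (ses_pullP _ _ _). Qed.

Lemma ses_map_iso M N M' N' (s : ses M N) (s' : ses M' N') f h :
  ses_map s s' f h -> (siso f <-> siso h).
Proof.
move=> m; split=> -[g [e1 e2]].
  have m' := ses_pushP s' s g; exists (ses_push s' s g).
  have := ses_map_comp m m'; have := ses_map_comp m' m; rewrite e1 e2.
  by move=> /ses_map_funr /(_ (ses_map_id _)) -> /ses_map_funr /(_ (ses_map_id _)) ->.
have m' := ses_pullP s' s g; exists (ses_pull s' s g).
have := ses_map_comp m m'; have := ses_map_comp m' m; rewrite e1 e2.
by move=> /ses_map_funl /(_ (ses_map_id _)) -> /ses_map_funl /(_ (ses_map_id _)) ->.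
Qed.

End SesMaps.

(** The laws of an adjoint equivalence: [scancel_tri0] and [scancel_tri1] are the triangle
    identities, which make powers of mixed signs coherent. *)
Record sequiv_laws k Ob (T : addcat k Ob) (F : sequiv T) := SequivLaws {
  smor1 : forall s M, smor F s (sid M) = sid (F s M);
  smorM : forall s M N P (g : sHom N P) (f : sHom M N),
    smor F s (g \so f) = smor F s g \so smor F s f;
  smorD : forall s M N (g f : sHom M N), smor F s (g + f) = smor F s g + smor F s f;
  scancel_nat : forall s M N (f : sHom M N),
    scancel F s N \so smor F s (smor F (~~ s) f) = f \so scancel F s M;
  scancel_tri0 : forall M, smor F false (scancel F true M) = scancel F false (F false M);
  scancel_tri1 : forall M, smor F true (scancel F false M) = scancel F true (F true M);
  scancel_iso : forall s M, siso (scancel F s M)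
}.

(** * Coherence of integer powers of self-equivalences *)

(** The step is an equivalence, so that one computation covers both signs: upward one cancels an
    invertible step map, downward one also uses faithfulness of the functor. *)
Lemma zstep_ind (P : int -> Prop) : P 0 ->
  (forall n, P n <-> P (zstep false n)) -> forall n, P n.
Proof.
move=> P0 PS; case; elim=> [|p IH] //; first exact: (proj1 (PS (Posz p))).
  exact: (proj2 (PS (Negz 0))).
exact: (proj2 (PS (Negz p.+1))).
Qed.

Section OneEquivalence.
Variables (k : comPzRingType) (Ob : Type) (T : addcat k Ob).
Implicit Types M N P Q : fpmod T.
Variables (F : sequiv T) (LF : sequiv_laws F).

Lemma smorN s M N (f : sHom M N) : smor F s (- f) = - smor F s f.
Proof.
have z : smor F s (0 : sHom M N) = 0.
  by apply: (addrI (smor F s 0)); rewrite -smorD // !addr0.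
by apply: (addrI (smor F s f)); rewrite -smorD // !subrr.
Qed.

Lemma smor_siso s M N (f : sHom M N) : siso f -> siso (smor F s f).
Proof.
by move=> [g [e1 e2]]; exists (smor F s g); rewrite -!smorM // e1 e2 !smor1.
Qed.

Lemma smor_inj s M N (f g : sHom M N) : smor F s f = smor F s g -> f = g.
Proof.
move=> e; apply: (siso_epic (scancel_iso LF (~~ s) M)); rewrite -!scancel_nat //.
by case: s e => /= ->.
Qed.

Lemma smor_siso_inv s M N (f : sHom M N) : siso (smor F s f) -> siso f.
Proof.
move=> h; apply: (siso_cancelr (scancel_iso LF (~~ s) M)); rewrite -scancel_nat //.
apply: siso_comp; first exact: scancel_iso.
by apply: smor_siso; case: s h.
Qed.

Lemma smor_iter1 s p M : smor_iter F s p (sid M) = sid _.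
Proof. by elim: p => //= p ->; rewrite smor1. Qed.

Lemma smor_iterM s p M N P (g : sHom N P) (f : sHom M N) :
  smor_iter F s p (g \so f) = smor_iter F s p g \so smor_iter F s p f.
Proof. by elim: p => //= p ->; rewrite smorM. Qed.

Lemma smor_pow1 n M : smor_pow F n (sid M) = sid _.
Proof. exact: smor_iter1. Qed.

Lemma smor_powM n M N P (g : sHom N P) (f : sHom M N) :
  smor_pow F n (g \so f) = smor_pow F n g \so smor_pow F n f.
Proof. exact: smor_iterM. Qed.

Lemma smor_pow_siso n M N (f : sHom M N) : siso f -> siso (smor_pow F n f).
Proof.
by move=> [g [e1 e2]]; exists (smor_pow F n g); rewrite -!smor_powM // e1 e2 !smor_pow1.
Qed.

Local Arguments sstep : simpl never.
Local Arguments spow_iter : simpl never.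
Local Arguments zstep : simpl never.

Lemma spow_iterS s q n M :
  spow_iter F s q.+1 n M = sstep F s (iter q (zstep s) n) M \so smor F s (spow_iter F s q n M).
Proof. by []. Qed.

(** The target index is a variable tied to [zstep false n] by an equation; destructing the equation
    replaces the manipulation of casts. [dist] follows the same pattern. *)
Definition step n n' (e : zstep false n = n') M : sHom (F false (spow F n M)) (spow F n' M) :=
  ecast l (sHom (F false (spow F n M)) (spow F l M)) e (sstep F false n M).

Lemma step_siso n n' (e : zstep false n = n') M : siso (step e M).
Proof.
case: _ / e; rewrite /step /sstep /=; case: n => [p|[|p]] /=; first exact: siso_id.
  exact: scancel_iso.
exact: scancel_iso.
Qed.

Lemma step_nat n n' (e : zstep false n = n') M N (f : sHom M N) :
  step e N \so smor F false (smor_pow F n f) = smor_pow F n' f \so step e M.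
Proof.
case: _ / e; rewrite /step /sstep /=; case: n => [p|[|p]] /=; first by rewrite scomp1m scompm1.
  exact: scancel_nat.
exact: scancel_nat.
Qed.

Lemma sstepK n (e : zstep false (zstep true n) = n) M :
  step e M \so smor F false (sstep F true n M) = scancel F false (spow F n M).
Proof.
rewrite /step /sstep; case: n e => [[|p]|p] e /=; rewrite (eq_axiomK e) /= ?smor1 ?scompm1 //.
by rewrite scomp1m scancel_tri0.
Qed.

Definition dist m n l (e : m + n = l) M : sHom (spow F m (spow F n M)) (spow F l M) :=
  ecast l (sHom (spow F m (spow F n M)) (spow F l M)) e (spowD F m n M).

Lemma dist_iter m n l (e : m + n = l) (e' : iter (absz m) (zstep (zneg m)) n = l) M :
  dist e M = ecast l (sHom (spow F m (spow F n M)) (spow F l M)) e'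
               (spow_iter F (zneg m) (absz m) n M).
Proof.
by case: _ / e e' => e'; rewrite /dist /spowD /= (Prop_irrelevance e' (iter_zstepE n m)).
Qed.

Lemma dist0 n (e : 0 + n = n) M : dist e M = sid _.
Proof. by rewrite (dist_iter e (erefl n)). Qed.

(** [spowD] recurses downward for negative [m]. This restores the upward recursion for every sign,
    the extra inverse step being cancelled by [sstepK]. *)
Lemma dist_step m n l m' l' (el : m + n = l) (el' : m' + n = l')
    (em : zstep false m = m') (e : zstep false l = l') M :
  dist el' M \so step em (spow F n M) = step e M \so smor F false (dist el M).
Proof.
have i1 : iter (absz m) (zstep (zneg m)) n = l by rewrite iter_zstepE.
have i2 : iter (absz m') (zstep (zneg m')) n = l' by rewrite iter_zstepE.
rewrite (dist_iter el i1) (dist_iter el' i2) {el el'}.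
case: _ / em in i2 *; case: m i1 i2 => [p|[|p]] i1 i2.
- case: _ / i1 in e *; case: _ / e in i2 *.
  by rewrite (eq_axiomK i2) spow_iterS /step scompm1.
- case: _ / i2 in e *; case: _ / i1 in e *.
  by rewrite /= spow_iterS smor1 // scompm1 sstepK scomp1m.
case: _ / i2 in e *; case: _ / i1 in e *.
have sS := spow_iterS true p.+1 n M; rewrite [spow_iter F _ _ _ _ in RHS]sS.
by rewrite smorM // scompA sstepK -scancel_nat.
Qed.

Lemma dist_r0 m (e : m + 0 = m) M : dist e M = sid _.
Proof.
elim/zstep_ind: m e => [e|m]; first exact: dist0.
have key (e : m + 0 = m) (e' : zstep false m + 0 = zstep false m) :
  dist e' M \so step erefl M = step erefl M \so smor F false (dist e M).
  exact: (dist_step e e' erefl erefl M).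
split=> IH e.
  apply: (siso_epic (step_siso erefl M)).
  by rewrite (key (addr0 m)) IH smor1 // scompm1 scomp1m.
apply: (@smor_inj false); apply: (siso_monic (step_siso erefl M)).
by rewrite -(key e (addr0 _)) IH smor1 // scompm1 scomp1m.
Qed.

Lemma dist_nat m n l (e : m + n = l) M N (f : sHom M N) :
  dist e N \so smor_pow F m (smor_pow F n f) = smor_pow F l f \so dist e M.
Proof.
move: l e; elim/zstep_ind: m => [|m].
  by move=> l e; have e' := e; rewrite add0r in e'; case: _ / e' in e *;
    rewrite !dist0 scomp1m scompm1.
have key l l' (e : m + n = l) (e' : zstep false m + n = l') (el : zstep false l = l') :
   (dist e' N \so smor_pow F (zstep false m) (smor_pow F n f)) \so step erefl (spow F n M) =
      step el N \so smor F false (dist e N \so smor_pow F m (smor_pow F n f))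
   /\ (smor_pow F l' f \so dist e' M) \so step erefl (spow F n M) =
      step el N \so smor F false (smor_pow F l f \so dist e M).
  split; first by rewrite -scompA -step_nat scompA (dist_step e _ _ el) -scompA -smorM.
  by rewrite -scompA (dist_step e _ _ el) scompA -step_nat -scompA -smorM.
split=> IH l e.
  have el : zstep false (m + n) = l by rewrite -e !zstepE; lia.
  have [k1 k2] := key _ _ erefl e el.
  by apply: (siso_epic (step_siso erefl (spow F n M))); rewrite k1 k2 IH.
have e' : zstep false m + n = zstep false l by rewrite -e !zstepE; lia.
have [k1 k2] := key _ _ e e' erefl.
by apply: (@smor_inj false); apply: (siso_monic (step_siso erefl N)); rewrite -k1 -k2 IH.
Qed.

End OneEquivalence.

(** * Two commuting self-equivalences and families of shifts *)

Section TwoEquivalences.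
Variables (k : comPzRingType) (Ob : Type) (T : addcat k Ob).
Implicit Types L M N P Q : fpmod T.
Variables (F G : sequiv T) (LF : sequiv_laws F) (LG : sequiv_laws G).
Variable c : forall s t M, sHom (F s (G t M)) (G t (F s M)).
Hypothesis c_iso : forall s t M, siso (c s t M).
Hypothesis c_nat : forall s t M N (f : sHom M N),
  smor G t (smor F s f) \so c s t M = c s t N \so smor F s (smor G t f).
Hypothesis c_cancelG : forall M,
  scancel G false (F false M) \so smor G false (c false true M) \so c false false (G true M)
  = smor F false (scancel G false M).
Hypothesis c_cancelF : forall t M,
  smor G t (scancel F false M) \so c false t (F true M) \so smor F false (c true t M)
  = scancel F false (G t M).
Local Arguments zstep : simpl never.

Definition comm1 n M := scomm_iter1 c false (zneg n) (absz n) M.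

Lemma iter1_nat s t q M N (f : sHom M N) :
  smor_iter G t q (smor F s f) \so scomm_iter1 c s t q M =
  scomm_iter1 c s t q N \so smor F s (smor_iter G t q f).
Proof.
elim: q => [|q IH] /=; first by rewrite scompm1 scomp1m.
by rewrite scompA -smorM // IH smorM // -scompA c_nat scompA.
Qed.

Lemma comm1_nat n M N (f : sHom M N) :
  smor_pow G n (smor F false f) \so comm1 n M = comm1 n N \so smor F false (smor_pow G n f).
Proof. exact: iter1_nat. Qed.

Lemma comm1_iso n M : siso (comm1 n M).
Proof.
rewrite /comm1; elim: (absz n) => [|q IH] /=; first exact: siso_id.
by apply: siso_comp => //; apply: smor_siso.
Qed.

Lemma comm1_step n n' (e : zstep false n = n') M :
  comm1 n' M \so smor F false (step G e M) =
  step G e (F false M) \so smor G false (comm1 n M) \so c false false (spow G n M).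
Proof.
case: _ / e; rewrite /step /sstep; case: n => [p|[|p]]; rewrite /comm1.
- by rewrite smor1 // scompm1 scomp1m.
- by rewrite /= scomp1m smor1 // scomp1m c_cancelG.
rewrite /= smorM // scompA scancel_nat //.
by rewrite -c_cancelG -!scompA.
Qed.

Lemma iter1_cancelF t q M :
  smor_iter G t q (scancel F false M) \so scomm_iter1 c false t q (F true M)
    \so smor F false (scomm_iter1 c true t q M) = scancel F false (iter q (G t) M).
Proof.
elim: q => [|q IH] /=; first by rewrite smor1 // !scompm1.
rewrite smorM // -c_cancelF -IH !smorM // -!scompA; congr (_ \so (_ \so _)).
by rewrite !scompA; congr (_ \so _); rewrite c_nat.
Qed.

(** The upward recursion in the exponent of [F]; for negative exponents [iter1_cancelF] removes the
    factor [F] next to its inverse. *)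
Lemma comm_step n m m' (e : zstep false m = m') M :
  spow_comm c m' n M \so step F e (spow G n M) =
  smor_pow G n (step F e M) \so comm1 n (spow F m M) \so smor F false (spow_comm c m n M).
Proof.
case: _ / e; rewrite /step /sstep; case: m => [p|[|p]]; rewrite /comm1.
- by rewrite scompm1 smor_pow1 // scomp1m.
- rewrite /spow_comm /= smor1 // scompm1 scomp1m.
  by rewrite -[LHS]iter1_cancelF.
rewrite /spow_comm -[scomm_iter c _ _ (absz (Negz p.+1)) _ M]/(
  scomm_iter1 c true (zneg n) (absz n) (spow F (Negz p) M) \so
    smor F true (scomm_iter c true (zneg n) p.+1 (absz n) M)).
by rewrite smorM // scompA [X in _ = X \so _]iter1_cancelF scancel_nat.
Qed.

(** A hexagon: moving [F] past [G^(m + n)] amounts to moving it past [G^m] and [G^n] in turn. Both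
    sides obey the same recursion in [m]. *)
Lemma comm1_dist m n l (e : m + n = l) M :
  comm1 l M \so smor F false (dist G e M) =
  dist G e (F false M) \so smor_pow G m (comm1 n M) \so comm1 m (spow G n M).
Proof.
move: l e; elim/zstep_ind: m => [|m].
  move=> l e; have e' := e; rewrite add0r in e'; case: _ / e' in e *.
  by rewrite !dist0 // smor1 // scompm1 scomp1m scompm1.
have key l l' (e : m + n = l) (e' : zstep false m + n = l') (el : zstep false l = l') :
   (comm1 l' M \so smor F false (dist G e' M)) \so smor F false (step G erefl (spow G n M)) =
   step G el (F false M) \so smor G false (comm1 l M \so smor F false (dist G e M))
     \so c false false _
   /\ (dist G e' (F false M) \so smor_pow G (zstep false m) (comm1 n M)
        \so comm1 (zstep false m) (spow G n M)) \so smor F false (step G erefl (spow G n M)) =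
   step G el (F false M) \so smor G false
     (dist G e (F false M) \so smor_pow G m (comm1 n M) \so comm1 m (spow G n M))
     \so c false false _.
  split.
    rewrite -scompA -(smorM LF) (dist_step LG e e' _ el) (smorM LF) scompA comm1_step.
    by rewrite -!scompA -c_nat !(smorM LG) -!scompA.
  rewrite -[LHS]scompA comm1_step // !scompA -(scompA (dist _ _ _)) -step_nat //.
  by rewrite scompA (dist_step LG e e' _ el) !smorM // !scompA.
split=> IH l e.
  have el : zstep false (m + n) = l by rewrite -e !zstepE; lia.
  have [k1 k2] := key _ _ erefl e el.
  apply: (siso_epic (smor_siso LF false (step_siso LG erefl (spow G n M)))).
  by rewrite k1 k2 IH.
have e' : zstep false m + n = zstep false l by rewrite -e !zstepE; lia.
have [k1 k2] := key _ _ e e' erefl.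
apply: (smor_inj LG (s := false)); apply: (siso_monic (step_siso LG erefl (F false M))).
by apply: (siso_epic (c_iso _ _ _)); rewrite -k1 -k2 IH.
Qed.

(** The type of all shifts of a class of bidegree [(n, m)]. Target indices are variables with
    equations, so that families compose without casts. *)
Definition fam n m M N := forall i j i' j', i + n = i' -> j + m = j' ->
  sHom (spow G i (spow F j M)) (spow G i' (spow F j' N)).

Definition stepF i j j' (e : zstep false j = j') M :
    sHom (F false (spow G i (spow F j M))) (spow G i (spow F j' M)) :=
  smor_pow G i (step F e M) \so comm1 i (spow F j M).

Lemma stepF_iso i j j' (e : zstep false j = j') M : siso (stepF i e M).
Proof.
apply: siso_comp; last exact: comm1_iso.
by apply: smor_pow_siso => //; exact: step_siso.
Qed.

Record compat n m M N (H : fam n m M N) : Prop := Compat {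
  compatG : forall i j i' j' (ei : i + n = i') (ej : j + m = j') i1 i1'
    (e : zstep false i = i1) (e' : zstep false i' = i1') (ei1 : i1 + n = i1'),
    H i1 j i1' j' ei1 ej \so step G e (spow F j M) =
    step G e' (spow F j' N) \so smor G false (H i j i' j' ei ej);
  compatF : forall i j i' j' (ei : i + n = i') (ej : j + m = j') j1 j1'
    (e : zstep false j = j1) (e' : zstep false j' = j1') (ej1 : j1 + m = j1'),
    H i j1 i' j1' ei ej1 \so stepF i e M =
    stepF i' e' N \so smor F false (H i j i' j' ei ej)
}.

(* The shifts stepF and step are invertible, so a compatible family is determined by its
   member at (0, 0); hence the Yoneda product is the composition of families, and
   is associative. *)
Lemma compat_eq n m M N (H K : fam n m M N) : compat H -> compat K ->
  H 0 0 n m (add0r n) (add0r m) = K 0 0 n m (add0r n) (add0r m) ->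
  forall i j i' j' ei ej, H i j i' j' ei ej = K i j i' j' ei ej.
Proof.
move=> hH hK e0.
have e0j j : forall i' j' ei ej, H 0 j i' j' ei ej = K 0 j i' j' ei ej.
  elim/zstep_ind: j => [|j].
    move=> i' j' ei ej; have ei' := ei; have ej' := ej; rewrite !add0r in ei' ej'.
    case: _ / ei' in ei *; case: _ / ej' in ej *.
    by rewrite (Prop_irrelevance ei (add0r n)) (Prop_irrelevance ej (add0r m)).
  split=> IH i' j' ei ej.
    have e' : zstep false (j + m) = j' by rewrite -ej !zstepE; lia.
    apply: (siso_epic (stepF_iso 0 erefl M)).
    by rewrite (compatF hH ei erefl erefl e' ej) (compatF hK ei erefl erefl e' ej) IH.
  have ej1 : zstep false j + m = zstep false j' by rewrite -ej !zstepE; lia.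
  apply: (smor_inj LF (s := false)); apply: (siso_monic (stepF_iso i' erefl N)).
  by rewrite -(compatF hH ei ej erefl erefl ej1) -(compatF hK ei ej erefl erefl ej1) IH.
move=> i j; move: i; elim/zstep_ind => [|i]; first exact: e0j.
split=> IH i' j' ei ej.
  have e' : zstep false (i + n) = i' by rewrite -ei !zstepE; lia.
  apply: (siso_epic (step_siso LG erefl (spow F j M))).
  by rewrite (compatG hH erefl ej erefl e' ei) (compatG hK erefl ej erefl e' ei) IH.
have ei1 : zstep false i + n = zstep false i' by rewrite -ei !zstepE; lia.
apply: (smor_inj LG (s := false)); apply: (siso_monic (step_siso LG erefl (spow F j' N))).
by rewrite -(compatG hH ei ej erefl erefl ei1) -(compatG hK ei ej erefl erefl ei1) IH.
Qed.

(** Apply [G^i F^j] to [f], move [F^j] past [G^n] and add the exponents. The member at the bidegree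
    of [g], composed with [g], is the Yoneda product of [f] and [g]. *)
Definition ext_fam n m M N (f : sHom M (spow G n (spow F m N))) : fam n m M N :=
  fun i j i' j' ei ej =>
  dist G ei (spow F j' N) \so smor_pow G i (smor_pow G n (dist F ej N)
    \so spow_comm c j n (spow F m N) \so smor_pow F j f).

(** Compatibility with [G] is the recursion of [dist]; compatibility with [F] needs the hexagon
    [comm1_dist] and the recursion [comm_step]. *)
Lemma ext_fam_compat n m M N (f : sHom M (spow G n (spow F m N))) : compat (ext_fam f).
Proof.
split=> [i j i' j' ei ej i1 i1' e e' ei1|i j i' j' ei ej j1 j1' e e' ej1]; rewrite /ext_fam.
  by rewrite -scompA -step_nat // scompA (dist_step LG ei ei1 e e') -scompA -smorM.
set u := _ \so smor_pow F j f; set u1 := _ \so smor_pow F j1 f.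
rewrite smorM // /stepF -!scompA (scompA (comm1 i' _)) comm1_dist -!scompA.
rewrite -comm1_nat !scompA; congr (_ \so _).
rewrite -dist_nat // -!scompA; congr (_ \so _); rewrite -!smor_powM //; congr smor_pow.
rewrite {}/u {}/u1 -scompA -step_nat // scompA -(scompA _ _ (step F e _)) comm_step.
rewrite !scompA -smor_powM // (dist_step LF ej ej1 e e') smor_powM // !smorM // !scompA.
congr (_ \so _); rewrite -!scompA; congr (_ \so _).
by rewrite scompA comm1_nat scompA.
Qed.

Lemma spow_comm0 m M : spow_comm c m 0 M = sid _.
Proof.
have h s p : scomm_iter c s false p 0 M = sid (iter p (F s) M).
  by elim: p => //= p ->; rewrite smor1 // scomp1m.
exact: h.
Qed.

Lemma ext_fam_l0 m i j j' M N (f : sHom M (spow F m N)) (ei : i + 0 = i) (ej : j + m = j') :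
  ext_fam (f : sHom M (spow G 0 (spow F m N))) ei ej =
  smor_pow G i (dist F ej N \so smor_pow F j f).
Proof. by rewrite /ext_fam dist_r0 // scomp1m spow_comm0 scompm1. Qed.

Lemma ext_famN n m M N (f : sHom M (spow G n (spow F m N))) i j i' j' (ei : i + n = i')
  (ej : j + m = j') : ext_fam (- f) ei ej = - ext_fam f ei ej.
Proof.
have pN (H : sequiv T) (LH : sequiv_laws H) l P Q (g : sHom P Q) :
    smor_pow H l (- g) = - smor_pow H l g.
  have h t p : smor_iter H t p (- g) = - smor_iter H t p g.
    by elim: p => //= p ->; rewrite smorN.
  exact: h.
by rewrite /ext_fam pN // scompNr pN // scompNr.
Qed.

Lemma ext_fam00 n m M N (f : sHom M (spow G n (spow F m N))) ei ej :
  ext_fam f (i := 0) (j := 0) ei ej = f.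
Proof.
rewrite /ext_fam !dist0 // scomp1m smor_pow1 // scomp1m.
exact: scomp1m.
Qed.

Lemma compat_siso n m M N (H : fam n m M N) : compat H ->
  siso (H 0 0 n m (add0r n) (add0r m)) -> forall i j i' j' ei ej, siso (H i j i' j' ei ej).
Proof.
move=> hH e0.
have e0j j : forall i' j' ei ej, siso (H 0 j i' j' ei ej).
  elim/zstep_ind: j => [|j].
    move=> i' j' ei ej; have ei' := ei; have ej' := ej; rewrite !add0r in ei' ej'.
    case: _ / ei' in ei *; case: _ / ej' in ej *.
    by rewrite (Prop_irrelevance ei (add0r n)) (Prop_irrelevance ej (add0r m)).
  split=> IH i' j' ei ej.
    have e' : zstep false (j + m) = j' by rewrite -ej !zstepE; lia.
    apply: (siso_cancelr (stepF_iso 0 erefl M)).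
    rewrite (compatF hH ei erefl erefl e' ej); apply: siso_comp; first exact: stepF_iso.
    exact: smor_siso.
  have ej1 : zstep false j + m = zstep false j' by rewrite -ej !zstepE; lia.
  apply: (smor_siso_inv LF (s := false)); apply: (siso_cancell (stepF_iso i' erefl N)).
  rewrite -(compatF hH ei ej erefl erefl ej1); apply: siso_comp; first exact: IH.
  exact: stepF_iso.
move=> i j; move: i; elim/zstep_ind => [|i]; first exact: e0j.
split=> IH i' j' ei ej.
  have e' : zstep false (i + n) = i' by rewrite -ei !zstepE; lia.
  apply: (siso_cancelr (step_siso LG erefl (spow F j M))).
  rewrite (compatG hH erefl ej erefl e' ei); apply: siso_comp; first exact: step_siso.
  exact: smor_siso.
have ei1 : zstep false i + n = zstep false i' by rewrite -ei !zstepE; lia.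
apply: (smor_siso_inv LG (s := false)); apply: (siso_cancell (step_siso LG erefl (spow F j' N))).
rewrite -(compatG hH ei ej erefl erefl ei1); apply: siso_comp; first exact: IH.
exact: step_siso.
Qed.

Lemma ext_fam_siso n m M N (f : sHom M (spow G n (spow F m N))) :
  siso f -> forall i j i' j' (ei : i + n = i') (ej : j + m = j'), siso (ext_fam f ei ej).
Proof.
by move=> fi; apply: (compat_siso (ext_fam_compat f)); rewrite ext_fam00.
Qed.

Lemma compat_comp n m n' m' r s L M N (H : fam n m M N) (K : fam n' m' L M) (R : fam r s L N) :
  n' + n = r -> m' + m = s -> compat H -> compat K ->
  (forall i j i1 j1 i2 j2 (ei : i + n' = i1) (ej : j + m' = j1) (ei1 : i1 + n = i2)
     (ej1 : j1 + m = j2) (ei2 : i + r = i2) (ej2 : j + s = j2),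
     R i j i2 j2 ei2 ej2 = H i1 j1 i2 j2 ei1 ej1 \so K i j i1 j1 ei ej) ->
  compat R.
Proof.
move=> er es hH hK RE.
split=> [i j i' j' ei ej i1 i1' e e' ei1|i j i' j' ei ej j1 j1' e e' ej1].
  have p1 : (i + n') + n = i' by rewrite -ei -er; lia.
  have p2 : (j + m') + m = j' by rewrite -ej -es; lia.
  have p3 : zstep false (i + n') = i1 + n' by rewrite -e !zstepE; lia.
  have p4 : (i1 + n') + n = i1' by rewrite -ei1 -er; lia.
  rewrite (RE _ _ _ _ _ _ erefl erefl p1 p2) (RE _ _ _ _ _ _ erefl erefl p4 p2).
  rewrite -scompA (compatG hK erefl erefl e p3 erefl) scompA.
  by rewrite (compatG hH p1 p2 p3 e' p4) -scompA smorM.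
have p1 : (i + n') + n = i' by rewrite -ei -er; lia.
have p2 : (j + m') + m = j' by rewrite -ej -es; lia.
have p3 : zstep false (j + m') = j1 + m' by rewrite -e !zstepE; lia.
have p4 : (j1 + m') + m = j1' by rewrite -ej1 -es; lia.
rewrite (RE _ _ _ _ _ _ erefl erefl p1 p2) (RE _ _ _ _ _ _ erefl erefl p1 p4).
rewrite -scompA (compatF hK erefl erefl e p3 erefl) scompA.
by rewrite (compatF hH p1 p2 p3 e' p4) -scompA smorM.
Qed.

(** Associativity of the Yoneda product: both sides are compatible families with the same member at
    [(0, 0)]. *)
Lemma ext_fam_comp p a q b r s L M N (f : sHom M (spow G p (spow F a N)))
    (g : sHom L (spow G q (spow F b M))) (h : sHom L (spow G r (spow F s N)))
    (er : q + p = r) (es : b + a = s) : ext_fam f er es \so g = h ->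
  forall i j i1 j1 i2 j2 (ei : i + q = i1) (ej : j + b = j1) (ei1 : i1 + p = i2)
    (ej1 : j1 + a = j2) (ei2 : i + r = i2) (ej2 : j + s = j2),
  ext_fam f ei1 ej1 \so ext_fam g ei ej = ext_fam h ei2 ej2.
Proof.
move=> fgh i j i1 j1 i2 j2 ei ej ei1 ej1 ei2 ej2.
have pi' i' i3 : i' + r = i3 -> (i' + q) + p = i3 by rewrite -er; lia.
have pj' j' j3 : j' + s = j3 -> (j' + b) + a = j3 by rewrite -es; lia.
(* [K] takes [i + q] and [j + b] themselves as intermediate indices; [KE] says that any other
   indices and equations give the same composite. *)
pose K : fam r s L N := fun i j i2 j2 ei2 ej2 =>
  ext_fam f (pi' _ _ ei2) (pj' _ _ ej2) \so ext_fam g erefl erefl.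
have KE i' j' i1' j1' i2' j2' (ei' : i' + q = i1') (ej' : j' + b = j1') (ei1' : i1' + p = i2')
     (ej1' : j1' + a = j2') (ei2' : i' + r = i2') (ej2' : j' + s = j2') :
     K i' j' i2' j2' ei2' ej2' = ext_fam f ei1' ej1' \so ext_fam g ei' ej'.
  case: _ / ei' in ei1' *; case: _ / ej' in ej1' *; rewrite /K.
  by congr (ext_fam f _ _ \so _); exact: Prop_irrelevance.
rewrite -(KE _ _ _ _ _ _ ei ej ei1 ej1 ei2 ej2).
apply: (compat_eq (compat_comp er es (ext_fam_compat f) (ext_fam_compat g) KE)
   (ext_fam_compat h)).
by rewrite (KE _ _ _ _ _ _ (add0r q) (add0r b) er es) !ext_fam00.
Qed.

End TwoEquivalences.

(** * Suspension and cosyzygies *)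

Section SuspensionLaws.
Variables (k : comPzRingType) (Ob : Type) (T : addcat k Ob).
Implicit Types M N P Q : fpmod T.
Implicit Type A : automorphism T.

Definition ssus A M N (f : sHom M N) : sHom (sus A M) (sus A N) := scl (susf A (repr f)).

Lemma susf_comp A M N P (g : mhom N P) (f : mhom M N) : susf A (g \mo f) = susf A g \mo susf A f.
Proof. exact: mhomP. Qed.

Lemma susf_add A M N (g f : mhom M N) : susf A (g + f) = susf A g + susf A f.
Proof. by apply: mhomP => X x; rewrite [RHS]mhom_addE -[LHS]/((g + f) _ x) mhom_addE. Qed.

(** A map through [T(-,X)] suspends to a map through [T(-,A X)], so the class is independent of the
    representative. *)
Lemma ssusE A M N (f : mhom M N) : ssus A (scl f) = scl (susf A f).
Proof.
rewrite /ssus; have /scl_eqP [X [a [b ->]]] : scl (repr (scl f)) = scl f by rewrite /scl reprK.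
apply/scl_eqP; exists (A X), (sus_yo A X \mo susf A a), (susf A b \mo sus_yoV A X).
rewrite susf_add susf_comp; congr (_ + _).
by rewrite mcomp_assoc -(mcomp_assoc _ _ (sus_yo A X)) sus_yoVK mcomp_idr.
Qed.

Lemma ssus1 A M : ssus A (sid M) = sid (sus A M).
Proof. by rewrite ssusE; congr scl; exact: mhomP. Qed.

Lemma ssusM A M N P (g : sHom N P) (f : sHom M N) : ssus A (g \so f) = ssus A g \so ssus A f.
Proof.
have [[f' ->] [g' ->]] := (sclP f, sclP g).
by rewrite scl_comp !ssusE scl_comp susf_comp.
Qed.

Lemma ssusD A M N (g f : sHom M N) : ssus A (g + f) = ssus A g + ssus A f.
Proof.
have [[f' ->] [g' ->]] := (sclP f, sclP g).
by rewrite -sclD !ssusE -sclD susf_add.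
Qed.

Lemma susK_nat A M N (f : mhom M N) :
  susK A N \mo susf A (susf (autV A) f) = f \mo susK A M.
Proof. by apply: mhomP => X x; rewrite /= mfun_nat. Qed.

Lemma susK_bij A M : injectivem (susK A M) /\ surjectivem (susK A M).
Proof.
split=> [X x y /= /(congr1 (mact (eqm T (autiK A X))))|X x].
  by rewrite -!mactM eqmK !mact1.
by exists (mact (eqm T (autiK A X)) x); rewrite /= -mactM eqmVK mact1.
Qed.

Lemma inj_surj_siso M N (f : mhom M N) : injectivem f /\ surjectivem f -> siso (scl f).
Proof. by move=> [fI fS]; have [g [e1 e2]] := inj_surj_iso fI fS; exact: scl_siso e1 e2. Qed.

Lemma susK_siso A M : siso (scl (susK A M)).
Proof. by apply: inj_surj_siso; exact: susK_bij. Qed.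

Lemma susK_tri A M : susf A (susK (autV A) M) = susK A (sus A M).
Proof.
apply: mhomP => X x /=; rewrite fmor_eqm; congr (mact (eqm _ _) _).
exact: Prop_irrelevance.
Qed.

Lemma Sigma_laws A : sequiv_laws (Sigma A).
Proof.
split.
- by move=> s M; exact: ssus1.
- by move=> s M N P g f; exact: ssusM.
- by move=> s M N g f; exact: ssusD.
- case=> M N f; have [f' ->] := sclP f.
    rewrite -[smor _ _ (smor _ _ _)]/(ssus (autV A) (ssus A (scl f'))) !ssusE !scl_comp.
    congr scl; exact: (susK_nat (autV A) f').
  rewrite -[smor _ _ (smor _ _ _)]/(ssus A (ssus (autV A) (scl f'))) !ssusE !scl_comp.
  congr scl; exact: susK_nat.
- move=> M; rewrite -[LHS]/(ssus A _) ssusE; congr scl; exact: susK_tri.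
- move=> M; rewrite -[LHS]/(ssus (autV A) _) ssusE; congr scl.
  exact: (susK_tri (autV A)).
case=> M; last exact: susK_siso.
by apply: inj_surj_siso; exact: susK_bij.
Qed.

Lemma ses_sus_map A M N M' N' (s : ses M N) (s' : ses M' N') f h :
  ses_map s s' f h -> ses_map (ses_sus A s) (ses_sus A s') (ssus A f) (ssus A h).
Proof.
move=> [f0 [g [h0 [<- <- e1 e2]]]]; rewrite !ssusE.
exists (susf A f0), (sus_yo A _ \mo susm A g \mo sus_yoV A _), (susf A h0); split=> //=.
  rewrite mcomp_assoc -(mcomp_assoc _ _ (sus_yo A _)) sus_yoVK mcomp_idr -!mcomp_assoc;
    congr (_ \mo _).
  by apply: mhomP => X x; exact: (mhom_app e1 x).
rewrite !mcomp_assoc -(mcomp_assoc _ _ (sus_yo A _)) sus_yoVK mcomp_idr; congr (_ \mo _).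
by apply: mhomP => X x; exact: (mhom_app e2 x).
Qed.

(** Cancelling [A A^-1] is a map of short exact sequences; this gives the compatibility
    [sigma_cancelF] of [sigma] with [scancel]. *)
Lemma susK_ses A M N (s : ses M N) :
  ses_map (ses_sus A (ses_sus (autV A) s)) s (scl (susK A M)) (scl (susK A N)).
Proof.
exists (susK A M), (susK A (yo T (ses_ob s)) \mo susm A (sus_yoV (autV A) _) \mo sus_yoV A _),
  (susK A N); split=> //.
  rewrite -[RHS]susK_nat -[ses_i _]/(sus_yo A _ \mo susm A (sus_yo (autV A) _ \mo susm (autV A)
    (ses_i s))).
  rewrite mcomp_assoc -(mcomp_assoc _ _ (sus_yo A _)) sus_yoVK mcomp_idr -mcomp_assoc;
    congr (_ \mo _).
  by apply: mhomP => X x; exact: sus_yoVKE.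
rewrite -[ses_p (ses_sus _ _)]/(susm A (susm (autV A) (ses_p s) \mo sus_yoV (autV A) _) \mo
  sus_yoV A _).
rewrite !mcomp_assoc; congr (_ \mo _); rewrite -[X in _ = X \mo _]susK_nat.
by apply: mhomP.
Qed.

End SuspensionLaws.

(** * The cosyzygy functor and its commutation with the suspension *)

Section CosyzygyLaws.
Variables (k : comPzRingType) (Ob : Type) (T : addcat k Ob).
Hypothesis hfrob : is_frobenius (modcat T).
Variables (A : automorphism T) (cs : cosyzygies T) (sy : syzygies T).
Implicit Types M N P Q : fpmod T.
Notation S := (Scosyz cs sy).
Notation Sig := (Sigma A).
Notation cse M := (projT2 (cs M)).
Notation sye M := (projT2 (sy M)).

Lemma S_map M N (f : sHom M N) : ses_map (cse M) (cse N) f (smor S false f).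
Proof. exact: ses_pushP. Qed.
Lemma SV_map M N (f : sHom M N) : ses_map (sye M) (sye N) (smor S true f) f.
Proof. exact: ses_pullP. Qed.
Lemma scancel_map M : ses_map (cse (S true M)) (sye M) (sid _) (scancel S false M).
Proof. exact: ses_pushP. Qed.
Lemma scancelV_map M : ses_map (sye (S false M)) (cse M) (scancel S true M) (sid _).
Proof. exact: ses_pullP. Qed.
Lemma sigma_map s M : ses_map (ses_sus (auts A s) (cse M)) (cse (Sig s M)) (sid _)
  (sigma A cs sy s false M).
Proof. exact: ses_pushP. Qed.
Lemma sigmaV_map s M : ses_map (ses_sus (auts A s) (sye M)) (sye (Sig s M))
  (sigma A cs sy s true M) (sid _).
Proof. exact: ses_pullP. Qed.

(** Each equation compares ends of two maps of short exact sequences that agree at the other end.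
    The laws of [sigma] are obtained in the same way. *)
Lemma Scosyz_laws : sequiv_laws S.
Proof.
split.
- case=> M; first exact: (ses_pullE hfrob (ses_map_id _)).
  exact: (ses_pushE hfrob (ses_map_id _)).
- case=> M N P g f; first exact: (ses_pullE hfrob (ses_map_comp (SV_map f) (SV_map g))).
  exact: (ses_pushE hfrob (ses_map_comp (S_map f) (S_map g))).
- case=> M N g f; first exact: (ses_pullE hfrob (ses_mapD (SV_map g) (SV_map f))).
  exact: (ses_pushE hfrob (ses_mapD (S_map g) (S_map f))).
- case=> M N f /=.
    have := ses_map_comp (SV_map (smor S false f)) (scancelV_map N).
    have := ses_map_comp (scancelV_map M) (S_map f); rewrite scomp1m scompm1 => m1 m2.
    exact: (ses_map_funl hfrob m2 m1).
  have := ses_map_comp (S_map (smor S true f)) (scancel_map N).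
  have := ses_map_comp (scancel_map M) (SV_map f); rewrite scomp1m scompm1 => m1 m2.
  exact: (ses_map_funr hfrob m2 m1).
- move=> M; apply: (ses_map_funr hfrob (S_map _)).
  have := ses_map_comp (scancel_map (S false M)) (scancelV_map M).
  by rewrite scompm1 scomp1m.
- move=> M; apply: (ses_map_funl hfrob (SV_map _)).
  have := ses_map_comp (scancelV_map (S true M)) (scancel_map M).
  by rewrite scompm1 scomp1m.
case=> M; first exact: (proj2 (ses_map_iso hfrob (scancelV_map M)) (siso_id _)).
exact: (proj1 (ses_map_iso hfrob (scancel_map M)) (siso_id _)).
Qed.

Lemma sigma_iso s t M : siso (sigma A cs sy s t M).
Proof.
case: t; first exact: (proj2 (ses_map_iso hfrob (sigmaV_map s M)) (siso_id _)).
exact: (proj1 (ses_map_iso hfrob (sigma_map s M)) (siso_id _)).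
Qed.

Lemma sigma_nat s t M N (f : sHom M N) :
  smor S t (smor Sig s f) \so sigma A cs sy s t M = sigma A cs sy s t N \so smor Sig s (smor S t
    f).
Proof.
case: t.
  have := ses_map_comp (sigmaV_map s M) (SV_map (smor Sig s f)).
  have := ses_map_comp (ses_sus_map (auts A s) (SV_map f)) (sigmaV_map s N).
  rewrite scomp1m scompm1 => m1 m2; exact: (ses_map_funl hfrob m2 m1).
have := ses_map_comp (sigma_map s M) (S_map (smor Sig s f)).
have := ses_map_comp (ses_sus_map (auts A s) (S_map f)) (sigma_map s N).
rewrite scomp1m scompm1 => m1 m2; exact: (ses_map_funr hfrob m2 m1).
Qed.

Lemma sigma_cancelG M :
  scancel S false (Sig false M) \so smor S false (sigma A cs sy false true M)
    \so sigma A cs sy false false (S true M) = smor Sig false (scancel S false M).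
Proof.
have m1 := ses_map_comp (sigma_map false (S true M))
  (ses_map_comp (S_map (sigma A cs sy false true M)) (scancel_map (Sig false M))).
have m2 := ses_map_comp (ses_sus_map A (scancel_map M)) (sigmaV_map false M).
move: m1 m2; rewrite scompm1 scomp1m ssus1 scompm1 scomp1m => m1 m2.
exact: (ses_map_funr hfrob m1 m2).
Qed.

Lemma sigma_cancelF t M :
  smor S t (scancel Sig false M) \so sigma A cs sy false t (Sig true M)
    \so smor Sig false (sigma A cs sy true t M) = scancel Sig false (S t M).
Proof.
case: t.
  have m1 := ses_map_comp (ses_sus_map A (sigmaV_map true M))
    (ses_map_comp (sigmaV_map false (Sig true M)) (SV_map (scancel Sig false M))).
  have m2 := susK_ses A (sye M).
  move: m1 m2; rewrite ssus1 !scompm1 => m1 m2.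
  exact: (ses_map_funl hfrob m1 m2).
have m1 := ses_map_comp (ses_sus_map A (sigma_map true M))
  (ses_map_comp (sigma_map false (Sig true M)) (S_map (scancel Sig false M))).
have m2 := susK_ses A (cse M).
move: m1 m2; rewrite ssus1 !scompm1 => m1 m2.
exact: (ses_map_funr hfrob m1 m2).
Qed.

End CosyzygyLaws.

(** * Graded elements of the bigraded ring *)

Section GradedElements.
Variables (k : comPzRingType) (Ob : Type) (T : addcat k Ob).
Hypothesis hfrob : is_frobenius (modcat T).
Variables (A : automorphism T) (cs : cosyzygies T) (sy : syzygies T).
Implicit Types L M N P Q : fpmod T.
Notation G := (Scosyz cs sy).
Notation F := (Sigma A).
Notation Ext := (Ext A cs sy).
Notation sig := (sigma A cs sy).

Let LF := Sigma_laws A.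
Let LG := Scosyz_laws hfrob cs sy.
Let c_iso := sigma_iso hfrob A cs sy.
Let c_nat := sigma_nat hfrob A cs sy.
Let c_G := sigma_cancelG hfrob A cs sy.
Let c_F := sigma_cancelF hfrob A cs sy.
Notation efam := (ext_fam sig).

Let famc p a q b r s L M N f g h er es := 
  @ext_fam_comp k Ob T F G LF LG sig c_iso c_nat c_G c_F p a q b r s L M N f g h er es.

Lemma ext_cast_trans n n' n'' m m' m'' (en : n = n') (en' : n' = n'') (em : m = m')
    (em' : m' = m'') M N (e : Ext n m M N) :
  ext_cast en' em' (ext_cast en em e) = ext_cast (etrans en en') (etrans em em') e.
Proof. by case: _ / en'; case: _ / em'. Qed.

Lemma ext_cast_refl n m (en : n = n) (em : m = m) M N (e : Ext n m M N) : ext_cast en em e = e.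
Proof. by rewrite (eq_axiomK en) (eq_axiomK em). Qed.

Lemma yprod_fam p a q b L M N (f : Ext p a M N) (g : Ext q b L M) r s
    (er : q + p = r) (es : b + a = s) (er' : p + q = r) (es' : a + b = s) :
  ext_cast er' es' (yprod f g) = (efam f er es \so g : Ext r s L N).
Proof.
case: _ / er in er' *; case: _ / es in es' *.
rewrite /yprod ext_cast_trans ext_cast_refl /ext_fam.
by rewrite !(smor_powM LG) !scompA.
Qed.

(** The condition [hhgP] at [g], with products written as members of families; the quantified index
    [r] absorbs the casts. *)
Definition graded_at n m (phi : forall M, Ext n m M M) q M N (g : gHom A q M N) :=
  forall r (e1 : n + 0 = n) (e2 : m + q = r) (e3 : 0 + n = n) (e4 : q + m = r),
  (efam (scl g : Ext 0 q M N) e1 e2 \so phi M) *~ (-1) ^+ absz (m * q) =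
  efam (phi N) e3 e4 \so scl g.

Lemma hhg_graded n m (phi : forall M, Ext n m M M) q M N (g : gHom A q M N) :
  (ext_lact g (phi M) *~ (-1) ^+ absz (m * q) =
    ext_cast erefl (addrC m q) (ext_ract (phi N) g)) <-> graded_at phi g.
Proof.
have h1 (e1 : n + 0 = n) (e2 : m + q = q + m) :
    ext_lact g (phi M) = efam (scl g : Ext 0 q M N) e1 e2 \so phi M.
  exact: yprod_fam.
have h2 (e3 : 0 + n = n) :
    ext_cast erefl (addrC m q) (ext_ract (phi N) g) = efam (phi N) e3 erefl \so scl g.
  by rewrite /ext_ract ext_cast_trans; exact: yprod_fam.
split=> [h r e1 e2 e3 e4|h]; last by rewrite (h1 (addr0 n) (addrC m q)) (h2 (add0r n)); exact: h.
by case: _ / e4 in e2 *; rewrite -h1 h h2.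
Qed.

Lemma mulrz_sign p M N (x : sHom M N) : x *~ (-1) ^+ p = if odd p then - x else x.
Proof. by rewrite -signr_odd; case: odd; rewrite ?expr0 ?expr1 ?mulrN1z ?mulr1z. Qed.

(** * Bidegree (3, -1): the graded condition as naturality and a sign *)

Section DegreeThree.
Variable phi : forall M, Ext 3%:Z (Negz 0) M M.

Notation S3 f := (smor G false (smor G false (smor G false f))).

Definition natural_ext := forall M N (g : mhom M N),
  S3 (smor F true (scl g)) \so phi M = phi N \so scl g.

Definition theta M : sHom (F false M) (G false (G false (G false M))) :=
  S3 (scancel F true M) \so phi (F false M).

(** [delta] for a bare family, not yet known to satisfy a Hochschild condition. *)
Definition deltaf M : sHom (F false M) (G false (G false (G false M))) :=
  S3 (scancel F false M) \so smor G false (smor G false (sig false false (F true M)))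
  \so smor G false (sig false false (G false (F true M)))
  \so sig false false (G false (G false (F true M))) \so smor F false (phi M).

Lemma deltafE M : deltaf M =
  S3 (scancel F false M) \so (comm1 sig 3%:Z (F true M) \so smor F false (phi M)).
Proof.
pose c X := sig false false X; set X := F true M.
rewrite -[comm1 _ _ _]/(smor G false (smor G false (smor G false (sid _) \so c X)
  \so c (G false X)) \so c (G false (G false X))).
by rewrite !(smorM LG) !(smor1 LG) scomp1m !scompA.
Qed.

Lemma graded0 M N (g : mhom M N) :
  graded_at phi (q := 0) (g : gHom A 0 M N) <->
  S3 (smor F true (scl g)) \so phi M = phi N \so scl g.
Proof.
have h (e1 : 3%:Z + 0 = 3%:Z) (e2 : Negz 0 + 0 = Negz 0) : 
    efam (scl g : Ext 0 0 M N) e1 e2 = S3 (smor F true (scl g)).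
  by rewrite (ext_fam_l0 LF LG) (dist_r0 LF) scomp1m.
split=> [/(_ _ (addr0 _) (addr0 _) (add0r _) (add0r _))|h0 r e1 e2 e3 e4].
  by rewrite h mulr0 expr0 mulr1z (ext_fam00 LG).
have e2' := e2; rewrite addr0 in e2'; case: _ / e2' in e2 e4 *.
by rewrite h mulr0 expr0 mulr1z (ext_fam00 LG).
Qed.

Lemma dist_scancel q q' (e : zstep false q = q') (e' : Negz 0 + q' = q) N :
  dist F e' N \so smor F true (step F e N) = scancel F true (spow F q N).
Proof.
apply: (smor_inj LF (s := false)); apply: (siso_monic (step_siso LF e N)).
rewrite (smorM LF) scompA -(dist_step LF e' (add0r q') erefl e) dist0 scomp1m.
rewrite -[step F _ (spow F q' N)]/(scancel F false (spow F q' N)) (scancel_nat LF).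
by rewrite (scancel_tri0 LF).
Qed.

Section Shift.
Hypothesis phi_nat : natural_ext.

Lemma natural_ext_scl M N (g : sHom M N) : S3 (smor F true g) \so phi M = phi N \so g.
Proof. by have [g' ->] := sclP g; exact: phi_nat. Qed.

(** The class of [phi] at [Sigma^q N], with target rewritten as [S^3 Sigma^(q-1) N]; the graded
    condition compares it with the shift of [phi N] by [Sigma^q]. *)
Definition shifted q r (e : Negz 0 + q = r) N :
    sHom (spow F q N) (spow G 3%:Z (spow F r N)) :=
  smor_pow G 3%:Z (dist F e N) \so phi (spow F q N).

Lemma shifted_theta q q' (e : zstep false q = q') (e' : Negz 0 + q' = q) N :
  shifted e' N \so step F e N = theta (spow F q N).
Proof.
rewrite /shifted -scompA -natural_ext_scl scompA /theta -(dist_scancel e e').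
by rewrite -[S3 (_ \so _)]/(smor_pow G 3%:Z (_ \so _)) (smor_powM LG).
Qed.

Lemma shifted_delta q r r' (e : Negz 0 + q = r) (e' : zstep false r = r') (er : q = r') N :
  stepF sig 3%:Z e' N \so smor F false (shifted e N) =
  ecast l (sHom (F false (spow F q N)) (spow G 3%:Z (spow F l N))) er (deltaf (spow F q N)).
Proof.
case: _ / er in e' *; rewrite /stepF /shifted (smorM LF) scompA -(scompA _ (comm1 _ _ _)).
rewrite -(comm1_nat LG c_nat) scompA -smor_powM //.
rewrite -(dist_step LF e (add0r q) erefl e') dist0 scomp1m.
by rewrite -scompA deltafE.
Qed.

(** Raising [q] by one suspends [efam (phi N)]. Suspending [shifted] gives [deltaf] at [Sigma^q N],
    whereas the next [shifted] is [theta] there, so each step costs one sign. *)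
Lemma graded_shift : (forall M, deltaf M = - theta M) ->
  forall q r (e3 : 0 + 3%:Z = 3%:Z) (e4 : q + Negz 0 = r) (e : Negz 0 + q = r) N,
  efam (phi N) e3 e4 = shifted e N *~ (-1) ^+ absz q.
Proof.
move=> dt q r e3; elim/zstep_ind: q r => [|q].
  move=> r e4 e; have e' := e; rewrite addr0 in e'; case: _ / e' in e e4 *.
move=> N;   rewrite (ext_fam00 LG) /shifted (dist_r0 LF) expr0 mulr1z.
  by rewrite (smor_pow1 LG) scomp1m.
have pq : Negz 0 + zstep false q = q by rewrite zstepE addrC; exact: addrK.
have sgn P Q (x : sHom P Q) : x *~ (-1) ^+ absz (zstep false q) = - (x *~ (-1) ^+ absz q).
  rewrite !mulrz_sign; have -> : odd (absz (zstep false q)) = ~~ odd (absz q).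
    by case: (q) => [p|[|p]] //=; rewrite !negbK.
  by case: odd; rewrite ?opprK.
have key r (e4 : q + Negz 0 = r) (e : Negz 0 + q = r) (e4' : zstep false q + Negz 0 = q) N :
    (efam (phi N) e3 e4 = shifted e N *~ (-1) ^+ absz q) <->
    (efam (phi N) e3 e4' = shifted pq N *~ (-1) ^+ absz (zstep false q)).
  have e' : zstep false r = q by rewrite zstepE -e addrC; exact: addNKr.
  have := compatF (ext_fam_compat LF LG c_iso c_nat c_G c_F (phi N)) e3 e4 erefl e' e4'.
  have -> : stepF sig 0 (erefl (zstep false q)) N = step F erefl N.
    exact: scompm1.
  move=> kc; have kd := shifted_delta e e' erefl N; rewrite /= dt in kd.
  rewrite -(shifted_theta erefl pq) in kd.
  split=> h.
    apply: (siso_epic (step_siso LF erefl N)); rewrite kc h sgn; move: kd.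
    rewrite !mulrz_sign; case: odd => kd; last by rewrite kd scompNl.
    by rewrite (smorN LF) scompNr kd !opprK.
  apply: (smor_inj LF (s := false)).
  apply: (siso_monic (stepF_iso LF LG c_iso 3%:Z e' N)); rewrite -kc h sgn; move: kd.
  rewrite !mulrz_sign; case: odd => kd; last by rewrite kd scompNl.
  by rewrite (smorN LF) scompNr kd !opprK.
split=> IH r e4 e N.
  have er : q = r by rewrite -e pq.
  case: _ / er in e4 e *; rewrite (Prop_irrelevance e pq).
  by apply/(key _ (addrC _ _) erefl); exact: IH.
apply/(key _ _ _ (etrans (addrC _ _) pq)); exact: IH.
Qed.

Lemma graded_all : (forall M, deltaf M = - theta M) ->
  forall q M N (g : gHom A q M N), graded_at phi g.
Proof.
move=> dt q M N g r e1 e2 e3 e4; rewrite (graded_shift dt _ _ e2).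
rewrite (ext_fam_l0 LF LG) smor_powM // -!scompA.
have -> : smor_pow F (Negz 0) (scl g) = smor F true (scl g) by [].
rewrite /shifted.
have -> : smor_pow G 3%:Z (smor F true (scl g)) \so phi M = phi (spow F q N) \so scl g.
  exact: natural_ext_scl.
rewrite !mulrz_sign; have -> : odd (absz (Negz 0 * q)) = odd (absz q) by rewrite abszM mul1n.
by case: odd; rewrite ?scompNl -scompA.
Qed.

Lemma graded_delta : (forall q M N (g : gHom A q M N), graded_at phi g) ->
  forall M, deltaf M = - theta M.
Proof.
move=> gr M.
(* The identity of [Sigma M] is a morphism of degree 1 from [Sigma M] to [M]; its Koszul exponent
   [-1 * 1] is odd. *)
have := gr 1 (F false M) M (mid (F false M)) 0 (addr0 _) (addNr 1) (add0r _) (addrN 1).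
rewrite scompm1 (ext_fam_l0 LF LG) -[scl _]/(sid (F false M)) smor_pow1 // scompm1.
rewrite -[X in X *~ _]/(shifted (addNr 1) M) mulrz_sign /=.
have := compatF (ext_fam_compat LF LG c_iso c_nat c_G c_F (phi M))
  (add0r 3%:Z) (add0r (Negz 0)) erefl erefl (addrN 1).
have -> : stepF sig 0 (erefl (zstep false 0)) M = sid _.
  exact: scompm1.
rewrite scompm1 (ext_fam00 LG) => -> e.
have := shifted_delta (q := 0) (r := Negz 0) erefl erefl erefl M => /=.
rewrite /shifted (dist_r0 LF) (smor_pow1 LG) scomp1m => <-.
rewrite -e; congr (- _); have := shifted_theta (q := 0) erefl (addNr 1) M.
by rewrite -[step _ _ _]/(sid (F false M)) scompm1.
Qed.

End Shift.
End DegreeThree.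

Lemma efam_id M i j (ei : i + 0 = i) (ej : j + 0 = j) :
  efam (ext1 A cs sy M) ei ej = sid _.
Proof. by rewrite (ext_fam_l0 LF LG) (dist_r0 LF) scomp1m (smor_pow1 LF) (smor_pow1 LG). Qed.

(** The first product says that [psi M] is a right inverse of a shift of [phi M]; shifting by
    [(n, m)] gives a right inverse of [phi M] itself, and the second product says that it is a left
    inverse too. *)
Lemma unit_siso n m (phi : HH0_graded A cs sy n m) : hh_unit phi -> forall M, siso (phi M).
Proof.
move=> [psi psiP] M; have [u1 u2] := psiP M.
move: u1 u2; rewrite (yprod_fam _ _ (addNr n) (addNr m)) (yprod_fam _ _ (addrN n) (addrN m)) =>
  u1 u2.
have := famc u1 (addrN n) (addrN m) (add0r n) (add0r m) (addr0 n) (addr0 m).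
rewrite (ext_fam00 LG) efam_id => u3.
by exists (efam (psi M) (addrN n) (addrN m)).
Qed.

(** The inverse in the ring is the inverse of the shift of [phi M] by [(-n, -m)], a map from
    [S^(-n) Sigma^(-m) M] to [M]. Its graded condition follows from that of [phi] by cancelling
    shifts of [phi]. *)
Lemma siso_unit n m (phi : HH0_graded A cs sy n m) : (forall M, siso (phi M)) -> hh_unit phi.
Proof.
move=> phii.
have phif M i j i' j' (ei : i + n = i') (ej : j + m = j') : siso (efam (phi M) ei ej).
  exact: (ext_fam_siso LF LG c_iso c_nat c_G c_F (phii M)).
pose psi M : Ext (- n) (- m) M M := sval (cid (phif M _ _ _ _ (addNr n) (addNr m))).
have u1 M : efam (phi M) (addNr n) (addNr m) \so psi M = ext1 A cs sy M.
  by rewrite /psi; case: cid => /= x [].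
have u2 M : efam (psi M) (addrN n) (addrN m) \so phi M = ext1 A cs sy M.
  have := famc (u1 M) (addrN n) (addrN m) (add0r n) (add0r m) (addr0 n) (addr0 m).
  rewrite (ext_fam00 LG) efam_id => u3; apply: (siso_monic (phii M)).
  by rewrite scompA u3 scomp1m; exact: esym (scompm1 _).
have gr q M N (g : gHom A q M N) : graded_at psi g.
  move=> r e1 e2 e3 e4.
  have p1 : - n + n = 0 by rewrite addNr.
  have e5 : - m + (q + m) = q by rewrite addrCA addNr addr0.
  have p2 : r + m = q by rewrite -e4 subrK.
  apply: (siso_monic (phif N _ _ _ _ p1 p2)).
  have -> : efam (phi N) p1 p2 \so (efam (psi N) e3 e4 \so scl g) = scl g.
    by rewrite scompA (famc (u1 N) e3 e4 p1 p2 (addr0 0) (addr0 q)) efam_id scomp1m.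
  have := proj1 (hhg_graded phi g) (hhgP phi g) _ (addr0 n) (addrC m q) (add0r n) erefl => gphi.
  (* [h] is the product of [phi] with [g], and [h'] below that of [g] with [phi]. They agree up to
     the Koszul sign; [k1] and [k2] compute their shifts by [(-n, -m)]. *)
  pose h := efam (phi N) (add0r n) erefl \so scl g.
  have k1 : efam (phi N) p1 p2 \so efam (scl g : Ext 0 q M N) e1 e2 =
            efam (h : Ext n (q + m) M N) p1 e5.
    exact: (famc (erefl h)).
  pose h' := efam (scl g : Ext 0 q M N) (addr0 n) (addrC m q) \so phi M.
  have k2 : efam (scl g : Ext 0 q M N) (add0r 0) (add0r q) \so efam (phi M) (addNr n) (addNr m)
     = efam (h' : Ext n (q + m) M N) p1 e5.
    exact: (famc (erefl h')).
  have hh' : h = if odd (absz (m * q)) then - h' else h'.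
    by rewrite -mulrz_sign /h' gphi.
  rewrite mulrz_sign.
  have -> : odd (absz (- m * q)) = odd (absz (m * q)) by rewrite mulNr abszN.
  move: k2; rewrite (ext_fam00 LG) => k2.
  have k3 : efam (h' : Ext n (q + m) M N) p1 e5 \so psi M = scl g.
    by rewrite -k2 -scompA u1; exact: scompm1.
  move: hh'; case: odd => hh'.
    by rewrite scompNr scompA k1 hh' (ext_famN LF LG) scompNl opprK.
  by rewrite scompA k1 hh'.
exists (HH0Graded (fun q M N g => proj2 (hhg_graded psi g) (gr q M N g))) => M /=; split.
  by rewrite (yprod_fam _ _ (addNr n) (addNr m)); exact: u1.
by rewrite (yprod_fam _ _ (addrN n) (addrN m)); exact: u2.
Qed.

End GradedElements.

(** * Heller's condition *)

Section HellerCondition.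
Variables (k : comPzRingType) (Ob : Type) (T : addcat k Ob).
Hypothesis hfrob : is_frobenius (modcat T).
Variables (A : automorphism T) (cs : cosyzygies T) (sy : syzygies T).
Implicit Types L M N P Q : fpmod T.
Notation G := (Scosyz cs sy).
Notation F := (Sigma A).
Notation sig := (sigma A cs sy).
Notation S1 f := (smor G false f).
Notation S3 f := (S1 (S1 (S1 f))).

Let LF := Sigma_laws A.
Let LG := Scosyz_laws hfrob cs sy.
Let c_nat := sigma_nat hfrob A cs sy.

Definition anticomm (x : forall M, sHom (F false M) (G false (G false (G false M)))) :=
  forall M, S1 (x M) \so sig false false M + x (G false M) = 0.

(** Naturality along [x M] equates [S3 (x M) \so x (Sigma M)] with [x (S^3 M) \so Sigma (x M)].
    Three uses of anticommutativity turn [x (S^3 M)] into [- S3 (x M)] followed by the commutation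
    of Sigma with [S^3], and [S3 (x M)] cancels. *)
Lemma anticomm_shift (x : forall M, sHom (F false M) (G false (G false (G false M)))) :
  (forall M, siso (x M)) -> (forall M N (g : sHom M N), S3 g \so x M = x N \so smor F false g) ->
  anticomm x -> forall M, x (F false M) = - (comm1 sig 3%:Z M \so smor F false (x M)).
Proof.
move=> xi xn xa M; have xS N : x (G false N) = - (S1 (x N) \so sig false false N).
  by apply/eqP; rewrite -addr_eq0 addrC xa.
apply: (siso_monic (smor_siso LG false (smor_siso LG false (smor_siso LG false (xi M))))).
rewrite xn 3!xS -[comm1 _ _ _]/(smor G false (smor G false (smor G false (sid _) \so sig false
  false M)
  \so sig false false (G false M)) \so sig false false (G false (G false M))).
by rewrite !((smorM LG), (smorN LG), (smor1 LG), scompNl, scompNr, opprK, scomp1m, scompA).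
Qed.

Variable phi : forall M, Ext A cs sy 3%:Z (Negz 0) M M.
Hypothesis phi_nat : natural_ext phi.

Lemma theta_nat M N (g : sHom M N) : S3 g \so theta phi M = theta phi N \so smor F false g.
Proof.
rewrite /theta -[RHS]scompA -(natural_ext_scl phi_nat) !scompA; congr (_ \so _).
by rewrite -!(smorM LG) (scancel_nat LF).
Qed.

Lemma deltaf_nat M N (g : sHom M N) : S3 g \so deltaf phi M = deltaf phi N \so smor F false g.
Proof.
have : S3 (smor F false (smor F true g)) \so comm1 sig 3%:Z (F true M) =
  comm1 sig 3%:Z (F true N) \so smor F false (S3 (smor F true g)) := comm1_nat LG c_nat 3%:Z
    (smor F true g).
rewrite !(deltafE hfrob).
move: (comm1 sig 3%:Z (F true M)) (comm1 sig 3%:Z (F true N)) => c1 c2 cn.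
rewrite -!scompA -(smorM LF) -(natural_ext_scl phi_nat) (smorM LF) (scompA c2) -cn !scompA.
by rewrite -!(smorM LG) (scancel_nat LF).
Qed.

Lemma comm1_theta M : comm1 sig 3%:Z M \so smor F false (theta phi M) = deltaf phi (F false M).
Proof.
have : S3 (smor F false (scancel F true M)) \so comm1 sig 3%:Z (F true (F false M)) =
  comm1 sig 3%:Z M \so smor F false (S3 (scancel F true M)) := comm1_nat LG c_nat 3%:Z (scancel
    F true M).
rewrite (deltafE hfrob).
move: (comm1 sig 3%:Z M) (comm1 sig 3%:Z (F true (F false M))) => c1 c2 cn.
by rewrite (smorM LF) !scompA -cn (scancel_tri0 LF).
Qed.

Lemma theta_siso M : (forall N, siso (phi N)) -> siso (theta phi M).
Proof.
move=> h; apply: siso_comp; last exact: h.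
by do 3!apply: (smor_siso LG); exact: (scancel_iso LF true).
Qed.

Lemma theta_delta : (forall N, siso (phi N)) -> anticomm (theta phi) ->
  forall M, deltaf phi M = - theta phi M.
Proof.
move=> h ha M; have e N : deltaf phi (F false N) = - theta phi (F false N).
  rewrite -comm1_theta (anticomm_shift _ _ ha) ?opprK // => [L|L L' g].
    exact: theta_siso.
  exact: theta_nat.
(* The equation holds at suspensions; naturality carries it to [M] along the isomorphism from
   [Sigma Sigma^-1 M]. *)
apply: (siso_epic (smor_siso LF false (scancel_iso LF false M))).
by rewrite -deltaf_nat e scompNl -theta_nat scompNr.
Qed.

End HellerCondition.

(** * Classes of three-fold extensions *)

Section ExtensionClasses.
Variables (k : comPzRingType) (Ob : Type) (T : addcat k Ob).
Hypothesis hab : is_abelian (modcat T).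
Hypothesis hfrob : is_frobenius (modcat T).
Variables (cs : cosyzygies T) (sy : syzygies T).
Implicit Types L M N P Q B : fpmod T.
Notation G := (Scosyz cs sy).
Notation S1 f := (smor G false f).
Notation cse M := (projT2 (cs M)).

Let LG := Scosyz_laws hfrob cs sy.

Definition ses_class M N (s : ses M N) : sHom N (G false M) := ses_push s (cse M) (sid M).

Lemma ses_class_map M N (s : ses M N) : ses_map s (cse M) (sid M) (ses_class s).
Proof. exact: ses_pushP. Qed.

Lemma ses_class_siso M N (s : ses M N) : siso (ses_class s).
Proof. exact: (proj1 (ses_map_iso hfrob (ses_class_map s)) (siso_id _)). Qed.

Lemma ses_class_cse M : ses_class (cse M) = sid _.
Proof. exact: (ses_pushE hfrob (ses_map_id _)). Qed.

Lemma ses_class_nat M N M' N' (s : ses M N) (s' : ses M' N') f h :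
  ses_map s s' f h -> ses_class s' \so h = S1 f \so ses_class s.
Proof.
move=> m; have m1 := ses_map_comp m (ses_class_map s');
  have m2 := ses_map_comp (ses_class_map s) (S_map hfrob cs sy f).
by move: m1 m2; rewrite scomp1m scompm1; exact: ses_map_funr.
Qed.

(** By hypothesis [h] differs from the end induced by [f] by some [b \mo a] through a representable.
    Lifting [b] along [ses_p s'] corrects the middle map, so [f] and [h] themselves fit together,
    not only their stable classes. *)
Lemma ses_fill M N M' N' (s : ses M N) (s' : ses M' N') (f : mhom M M') (h : mhom N N') :
  ses_class s' \so scl h = S1 (scl f) \so ses_class s ->
  exists g, g \mo ses_i s = ses_i s' \mo f /\ h \mo ses_p s = ses_p s' \mo g.
Proof.
move=> e; have [g1 [h1 [gi hp]]] := ses_fwd hfrob s s' f.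
have m : ses_map s s' (scl f) (scl h1) by exists f, g1, h1.
have /scl_eqP [X [a [b hE]]] : scl h = scl h1.
  by apply: (siso_monic (ses_class_siso s')); rewrite e (ses_class_nat m).
have [c cE] := yo_proj b (fun X => @sesS _ _ _ _ _ s' X).
exists (g1 + c \mo a \mo ses_p s); split.
  by rewrite mcompDl -mcomp_assoc ses_pi mcomp0r addr0.
by rewrite hE mcompDl mcompDr hp !mcomp_assoc cE addrC.
Qed.

Definition is_ses M X N (i : mhom M (yo T X)) (p : mhom (yo T X) N) :=
  [/\ injectivem i, exactm i p & surjectivem p].

(** Since the proof is matched on, the projections of [mk_ses h] reduce only once [h] is
    destructed. *)
Definition mk_ses M X N (i : mhom M (yo T X)) (p : mhom (yo T X) N) (h : is_ses i p) : ses M N :=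
  let: And3 hi he hs := h in Ses hi he hs.

Lemma mk_ses_map M X N (i : mhom M (yo T X)) (p : mhom (yo T X) N) (h : is_ses i p)
   M' X' N' (i' : mhom M' (yo T X')) (p' : mhom (yo T X') N') (h' : is_ses i' p')
   (f : mhom M M') (g : mhom (yo T X) (yo T X')) (l : mhom N N') :
  g \mo i = i' \mo f -> l \mo p = p' \mo g -> ses_map (mk_ses h) (mk_ses h') (scl f) (scl l).
Proof. by case: h h' => [h1 h2 h3] [h1' h2' h3'] e1 e2; exists f, g, l. Qed.

Lemma mk_ses_map_cse M X N (i : mhom M (yo T X)) (p : mhom (yo T X) N) (h : is_ses i p) M'
   (f : mhom M M') g (l : mhom N (Sob cs sy false M')) :
  g \mo i = ses_i (cse M') \mo f -> l \mo p = ses_p (cse M') \mo g ->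
  ses_map (mk_ses h) (cse M') (scl f) (scl l).
Proof. by case: h => [h1 h2 h3] e1 e2; exists f, g, l. Qed.

Lemma mk_ses_fill M X N (i : mhom M (yo T X)) (p : mhom (yo T X) N) (h : is_ses i p)
   M' X' N' (i' : mhom M' (yo T X')) (p' : mhom (yo T X') N') (h' : is_ses i' p')
   (f : mhom M M') (l : mhom N N') :
  ses_class (mk_ses h') \so scl l = S1 (scl f) \so ses_class (mk_ses h) ->
  exists g, g \mo i = i' \mo f /\ l \mo p = p' \mo g.
Proof. by case: h h' => [h1 h2 h3] [h1' h2' h3'] /ses_fill. Qed.

Definition seq4 N X Y Z M (a : mhom N (yo T X)) (f : mhom (yo T X) (yo T Y))
   (g : mhom (yo T Y) (yo T Z)) (l : mhom (yo T Z) M) :=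
  [/\ injectivem a, exactm a f, exactm f g, exactm g l & surjectivem l].

Lemma seq4_split N X Y Z M (a : mhom N (yo T X)) (f : mhom (yo T X) (yo T Y))
   (g : mhom (yo T Y) (yo T Z)) (l : mhom (yo T Z) M) : seq4 a f g l ->
  exists B1 B2 p1 (i2 : mhom B1 _) p2 (i3 : mhom B2 _),
    [/\ is_ses a p1, is_ses i2 p2, is_ses i3 l, f = i2 \mo p1 & g = i3 \mo p2].
Proof.
move=> [aI af fg gl lS].
have [B1 [p1 [i2 [p1S i2I fE]]]] := image_ex hab (f : mhom (yo T X) (yo T Y)).
have [B2 [p2 [i3 [p2S i3I gE]]]] := image_ex hab (g : mhom (yo T Y) (yo T Z)).
exists B1, B2, p1, i2, p2, i3; split=> //; split=> // W y.
- split=> [py|[x <-]]; first by apply/af; rewrite fE /= py mfun0.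
  by apply: (i2I W); rewrite mfun0 -[LHS]/((i2 \mo p1) W _) -fE; apply/af; exists x.
- split=> [py|[x <-]].
    have /fg [x xE] : g W y = 0 by rewrite gE /= py mfun0.
    by exists (p1 W x); rewrite -xE fE.
  have [x' <-] := p1S W x; apply: (i3I W); rewrite mfun0 -[LHS]/((i3 \mo p2) W _) -gE.
  by apply/fg; exists x'; rewrite fE.
split=> [/gl [x xE]|[x <-]]; first by exists (p2 W x); rewrite -xE gE.
by have [x' <-] := p2S W x; apply/gl; exists x'; rewrite gE.
Qed.

Lemma ses_seq4 N X Y Z M B1 B2 (a : mhom N (yo T X)) p1 (i2 : mhom B1 (yo T Y)) p2
   (i3 : mhom B2 (yo T Z)) (l : mhom (yo T Z) M) : is_ses a p1 -> is_ses i2 p2 -> is_ses i3 l ->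
  seq4 a (i2 \mo p1) (i3 \mo p2) l.
Proof.
move=> [aI ap p1S] [i2I ip2 p2S] [i3I il lS]; split=> // W y.
- split=> [/= e|[x <-]]; first by apply/ap; apply: (i2I W); rewrite e mfun0.
  by have e : p1 W (a W x) = 0 by [apply/ap; exists x]; rewrite /= e mfun0.
- split=> [/= e|[x <-] /=].
    have /ip2 [b <-] : p2 W y = 0 by apply: (i3I W); rewrite e mfun0.
    by have [x <-] := p1S W b; exists x.
  by have -> : p2 W (i2 W (p1 W x)) = 0; [apply/ip2; exists (p1 W x)|rewrite mfun0].
split=> [/il [b <-]|[x <-] /=]; first by have [x <-] := p2S W b; exists x.
by apply/il; exists (p2 W x).
Qed.

(** The vertical maps in [represents] amount to maps from the three short exact sequences to the
    chosen cosyzygy sequences, linked at their ends and starting with the identity of [N].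
    Naturality of [ses_class] along this chain gives the product. *)
Lemma represents_ses_class N X Y Z M B1 B2 (a : mhom N (yo T X)) p1 (i2 : mhom B1 (yo T Y)) p2
   (i3 : mhom B2 (yo T Z)) (l : mhom (yo T Z) M)
   (h1 : is_ses a p1) (h2 : is_ses i2 p2) (h3 : is_ses i3 l) e :
  @represents _ _ _ cs sy _ _ _ _ _ a (i2 \mo p1) (i3 \mo p2) l e <->
  e = S1 (S1 (ses_class (mk_ses h1)) \so ses_class (mk_ses h2)) \so ses_class (mk_ses h3).
Proof.
have key b1 b2 b3 : ses_map (mk_ses h1) (cse N) (sid N) b1 ->
    ses_map (mk_ses h2) (cse (G false N)) b1 b2 ->
    ses_map (mk_ses h3) (cse (G false (G false N))) b2 b3 ->
    b3 = S1 (S1 (ses_class (mk_ses h1)) \so ses_class (mk_ses h2)) \so ses_class (mk_ses h3).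
  move=> /ses_class_nat m1 /ses_class_nat m2 /ses_class_nat m3; move: m1 m2 m3.
  by rewrite !ses_class_cse !scomp1m (smor1 LG) scomp1m => <- <- <-.
split=> [[_ [k1 [k2 [k3 [h [e1 e2 e3 e4 <-]]]]]]|->]; last first.
  split; first exact: ses_seq4 h1 h2 h3.
  have [k1 [b1 [e1 e1']]] := ses_fwd hfrob (mk_ses h1) (cse N) (mid N).
  have [k2 [b2 [e2 e2']]] := ses_fwd hfrob (mk_ses h2) (cse _) b1.
  have [k3 [b3 [e3 e3']]] := ses_fwd hfrob (mk_ses h3) (cse _) b2.
  have e4 := key (scl b1) (scl b2) (scl b3).
  move: k1 k2 k3 e1 e2 e3 e1' e2' e3' e4.
  case: h1 h2 h3 {key} => [? ? ?] [? ? ?] [? ? ?] /= k1 k2 k3 e1 e2 e3 e1' e2' e3' e4.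
  exists k1, k2, k3, b3; split.
  - by rewrite e1 mcomp_idr.
  - by rewrite mcomp_assoc e2 -mcomp_assoc e1' mcomp_assoc.
  - by rewrite mcomp_assoc e3 -mcomp_assoc e2' mcomp_assoc.
  - by [].
  by apply: e4; [exists (mid N), k1, b1|exists b1, k2, b2|exists b2, k3, b3].
have [[aI ap p1S] [i2I ip2 p2S] [i3I il lS]] := And3 h1 h2 h3.
have [|b1 b1E] := @desc_surj _ _ _ _ _ _ p1 (ses_p (cse N) \mo k1) p1S.
  move=> W x /ap [y <-]; have /= -> := mhom_app e1 y; exact: (mhom_app (ses_pi (cse N)) y).
have e2' : k2 \mo i2 = ses_i (cse _) \mo b1.
  by apply: (surj_epi p1S); rewrite -mcomp_assoc e2 -[RHS]mcomp_assoc b1E mcomp_assoc.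
have [|b2 b2E] := @desc_surj _ _ _ _ _ _ p2 (ses_p (cse _) \mo k2) p2S.
  move=> W x /ip2 [y <-]; have /= -> := mhom_app e2' y;
    exact: (mhom_app (ses_pi (cse _)) (b1 W y)).
have e3' : k3 \mo i3 = ses_i (cse _) \mo b2.
  by apply: (surj_epi p2S); rewrite -mcomp_assoc e3 -[RHS]mcomp_assoc b2E mcomp_assoc.
apply: (key (scl b1) (scl b2)).
- by apply: (mk_ses_map_cse h1 (g := k1)); rewrite ?mcomp_idr.
- exact: (mk_ses_map_cse h2 e2' b2E).
exact: (mk_ses_map_cse h3 e3' e4).
Qed.

(** The class is invertible because each [ses_class] is: a sequence with representable middle term
    is stably a cosyzygy sequence. *)
Lemma represents_ex N X Y Z M (a : mhom N (yo T X)) (f : mhom (yo T X) (yo T Y))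
   (g : mhom (yo T Y) (yo T Z)) (l : mhom (yo T Z) M) : seq4 a f g l ->
  exists e, [/\ siso e & @represents _ _ _ cs sy _ _ _ _ _ a f g l e].
Proof.
move=> /seq4_split [B1 [B2 [p1 [i2 [p2 [i3 [h1 h2 h3 -> ->]]]]]]].
exists (S1 (S1 (ses_class (mk_ses h1)) \so ses_class (mk_ses h2)) \so ses_class (mk_ses h3));
  split.
  apply: siso_comp; last exact: ses_class_siso.
  apply: (smor_siso LG); apply: siso_comp; last exact: ses_class_siso.
  by apply: (smor_siso LG); exact: ses_class_siso.
exact/(represents_ses_class h1 h2 h3).
Qed.

(** The vertical maps induce [b1] and [b2] on the images; the naturality squares of the three
    [ses_class] compose. *)
Lemma represents_map N X Y Z M (a : mhom N (yo T X)) (f : mhom (yo T X) (yo T Y))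
   (g : mhom (yo T Y) (yo T Z)) (l : mhom (yo T Z) M) e
   N' X' Y' Z' M' (a' : mhom N' (yo T X')) (f' : mhom (yo T X') (yo T Y'))
   (g' : mhom (yo T Y') (yo T Z')) (l' : mhom (yo T Z') M') e'
   (n : mhom N N') (x : mhom (yo T X) (yo T X')) (y : mhom (yo T Y) (yo T Y'))
   (z : mhom (yo T Z) (yo T Z')) (m : mhom M M') :
  @represents _ _ _ cs sy _ _ _ _ _ a f g l e ->
  @represents _ _ _ cs sy _ _ _ _ _ a' f' g' l' e' ->
  x \mo a = a' \mo n -> y \mo f = f' \mo x -> z \mo g = g' \mo y -> m \mo l = l' \mo z ->
  e' \so scl m = S1 (S1 (S1 (scl n))) \so e.
Proof.
move=> r r' e1 e2 e3 e4.
have [B1 [B2 [p1 [i2 [p2 [i3 [h1 h2 h3 fE gE]]]]]]] := seq4_split (proj1 r).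
have [B1' [B2' [p1' [i2' [p2' [i3' [h1' h2' h3' fE' gE']]]]]]] := seq4_split (proj1 r').
move: r r'; rewrite fE gE fE' gE' in e2 e3 * => /(represents_ses_class h1 h2 h3) ->.
move=> /(represents_ses_class h1' h2' h3') ->.
have [[aI ap p1S] [i2I ip2 p2S] [i3I il lS]] := And3 h1 h2 h3.
have [[aI' ap' p1S'] [i2I' ip2' p2S'] [i3I' il' lS']] := And3 h1' h2' h3'.
have [|b1 b1E] := @desc_surj _ _ _ _ _ _ p1 (p1' \mo x) p1S.
  move=> W u /ap [v <-]; have /= -> := mhom_app e1 v; by apply/ap'; exists (n W v).
have e2' : y \mo i2 = i2' \mo b1.
  by apply: (surj_epi p1S); rewrite -mcomp_assoc e2 -[RHS]mcomp_assoc b1E mcomp_assoc.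
have [|b2 b2E] := @desc_surj _ _ _ _ _ _ p2 (p2' \mo y) p2S.
  move=> W u /ip2 [v <-]; have /= -> := mhom_app e2' v; by apply/ip2'; exists (b1 W v).
have e3' : z \mo i3 = i3' \mo b2.
  by apply: (surj_epi p2S); rewrite -mcomp_assoc e3 -[RHS]mcomp_assoc b2E mcomp_assoc.
have m1 := ses_class_nat (mk_ses_map h1 h1' e1 b1E).
have m2 := ses_class_nat (mk_ses_map h2 h2' e2' b2E).
have m3 := ses_class_nat (mk_ses_map h3 h3' e3' e4).
rewrite -scompA m3 !scompA -!(smorM LG); congr (smor _ _ _ \so _).
by rewrite -scompA m2 !scompA -!(smorM LG) m1.
Qed.

End ExtensionClasses.

(** * Stable pullbacks and adjunction with the suspension *)

Section ModuleSequences.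
Variables (k : comPzRingType) (Ob : Type) (T : klincat k Ob).

Lemma exactm_iso (M N P M' N' P' : rmod T) (f : mhom M N) (g : mhom N P)
    (f' : mhom M' N') (g' : mhom N' P') (x : mhom M M') (y : mhom N N') (z : mhom P P') :
  y \mo f = f' \mo x -> z \mo g = g' \mo y -> surjectivem x -> surjectivem y ->
  injectivem z -> exactm f g -> exactm f' g'.
Proof.
move=> e1 e2 xS yS zI fg W v; split=> [v0|[u <-]].
  have [w wv] := yS W v; rewrite -wv in v0 *.
  have /fg [u uw] : g W w = 0.
    by apply: (zI W); rewrite mfun0; have /= -> := mhom_app e2 w.
  by exists (x W u); have /= <- := mhom_app e1 u; rewrite uw.
have [w <-] := xS W u; have /= <- := mhom_app e1 w.
have /= <- := mhom_app e2 (f W w).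
have -> : g W (f W w) = 0 by apply/fg; exists w.
exact: mfun0.
Qed.

Lemma mid_bij (M : rmod T) : injectivem (mid M) /\ surjectivem (mid M).
Proof. by split=> [X x y|X x] //; exists x. Qed.

Lemma inverse_bij (M N : rmod T) (f : mhom M N) g : g \mo f = mid M -> f \mo g = mid N ->
  injectivem f /\ surjectivem f.
Proof.
move=> e1 e2; split=> [X x y e|X y]; last by exists (g X y); exact: (mhom_app e2).
have := congr1 (g X) e; have /= -> := mhom_app e1 x; by have /= -> := mhom_app e1 y.
Qed.

End ModuleSequences.

Section StablePullback.
Variables (k : comPzRingType) (Ob : Type) (T : addcat k Ob).
Hypothesis hidem : idempotent_complete T.
Hypothesis hab : is_abelian (modcat T).
Hypothesis hfrob : is_frobenius (modcat T).
Implicit Types L M N P Q B : fpmod T.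

(* The middle term of the pulled back sequence is stably zero, hence representable. *)
Lemma pullback_ses Q N M (s : ses Q N) (v : mhom M N) : siso (scl v) ->
  exists C (i : mhom Q (yo T C)) (l : mhom (yo T C) M) (h : is_ses i l),
    ses_map (mk_ses h) s (sid Q) (scl v).
Proof.
move=> [w' [wv vw]]; have [w wE] := sclP w'; subst w'.
have [E [e [j [ej EI EU]]]] := pullback_ex hab v (ses_p s).
have [iota [ei ji]] : exists u : mhom Q E, e \mo u = 0 /\ j \mo u = ses_i s.
  by apply: EU; rewrite ses_pi mcomp0r.
have eS : surjectivem e.
  move=> X m; have [p pm] := sesS s (v X m).
  have [|u [eu ju]] := EU (yo T X) (yel m) (yel p).
    by apply: yo_ext; rewrite /= mact1 compm1 pm.
  by exists (u X (idm T X)); have := mhom_app eu (idm T X); rewrite yel1.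
have ie : exactm iota e.
  move=> X x; split=> [ex|[q <-]]; last exact: (mhom_app ei q).
  have /(sesE s) [q qj] : ses_p s X (j X x) = 0.
    by have /= <- := mhom_app ej x; rewrite ex mfun0.
  exists q; apply: EI; first by rewrite ex; exact: (mhom_app ei q).
  by rewrite -qj; exact: (mhom_app ji q).
move: wv vw; rewrite !scl_comp => /scl_eqP [Z [a [b wv]]] /scl_eqP [Z' [c [d vw]]].
have [d' dE] := yo_proj d (fun X => @sesS _ _ _ _ _ s X).
(* [t] lies over [w \mo ses_p s]; its other component is a corrected identity, since [v \mo w] is
   the identity only up to [d \mo c]. *)
have [t [et jt]] : exists u : mhom (yo T (ses_ob s)) E,
    e \mo u = w \mo ses_p s /\ j \mo u = mid _ + d' \mo c \mo ses_p s.
  apply: EU; rewrite mcomp_assoc vw mcompDl mcompDr mcomp_idr mcomp_idl addrC; congr (_ + _).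
  by rewrite !mcomp_assoc dE.
have [b' bE] := yo_proj b eS.
have tI : t \mo ses_i s = iota.
  apply: mhomP => X x; apply: EI.
    have /= -> := mhom_app et (ses_i s X x); have /= -> := mhom_app ei x.
    by have /= -> := mhom_app (ses_pi s) x; rewrite mfun0.
  have /= -> := mhom_app jt (ses_i s X x); have /= -> := mhom_app ji x.
  rewrite scale1r; have /= -> := mhom_app (ses_pi s) x.
  by rewrite (mfun0 c) (mfun0 d') addr0.
have iotaI : injectivem iota.
  move=> X x y exy; apply: (sesI s); have /= <- := mhom_app ji x.
  by have /= <- := mhom_app ji y; rewrite exy.
(* This combination is killed by [e], hence factors through [iota = t \mo ses_i s]. Solving for
   [mid E] writes the identity of [E] as a sum of maps through representables. *)
have [|rho rhoE] := @lift_inj _ _ _ _ _ _ iota (mid E - t \mo j + b' \mo a \mo e) iotaI.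
  move=> X x; apply/ie; apply: (mhom_app (_ : e \mo _ = 0)).
  rewrite !mcompDr mcompNr !mcomp_assoc et bE -[w \mo _ \mo _]mcomp_assoc -ej mcomp_assoc wv.
  by rewrite mcompDl mcomp_idr mcomp_idl opprD addrCA subrr addr0 addNr.
have : scl (mid E) = 0.
  have -> : mid E = t \mo (ses_i s \mo rho + j) - b' \mo (a \mo e).
    by rewrite mcompDr mcomp_assoc tI rhoE mcomp_assoc (addrAC (_ - _)) subrK addrK.
  rewrite sclB; have -> : scl (t \mo (ses_i s \mo rho + j)) = 0.
    by apply/scl_eq0; exists (ses_ob s), (ses_i s \mo rho + j), t.
  rewrite sub0r; have -> : scl (b' \mo (a \mo e)) = 0 by apply/scl_eq0; exists Z, (a \mo e), b'.
  exact: oppr0.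
move/scl_eq0=> [X [a1 [b1 /esym e1]]].
have [C [u [u' [uu' u'u]]]] := summand_yo hidem e1.
have [uI uS] := inverse_bij u'u uu'.
have h : is_ses (u \mo iota) (e \mo u').
  split.
  - move=> W x y /= /uI exy; apply: (sesI s); have /= <- := mhom_app ji x.
    by have /= <- := mhom_app ji y; rewrite exy.
  - apply: (exactm_iso (x := mid Q) (y := u) (z := mid M) _ _ _ _ _ ie) => //.
    + by rewrite mcomp_idr.
    + by rewrite -mcomp_assoc u'u mcomp_idl mcomp_idr.
    + by case: (mid_bij Q).
    + by case: (mid_bij M).
  by move=> W m; have [x <-] := eS W m; exists (u W x); have /= -> := mhom_app u'u x.
exists C, (u \mo iota), (e \mo u'), h.
case: h => h1 h2 h3; exists (mid Q), (j \mo u'), v; split=> //=.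
  by rewrite mcomp_assoc -(mcomp_assoc j) u'u mcomp_idr ji mcomp_idr.
by rewrite !mcomp_assoc ej.
Qed.

End StablePullback.

Section Opposite.
Variables (k : comPzRingType) (Ob : Type) (T : klincat k Ob).

Lemma compNl X Y Z (g : T Y Z) (f : T X Y) : (- g) \oc f = - (g \oc f).
Proof. by have := comp_linl f (-1) g 0; rewrite comp0m !addr0 !scaleN1r. Qed.

Lemma compNr X Y Z (g : T Y Z) (f : T X Y) : g \oc (- f) = - (g \oc f).
Proof. by have := comp_linr g (-1) f 0; rewrite compm0 !addr0 !scaleN1r. Qed.

Lemma yomN X Y (f : T X Y) : yom (- f) = - yom f.
Proof. by apply: mhomP => W x; rewrite mhom_oppE /= compNl. Qed.

End Opposite.

(** * Maps from Sigma^-1 M to T(-,X) and from M to T(-,Sigma X) *)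

Section Adjoint.
Variables (k : comPzRingType) (Ob : Type) (T : addcat k Ob).
Variable A : automorphism T.
Implicit Types L M N P Q B : fpmod T.

Lemma fmor_inj X Y (f g : T X Y) : fmor A f = fmor A g -> f = g.
Proof.
move=> e; have := autKm A f; rewrite e autKm => /(congr1 (fun h => h \oc eqm T (esym (autK A
  X)))).
by rewrite -!compA eqmVK !compm1.
Qed.

Lemma fmor_full X Y (h : T (A X) (A Y)) : exists f, fmor A f = h.
Proof.
exists (eqm T (autK A Y) \oc fmor (auti A) h \oc eqm T (esym (autK A X))).
rewrite !fmorM !fmor_eqm.
rewrite (Prop_irrelevance (congr1 A (autK A Y)) (autiK A (A Y))) autiKm -compA eqm_trans.
by rewrite (Prop_irrelevance (etrans _ _) erefl) compm1.
Qed.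

Lemma fmor0 X Y : fmor A (0 : T X Y) = 0.
Proof. by have := fmor_lin A (-1) (0 : T X Y) 0; rewrite scaler0 addr0 scaleN1r addNr. Qed.

(* b is Sigma a, under Sigma Sigma^-1 M = M and Sigma T(-,X) = T(-,Sigma X). *)
Definition adj M X (a : mhom (sus (autV A) M) (yo T X)) (b : mhom M (yo T (A X))) :=
  forall Z (z : M (A Z)), fmor A (a Z z) = b (A Z) z.

Lemma adj_ex M X (b : mhom M (yo T (A X))) : exists a, adj a b.
Proof.
have [h hE] : {h : forall Z, M (A Z) -> T Z X | forall Z z, fmor A (h Z z) = b (A Z) z}.
  by exists (fun Z z => sval (cid (fmor_full (b (A Z) z)))) => Z z; case: cid.
have l Z r (x y : M (A Z)) : h Z (r *: x + y) = r *: h Z x + h Z y.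
  by apply: fmor_inj; rewrite fmor_lin !hE mfun_lin.
have n Z W (g : T Z W) (y : M (A W)) : h Z (mact (fmor A g) y) = h W y \oc g.
  by apply: fmor_inj; rewrite fmorM !hE mfun_nat.
by exists (@Mhom _ _ _ (sus (autV A) M) (yo T X) h l n).
Qed.

Lemma adj_uniq M X (a a' : mhom (sus (autV A) M) (yo T X)) b : adj a b -> adj a' b -> a = a'.
Proof. by move=> e e'; apply: mhomP => Z z; apply: fmor_inj; rewrite e e'. Qed.

Lemma fix_eqm M W (z : M W) : mact (eqm T (esym (autiK A W))) (mact (eqm T (autiK A W)) z) = z.
Proof. by rewrite -mactM eqmVK mact1. Qed.

(** Every [W] equals [A (auti A W)], so the values at objects [A Z] determine a map. *)
Lemma mhom_on_image M (N : rmod T) (b b' : mhom M N) :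
  (forall Z (z : M (A Z)), b (A Z) z = b' (A Z) z) -> b = b'.
Proof. by move=> h; apply: mhomP => W z; rewrite -(fix_eqm z) (mfun_nat b) (mfun_nat b') h. Qed.

Lemma adj_uniqr M X (a : mhom (sus (autV A) M) (yo T X)) b b' : adj a b -> adj a b' -> b = b'.
Proof. by move=> e e'; apply: mhom_on_image => Z z; rewrite -e e'. Qed.

Lemma adj_inj M X (a : mhom (sus (autV A) M) (yo T X)) b : adj a b ->
  (injectivem a <-> injectivem b).
Proof.
move=> ab; split=> h; apply/injectivemP => W z e.
  have : b (A (auti A W)) (mact (eqm T (autiK A W)) z) = 0 by rewrite mfun_nat e mact0.
  rewrite -ab => e'; rewrite -(fix_eqm z).
  suff -> : mact (eqm T (autiK A W)) z = 0 by rewrite mact0.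
  apply: (h (auti A W)); rewrite mfun0; apply: fmor_inj; rewrite e'.
  exact: esym (fmor0 _ _).
apply: (h (A W)); rewrite mfun0 -ab e.
exact: fmor0.
Qed.

Lemma adj_yo M X Y (a : mhom (sus (autV A) M) (yo T X)) b (x : T X Y) : adj a b ->
  adj (yom x \mo a) (yom (fmor A x) \mo b).
Proof. by move=> ab Z z; rewrite /= fmorM ab. Qed.

Lemma adj_mod M N X (a : mhom (sus (autV A) M) (yo T X)) b (m : mhom N M) : adj a b ->
  adj (a \mo susf (autV A) m) (b \mo m).
Proof. by move=> ab Z z; rewrite /= ab. Qed.

Lemma adj_exact M X Y (a : mhom (sus (autV A) M) (yo T X)) b (f : T X Y) : adj a b ->
  (exactm a (yom f) <-> exactm b (yom (fmor A f))).
Proof.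
move=> ab; split=> h W y.
  have key (z : yo T (A X) (A (auti A W))) : yom (fmor A f) _ z = 0 <-> exists x, b _ x = z.
    have [z' zE] := fmor_full z; rewrite -zE /= -fmorM; split=> [fz|[x xE]].
      have /h [x xE] : yom f _ z' = 0.
        apply: fmor_inj; rewrite [LHS]fz.
        exact: esym (fmor0 _ _).
      by exists x; rewrite -ab xE.
    have <- : a _ x = z' by apply: fmor_inj; rewrite ab.
    have -> : f \oc a _ x = 0 by apply/(h _ (a _ x)); exists x.
    exact: fmor0.
  split=> [fy|[x <-]].
    have /key [x xE] : yom (fmor A f) _ (mact (eqm T (autiK A W)) y) = 0 by rewrite mfun_nat fy
      mact0.
    by exists (mact (eqm T (esym (autiK A W))) x); rewrite mfun_nat xE fix_eqm.
  rewrite -(fix_eqm x) mfun_nat mfun_nat.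
  suff -> : yom (fmor A f) _ (b _ (mact (eqm T (autiK A W)) x)) = 0 by rewrite mact0.
  by apply/key; eexists.
split=> [fy|[x <-]].
  have /h [x xE] : yom (fmor A f) (A W) (fmor A y) = 0.
    by rewrite [LHS]/= -fmorM; move: fy => /= ->; rewrite fmor0.
  by exists x; apply: fmor_inj; rewrite ab.
apply: fmor_inj; rewrite fmor0 [LHS]fmorM ab; apply/(h _ (b (A W) x)); by exists x.
Qed.

Lemma adj_sus (K : fpmod T) X (u : mhom K (yo T X)) :
  adj (u \mo (susK (autV A) K : mhom (sus (autV A) (sus A K)) K)) (sus_yo A X \mo susf A u).
Proof.
move=> Z z /=; rewrite mfun_nat /= fmorM fmor_eqm; congr (_ \oc eqm T _).
exact: Prop_irrelevance.
Qed.

End Adjoint.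

(** * The triangles attached to a natural extension class *)

Section ExactTriangles.
Variables (k : comPzRingType) (Ob : Type) (T : addcat k Ob).
Hypothesis hidem : idempotent_complete T.
Hypothesis hab : is_abelian (modcat T).
Hypothesis hfrob : is_frobenius (modcat T).
Variables (A : automorphism T) (cs : cosyzygies T) (sy : syzygies T).
Implicit Types K L M N P Q B : fpmod T.
Implicit Type t : triangle A.
Notation G := (Scosyz cs sy).
Notation F := (Sigma A).
Notation sig := (sigma A cs sy).
Notation S1 f := (smor G false f).
Notation S3 f := (S1 (S1 (S1 f))).
Notation cse M := (projT2 (cs M)).
Notation clm h := (ses_class cs sy (mk_ses h)).
Notation repr4 := (@represents _ _ T cs sy _ _ _ _ _).

Let LF := Sigma_laws A.
Let LG := Scosyz_laws hfrob cs sy.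

Lemma natural_hhP (phi : forall M, Ext A cs sy 3%:Z (Negz 0) M M) :
  natural_ext phi <-> (forall M N (g : mhom M N),
    ext_lact (g : gHom A 0 M N) (phi M) =
    ext_cast erefl (addrC (Negz 0) 0) (ext_ract (phi N) (g : gHom A 0 M N))).
Proof.
have key M N (g : mhom M N) := hhg_graded hfrob phi (q := 0) g.
split=> h M N g; have := key M N g; rewrite mulr0 expr0 mulr1z => kg.
  exact/kg/(graded0 hfrob)/h.
exact/(graded0 hfrob)/kg/h.
Qed.

Variable phi : HH0_deg0 A cs sy 3%:Z (Negz 0).

Lemma hh_natural : natural_ext phi.
Proof. by apply/natural_hhP; exact: hhP. Qed.

(** The conditions of [phi_exact] on the image factorization alone, so that two factorizations of
    one triangle can be compared. *)
Definition factors t M (l : mhom (yo T (triC t)) M) (b : mhom M (yo T (A (triX t))))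
    (a : mhom (Sigma A true M) (yo T (triX t))) :=
  [/\ surjectivem l, injectivem b, yom (triq t) = b \mo l & adj a b].

(** [phi_exact] provides one image factorization; any other differs by an isomorphism [m] of images,
    and naturality of [phi] along [m] moves the class. *)
Lemma exact_transport t M l b a : phi_exact phi t -> @factors t M l b a ->
  repr4 a (yom (trif t)) (yom (trii t)) l (phi M).
Proof.
move=> [M' [l' [b' [a' [lS' bI' qE' ab' r]]]]] [lS bI qE ab].
have [|m mE] := @desc_surj _ _ _ _ _ _ l' l lS'.
  move=> W x x0; apply: (bI W); rewrite mfun0 -[LHS]/((b \mo l) W x) -qE qE' /= x0.
  exact: (mfun0 b').
have bm : b \mo m = b' by apply: (surj_epi lS'); rewrite -mcomp_assoc mE -qE.
have am : a \mo susf (autV A) m = a'.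
  by apply: (adj_uniq _ ab'); rewrite -bm; exact: adj_mod.
have mI : injectivem m by move=> W x y e; apply: (bI' W); rewrite -bm /= e.
have mS : surjectivem m.
  by move=> W y; have [x <-] := lS W y; exists (l' W x); exact: (mhom_app mE x).
have [aI' af fi il lS''] := proj1 r.
have s4 : seq4 a (yom (trif t)) (yom (trii t)) l.
  split=> //; first exact/(adj_inj ab).
    apply: (exactm_iso (x := susf (autV A) m) (y := mid _) (z := mid _) _ _ _ _ _ af).
    - by rewrite am mcomp_idl.
    - by rewrite mcomp_idl mcomp_idr.
    - by move=> W; exact: mS.
    - by case: (mid_bij (yo T (triX t))).
    by case: (mid_bij (yo T (triY t))).
  apply: (exactm_iso (x := mid _) (y := mid _) (z := m) _ _ _ _ _ il).
  - by rewrite mcomp_idl mcomp_idr.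
  - by rewrite mcomp_idr.
  - by case: (mid_bij (yo T (triY t))).
  - by case: (mid_bij (yo T (triC t))).
  exact: mI.
have [e [_ re]] := represents_ex hab hfrob cs sy s4.
have := represents_map hab hfrob (n := susf (autV A) m) (x := mid _) (y := mid _)
  (z := mid _) (m := m) r re (etrans (mcomp_idl _) (esym am))
  (etrans (mcomp_idl _) (esym (mcomp_idr _))) (etrans (mcomp_idl _) (esym (mcomp_idr _)))
  (etrans mE (esym (mcomp_idr _))).
have := hh_natural m; rewrite -[smor F true (scl m)]/(ssus (autV A) (scl m)) ssusE => -> e1.
suff <- : e = phi M by [].
apply: (siso_epic (inj_surj_siso (conj mI mS))); exact: e1.
Qed.

Hypothesis phi_siso : forall M, siso (phi M).

(** A prescribed image [M] makes the statement serve twice: for the existence of cones, and for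
    recovering [phi M] at every [M] from the triangles. *)
Lemma exact_completion M X Y (a : mhom (Sigma A true M) (yo T X)) b (f : T X Y) :
  injectivem b -> adj a b -> exactm a (yom f) ->
  exists C (i : T Y C) (q : T C (A X)) l, factors (t := Triangle f i q) l b a /\
    repr4 a (yom f) (yom i) l (phi M).
Proof.
move=> bI ab af; have aI := proj2 (adj_inj ab) bI.
have [B [p1 [i2 [p1S i2I fE]]]] := image_ex hab (yom f).
pose Q := coker i2; pose p2 : mhom (yo T Y) Q := coker_pi i2.
have h1 : is_ses a p1.
  split=> // W x; split=> [px|/af]; first by apply/af; rewrite fE /= px mfun0.
  by rewrite fE /= => e; apply: (i2I W); rewrite e mfun0.
have h2 : is_ses i2 p2 by split=> //; [exact: coker_pi_exact|exact: coker_pi_surj].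
pose w := S1 (S1 (clm h1) \so clm h2).
have wi : siso w.
  by apply: (smor_siso LG); apply: siso_comp; [apply: (smor_siso LG)|]; exact: ses_class_siso.
have [w' [ww' w'w]] := wi.
have [v vE] := sclP (w' \so phi M).
have vi : siso (scl v) by rewrite -vE; apply: siso_comp => //; exists w.
have [C [i3 [l [h3 m3]]]] := pullback_ses hidem hab (cse Q) vi.
have c3 : clm h3 = scl v.
  by have := ses_class_nat hfrob cs sy m3; rewrite (ses_class_cse hfrob) scomp1m (smor1 LG)
    scomp1m.
have [i3I i3l lS] := h3.
pose i : T Y C := (i3 \mo p2) Y (idm T Y); pose q : T C (A X) := (b \mo l) C (idm T C).
have iE : yom i = i3 \mo p2 by rewrite /i -[yom _]yo_full.
have qE : yom q = b \mo l by rewrite /q -[yom _]yo_full.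
exists C, i, q, l; split; first by split.
rewrite iE fE; apply/(represents_ses_class hfrob h1 h2 h3).
by rewrite c3 -vE scompA w'w scomp1m.
Qed.

Lemma phi_exactI t M l b a : @factors t M l b a ->
  repr4 a (yom (trif t)) (yom (trii t)) l (phi M) -> phi_exact phi t.
Proof. by move=> [lS bI qE ab] r; exists M, l, b, a. Qed.

Lemma phi_exact_cone X Y (f : T X Y) :
  exists C (i : T Y C) (q : T C (A X)), phi_exact phi (Triangle f i q).
Proof.
have [K [u [uI uf]]] := kernel_ex hab (yom f).
have ab := adj_sus u : adj (A := A) _ _; have uV := susK_bij (autV A) K.
have [||C [i [q [l [fc r]]]]] := @exact_completion (sus A K) X Y _ _ f _ ab _.
- by apply/(adj_inj ab) => W x y e; apply: (proj1 uV); exact: (uI W).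
- move=> W y; split=> [/uf [x <-]|[x <-]]; last by apply/uf; eexists.
  by have [x' <-] := proj2 uV W x; exists x'.
by exists C, i, q; exact: phi_exactI fc r.
Qed.

Lemma phi_exact_iso t t' : triangle_iso t t' -> phi_exact phi t -> phi_exact phi t'.
Proof.
move=> [x [y [z [[[x' [x1 x2]] [y' [y1 y2]] [z' [z1 z2]]] [ef ei eq]]]]].
move=> [M [l [b [a [lS bI qE ab r]]]]].
have bij X Y (u : T X Y) u' : u' \oc u = idm T X -> u \oc u' = idm T Y ->
    injectivem (yom u) /\ surjectivem (yom u).
  move=> e1 e2; apply: (inverse_bij (g := yom u')); rewrite -yom_comp ?e1 ?e2; exact: yom_id.
have [xI xS] := bij _ _ _ _ x1 x2; have [yI yS] := bij _ _ _ _ y1 y2.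
have [zI zS] := bij _ _ _ _ z1 z2; have [z'I z'S] := bij _ _ _ _ z2 z1.
have yf : yom y \mo yom (trif t) = yom (trif t') \mo yom x by rewrite -!yom_comp ef.
have zi : yom z \mo yom (trii t) = yom (trii t') \mo yom y by rewrite -!yom_comp ei.
have lz : (l \mo yom z') \mo yom z = l by rewrite -mcomp_assoc -yom_comp z1 yom_id mcomp_idr.
have [FxI _] : injectivem (yom (fmor A x)) /\ surjectivem (yom (fmor A x)).
  by apply: (bij _ _ _ (fmor A x')); rewrite -fmorM ?x1 ?x2 fmor1.
have fc : @factors t' M (l \mo yom z') (yom (fmor A x) \mo b) (yom x \mo a).
  split.
  - by move=> W m; have [u <-] := lS W m; have [v <-] := z'S W u; exists v.
  - by move=> W m m' /FxI /bI.
  - rewrite mcomp_assoc -(mcomp_assoc _ b l) -[b \mo l]qE -!yom_comp -eq -compA z2.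
    by rewrite compm1.
  exact: adj_yo.
apply: (phi_exactI fc).
have [aI af fi il _] := proj1 r; have [idI idS] := mid_bij (sus (autV A) M).
have s4 : seq4 (yom x \mo a) (yom (trif t')) (yom (trii t')) (l \mo yom z').
  split.
  - by move=> W m m' /xI /aI.
  - apply: (exactm_iso (x := mid _) (y := yom x) (z := yom y) _ yf idS xS yI af).
    by rewrite mcomp_idr.
  - exact: (exactm_iso yf zi xS yS zI fi).
  - apply: (exactm_iso (z := mid _) zi _ yS zS _ il); last by case: (mid_bij M).
    by rewrite lz mcomp_idl.
  by case: fc.
have [e [_ re]] := represents_ex hab hfrob cs sy s4.
have := represents_map hab hfrob (n := mid _) (x := yom x) (y := yom y)
  (z := yom z) (m := mid M) r re (esym (mcomp_idr _)) yf zi (etrans (mcomp_idl _) (esym lz)).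
by rewrite -[scl (mid M)]/(sid M) -[scl (mid _)]/(sid (F true M)) !(smor1 LG) scomp1m scompm1 =>
  <-.
Qed.

Lemma phi_exact_trivial X Z : is_zero_object T Z ->
  phi_exact phi (@Triangle _ _ _ A X X Z (idm T X) 0 0).
Proof.
move=> Z0; have z0 W (u : T W Z) : u = 0 by rewrite -[u]comp1m Z0 comp0m.
have yz : mid (yo T Z) = 0 by apply: mhomP => W u; rewrite (z0 W u) [LHS]mfun0.
have [a ab] := adj_ex (0 : mhom (yo T Z) (yo T (A X))).
have M0 W (x : sus (autV A) (yo T Z) W) : x = 0 by exact: z0.
have fc : @factors (@Triangle _ _ _ A X X Z (idm T X) 0 0) (yo T Z) (mid _) 0 a.
  split=> //; first by case: (mid_bij (yo T Z)).
  - by apply/injectivemP => W x _; exact: z0.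
  by apply: mhomP => W u /=; rewrite comp0m.
apply: (phi_exactI fc) => /=.
have a0 W x : a W x = 0 by rewrite (M0 W x) mfun0.
have s4 : seq4 a (yom (idm T X)) (yom (0 : T X Z)) (mid (yo T Z)).
  split; last by case: (mid_bij (yo T Z)).
  - by apply/injectivemP => W x _; exact: M0.
  - move=> W y /=; rewrite comp1m; split=> [->|[x <-]]; last exact: a0.
    by exists 0; rewrite a0.
  - by move=> W y /=; rewrite comp0m; split=> // _; exists y; rewrite comp1m.
  - move=> W y /=; rewrite (z0 W y); split=> // _; exists 0; exact: z0.
have [e [_ re]] := represents_ex hab hfrob cs sy s4.
(* The module [yo T Z] is zero, so all stable maps out of it coincide. *)
suff -> : phi (yo T Z) = e by [].
have s0 : sid (yo T Z) = 0 by rewrite /sid yz scl0.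
rewrite -[phi _]scompm1 -[e]scompm1 s0.
have c0 P Q R (g : sHom Q R) : g \so (0 : sHom P Q) = 0.
  by apply: (addrI (g \so 0)); rewrite -scompDr !addr0.
by rewrite !c0.
Qed.

(** The given square induces [m] on the outer terms. Cancelling the invertible product of the first
    two classes from the naturality of [phi] at [m] leaves the compatibility of the third classes,
    which is what [mk_ses_fill] needs. *)
Lemma phi_exact_TR3 t t' (x : T (triX t) (triX t')) (y : T (triY t) (triY t')) :
  phi_exact phi t -> phi_exact phi t' -> trif t' \oc x = y \oc trif t ->
  exists z : T (triC t) (triC t'),
    trii t' \oc y = z \oc trii t /\ triq t' \oc z = fmor A x \oc triq t.
Proof.
move=> [M [l [b [a [lS bI qE ab r]]]]] [M' [l' [b' [a' [lS' bI' qE' ab' r']]]]] xy.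
have [s4 s4'] := (proj1 r, proj1 r').
have be : exactm b (yom (fmor A (trif t))) by apply/(adj_exact _ ab); case: s4.
have be' : exactm b' (yom (fmor A (trif t'))) by apply/(adj_exact _ ab'); case: s4'.
have [|m mE] := @lift_inj _ _ _ _ _ _ b' (yom (fmor A x) \mo b) bI'.
  move=> W u; apply/be'; rewrite /= compA -fmorM xy fmorM -compA.
  have -> : fmor A (trif t) \oc b W u = 0 by apply/(be W); exists u.
  exact: compm0.
have aE : yom x \mo a = a' \mo susf (autV A) m.
  by apply: (adj_uniq (adj_yo x ab)); rewrite -mE; exact: adj_mod.
have yf : yom y \mo yom (trif t) = yom (trif t') \mo yom x by rewrite -!yom_comp xy.
have [B1 [B2 [p1 [i2 [p2 [i3 [h1 h2 h3 fE gE]]]]]]] := seq4_split hab s4.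
have [B1' [B2' [p1' [i2' [p2' [i3' [h1' h2' h3' fE' gE']]]]]]] := seq4_split hab s4'.
move: r r'; rewrite fE gE fE' gE' => /(represents_ses_class hfrob h1 h2 h3) r.
move=> /(represents_ses_class hfrob h1' h2' h3') r'.
have [[aI ap p1S] [i2I ip2 p2S] [i3I il _]] := And3 h1 h2 h3.
have [[aI' ap' p1S'] [i2I' ip2' p2S'] [i3I' il' _]] := And3 h1' h2' h3'.
have [|b1 b1E] := @desc_surj _ _ _ _ _ _ p1 (p1' \mo yom x) p1S.
  move=> W u /ap [v <-]; have /= -> := mhom_app aE v.
  by apply/ap'; exists (susf (autV A) m W v).
have e2' : yom y \mo i2 = i2' \mo b1.
  by apply: (surj_epi p1S); rewrite -mcomp_assoc -fE yf fE' -!mcomp_assoc b1E.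
have [|b2 b2E] := @desc_surj _ _ _ _ _ _ p2 (p2' \mo yom y) p2S.
  move=> W u /ip2 [v <-]; have /= -> := mhom_app e2' v; by apply/ip2'; exists (b1 W v).
have m1 := ses_class_nat hfrob cs sy (mk_ses_map h1 h1' aE b1E).
have m2 := ses_class_nat hfrob cs sy (mk_ses_map h2 h2' e2' b2E).
have pn := natural_ext_scl hh_natural (scl m).
have e3 : clm h3' \so scl m = S1 (scl b2) \so clm h3.
  have wi : siso (S1 (S1 (clm h1') \so clm h2')).
    by apply: (smor_siso LG); apply: siso_comp; [apply: (smor_siso LG)|]; exact: ses_class_siso.
  apply: (siso_monic wi); rewrite scompA -r' -pn r.
  rewrite -[smor F true _]/(ssus (autV A) (scl m)) ssusE !scompA -!(smorM LG).
  by congr (smor _ _ _ \so _); rewrite !scompA -!(smorM LG) -m1 (smorM LG) -!scompA -m2.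
have [z [zi lz]] := mk_ses_fill hfrob e3.
exists (z (triC t) (idm T _)); have zE := yo_full (z : mhom (yo T (triC t)) (yo T (triC t'))).
have zE' : yom (z (triC t) (idm T _)) = z by rewrite [RHS]zE.
split; apply: yom_inj; rewrite !yom_comp.
  rewrite -[X in X \mo _ = _]/(yom (trii t')) -[X in _ = _ \mo X]/(yom (trii t)) gE gE'.
  rewrite -[X in _ = X \mo _]/(yom (z (triC t) (idm T _))) zE'.
  by rewrite mcomp_assoc zi -!mcomp_assoc b2E.
rewrite -[X in X \mo _ = _]/(yom (triq t')) -[X in _ = _ \mo X]/(yom (triq t)).
rewrite -[X in _ \mo X = _]/(yom (z (triC t) (idm T _))) zE' qE qE'.
by rewrite -mcomp_assoc -lz mcomp_assoc mE mcomp_assoc.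
Qed.

Lemma ses_class_sus M N (s : ses M N) :
  ses_class cs sy (ses_sus A s) = sig false false M \so smor F false (ses_class cs sy s).
Proof.
apply: (ses_pushE hfrob); have := ses_map_comp (ses_sus_map A (ses_class_map hfrob cs sy s))
  (sigma_map hfrob A cs sy false M).
by rewrite ssus1 scompm1.
Qed.

Lemma theta_desusp M : theta phi (F true M) = phi M \so scancel F false M.
Proof. by rewrite /theta -(natural_ext_scl hh_natural) (scancel_tri1 LF). Qed.

(** The class [e] is built from [c2], [c3] and the suspension of [c1]. Multiplying by [S^3(c1)]
    completes [c2] and [c3] to the class of the original sequence, which then appears on the right
    under [S]. *)
Lemma rotate_class t M l b a B1 B2 p1 (i2 : mhom B1 _) p2 (i3 : mhom B2 _)
    (h1 : is_ses a p1) (h2 : is_ses i2 p2) (h3 : is_ses i3 l) :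
  @factors t M l b a -> yom (trif t) = i2 \mo p1 -> yom (trii t) = i3 \mo p2 ->
  exists l' b' a' e, [/\ @factors (rotate t) (sus A B1) l' b' a',
    repr4 a' (yom (trii t)) (yom (triq t)) l' e
  & S3 (clm h1) \so (S3 (scancel F true B1) \so e) =
    - (S1 (S1 (S1 (clm h1) \so clm h2) \so clm h3 \so scancel F false M)
       \so sig false false (F true M) \so smor F false (clm h1))].
Proof.
move=> [lS bI qE ab] fE iE.
have [[aI ap p1S] [i2I ip2 p2S] [i3I il _]] := And3 h1 h2 h3.
pose kB : mhom (sus (autV A) (sus A B1)) B1 := susK (autV A) B1.
have [kI kS] : injectivem kB /\ surjectivem kB by exact: susK_bij.
pose l' := - (susf A p1 \mo sus_yoV A (triX t)).
pose b' := sus_yo A (triY t) \mo susf A i2; pose a' := i2 \mo kB.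
have ab' : adj a' b' := adj_sus i2.
have lS' : surjectivem l'.
  move=> W y; have [x xE] := p1S _ (- y : B1 (auti A W)); exists (sus_yo A _ W x).
  by rewrite mhom_oppE -[X in - X]/(p1 _ (sus_yoV A _ W _)) sus_yoVKE xE opprK.
have aI' : injectivem a' by move=> W x y e; apply: kI; exact: (i2I W).
have bI' : injectivem b' by exact: (proj1 (adj_inj ab')).
have qE' : yom (- fmor A (trif t)) = b' \mo l'.
  rewrite mcompNr; have -> : b' \mo (susf A p1 \mo sus_yoV A (triX t)) = yom (fmor A (trif t)).
    have := sus_yo_nat A (trif t); rewrite fE => /(congr1 (fun u => u \mo sus_yoV A (triX t))).
    by rewrite -[X in _ = X]mcomp_assoc sus_yoK mcomp_idr => <-; exact: mhomP.
  exact: yomN.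
have r1 : is_ses a' p2.
  split=> // W y; split=> [/ip2 [x <-]|[x <-]]; last by apply/ip2; eexists.
  by have [x' <-] := kS W x; exists x'.
have r3 : is_ses b l'.
  split=> // W y; have be : exactm b (yom (fmor A (trif t))).
    apply/(adj_exact _ ab) => V x; split=> [e|[z <-]].
      by apply/ap; apply: (i2I V); rewrite mfun0 -[LHS]/((i2 \mo p1) V x) -fE.
    have : p1 V (a V z) = 0 by apply/ap; eexists.
    by rewrite fE /= => ->; rewrite mfun0.
  have e : b' W (l' W y) = - yom (fmor A (trif t)) W y.
    by rewrite -[LHS]/((b' \mo l') W y) -qE' yomN mhom_oppE.
  rewrite -(be W y); split=> h; first by move: e; rewrite h mfun0 => /eqP;
    rewrite eq_sym oppr_eq0 => /eqP.
  by apply: (bI' W); rewrite e h oppr0 mfun0.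
exists l', b', a', (S1 (S1 (clm r1) \so clm h3) \so clm r3); split=> //.
  by rewrite iE qE; apply/(represents_ses_class hfrob r1 h3 r3).
have c1 : S1 (scancel F true B1) \so clm r1 = clm h2.
  rewrite -(scompm1 (clm h2)); apply/esym/(ses_class_nat hfrob cs sy).
  by apply: (mk_ses_map r1 h2 (g := mid _)); rewrite mcomp_idl ?mcomp_idr.
have c3 : clm r3 = - (S1 (scancel F false M) \so sig false false (F true M) \so smor F false
  (clm h1)).
  have m : ses_map (ses_sus A (mk_ses h1)) (mk_ses r3) (scancel F false M) (- sid _).
    case: (h1) (r3) => ? ? ? [? ? ?].
    exists (susK A M), (mid _), (- mid _); split=> //=; first by rewrite sclN.
      rewrite mcomp_idl; apply: mhomP => W z /=; rewrite ab.
      by rewrite (mfun_nat b).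
    by rewrite mcompNl mcomp_idl mcomp_idr.
  have := ses_class_nat hfrob cs sy m; rewrite scompNr scompm1 ses_class_sus => /eqP.
  by rewrite eqr_oppLR scompA => /eqP.
rewrite c3 scompNr !scompA !scompNr; congr (- _).
rewrite !scompA -!(smorM LG); congr (smor _ _ _ \so _ \so _); congr (_ \so _).
rewrite scompA -(smorM LG); congr (smor _ _ _ \so _).
by rewrite -c1 (smorM LG) -scompA.
Qed.

Lemma represents_fun N X Y Z M (a : mhom N (yo T X)) (f : mhom (yo T X) (yo T Y))
    (g : mhom (yo T Y) (yo T Z)) (l : mhom (yo T Z) M) e e' :
  repr4 a f g l e -> repr4 a f g l e' -> e = e'.
Proof.
move=> r r'; have mm P Q (u : mhom P Q) : mid Q \mo u = u \mo mid P.
  by rewrite mcomp_idl mcomp_idr.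
have := represents_map hab hfrob r' r (mm _ _ a) (mm _ _ f) (mm _ _ g) (mm _ _ l).
by rewrite -[scl (mid M)]/(sid M) -[scl (mid _)]/(sid N) !(smor1 LG) scomp1m scompm1.
Qed.

(** Naturality of [theta] along [c1 : B1 -> S Sigma^-1 M] trades [phi (Sigma B1)] for [theta] at
    [S Sigma^-1 M]. The class [x] is arbitrary: rotation takes [x = phi M], inverse rotation solves
    for [x], and for a Puppe structure the equivalence yields anticommutativity. *)
Lemma rotate_phi t M l b a x : @factors t M l b a ->
  repr4 a (yom (trif t)) (yom (trii t)) l x ->
  exists N l' b' a' e, [/\ @factors (rotate t) N l' b' a',
    repr4 a' (yom (trii t)) (yom (triq t)) l' e
  & (phi N = e <-> theta phi (G false (F true M)) =
      - (S1 (x \so scancel F false M) \so sig false false (F true M)))].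
Proof.
move=> fc r; have [B1 [B2 [p1 [i2 [p2 [i3 [h1 h2 h3 fE iE]]]]]]] := seq4_split hab (proj1 r).
have [l' [b' [a' [e [fc' r' eE]]]]] := rotate_class h1 h2 h3 fc fE iE.
exists (sus A B1), l', b', a', e; split=> //.
move: r; rewrite fE iE => /(represents_ses_class hfrob h1 h2 h3) xE; rewrite -xE in eE.
have tn := theta_nat hfrob hh_natural (clm h1).
have thE : theta phi B1 = S3 (scancel F true B1) \so phi (sus A B1) by [].
split=> h.
  apply: (siso_epic (smor_siso LF false (ses_class_siso hfrob cs sy (mk_ses h1)))).
  by rewrite -tn thE h eE scompNl.
have c1i := ses_class_siso hfrob cs sy (mk_ses h1).
apply: (siso_monic (smor_siso LG false (smor_siso LG false
  (smor_siso LG false (scancel_iso LF true B1))))).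
apply: (siso_monic (smor_siso LG false (smor_siso LG false (smor_siso LG false c1i)))).
by rewrite eE -scompNl -h -thE; exact: tn.
Qed.

Hypothesis theta_anticomm : anticomm (theta phi).

Let theta_S M : theta phi (G false M) = - (S1 (theta phi M) \so sig false false M).
Proof. by apply/eqP; rewrite -addr_eq0 addrC theta_anticomm. Qed.

Lemma phi_exact_rotate t : phi_exact phi t -> phi_exact phi (rotate t).
Proof.
move=> [M [l [b [a [lS bI qE ab r]]]]]; have fc : @factors t M l b a by [].
have [N [l' [b' [a' [e [fc' r' [_ eE]]]]]]] := rotate_phi fc r.
by apply: (phi_exactI fc'); rewrite eE // theta_S theta_desusp.
Qed.

Lemma phi_exact_unrotate t : phi_exact phi (rotate t) -> phi_exact phi t.
Proof.
move=> ht; have [M' [l' [b' [a' [lS' bI' qE' ab' r']]]]] := ht.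
have [M [l [b [lS bI qE]]]] := image_ex hab (yom (triq t)).
have [a ab] := adj_ex b; have fc : @factors t M l b a by [].
have [aI' ai iq ql _] := proj1 r'.
have fl W y : yom (fmor A (trif t)) W y = 0 <-> l' W y = 0.
  have e : b' W (l' W y) = - yom (fmor A (trif t)) W y.
    by rewrite -[LHS]/((b' \mo l') W y) -qE' yomN mhom_oppE.
  split=> h; first by apply: (bI' W); rewrite e h oppr0 mfun0.
  by move: e; rewrite h mfun0 => /eqP; rewrite eq_sym oppr_eq0 => /eqP.
have be : exactm b (yom (fmor A (trif t))).
  move=> W y; rewrite fl; split=> [/ql [x xE]|[x <-]].
    by exists (l W x); rewrite -xE -[LHS]/((b \mo l) W x) -qE.
  have [z <-] := lS W x; apply/ql; exists z.
  by rewrite -[RHS]/((b \mo l) W z) -qE.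
have s4 : seq4 a (yom (trif t)) (yom (trii t)) l.
  split=> //; first exact/(adj_inj ab).
  - exact/(adj_exact _ ab).
  - move=> W y; split=> [/ai [n nE]|[x <-]].
      have [x xE] := lS' _ n; have [x0 x0E] := fmor_full (- x : T (A W) (A (triX t))).
      exists x0; apply: fmor_inj; rewrite -nE; apply: etrans (esym (ab' W n));
        rewrite -xE -[RHS]/((b' \mo l') _ x) -qE'.
      by rewrite yomN mhom_oppE /= fmorM x0E -compNr.
    have [n nE] : exists n, a' W n = yom (trif t) W x.
      exists (l' (A W) (- fmor A x)); apply: fmor_inj; apply: (etrans (ab' W _));
        rewrite mfunN mfunN.
      rewrite -[X in - X]/((b' \mo l') _ _) -qE' yomN mhom_oppE opprK /=.
      by rewrite fmorM.
    by rewrite -nE; apply/ai; exists n.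
  move=> W y; rewrite -(iq W y); split=> [h|h].
    by rewrite qE /= h mfun0.
  by apply: (bI W); rewrite mfun0 -[LHS]/((b \mo l) W y) -qE.
(* The class [x] is still unknown; comparison with the rotated triangle, after cancelling [sigma],
   [S] and [scancel], forces [x = phi M]. *)
have [x [_ r]] := represents_ex hab hfrob cs sy s4.
have [N [l2 [b2 [a2 [e [fc2 r2 [eE _]]]]]]] := rotate_phi fc r.
have := eE (represents_fun (exact_transport ht fc2) r2).
rewrite theta_S theta_desusp => /oppr_inj.
move=> /(siso_epic (sigma_iso hfrob A cs sy false false _)) /(smor_inj LG).
move=> /(siso_epic (scancel_iso LF false M)) xE.
by apply: (phi_exactI fc); rewrite xE.
Qed.

Lemma phi_exact_puppe : is_puppe (phi_exact phi).
Proof.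
split.
- exact: phi_exact_iso.
- exact: phi_exact_trivial.
- exact: phi_exact_cone.
- by move=> t; split; [exact: phi_exact_rotate|exact: phi_exact_unrotate].
by move=> t t' x y; exact: phi_exact_TR3.
Qed.

End ExactTriangles.

(** * The extension class attached to a Puppe structure *)

Section PuppeStructures.
Variables (k : comPzRingType) (Ob : Type) (T : addcat k Ob).
Hypothesis hidem : idempotent_complete T.
Hypothesis hab : is_abelian (modcat T).
Hypothesis hfrob : is_frobenius (modcat T).
Variables (A : automorphism T) (cs : cosyzygies T) (sy : syzygies T).
Implicit Types K L M N P Q B : fpmod T.
Implicit Type t : triangle A.
Notation G := (Scosyz cs sy).
Notation F := (Sigma A).
Notation sig := (sigma A cs sy).
Notation S1 f := (smor G false f).
Notation S3 f := (S1 (S1 (S1 f))).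
Notation repr4 := (@represents _ _ T cs sy _ _ _ _ _).

Let LF := Sigma_laws A.
Let LG := Scosyz_laws hfrob cs sy.

(** Embed [M] in a representable, whose object is a suspension since [A] is bijective on objects;
    then embed the cokernel of the desuspended map in another representable to obtain [f]. *)
Lemma presentation M : exists X Y (a : mhom (Sigma A true M) (yo T X)) b (f : T X Y),
  [/\ injectivem b, adj a b & exactm a (yom f)].
Proof.
pose s := projT2 (cs M); pose W := ses_ob s.
pose b : mhom M (yo T (A (auti A W))) := yom (eqm T (esym (autiK A W))) \mo ses_i s.
have bI : injectivem b.
  move=> V x y /= /(congr1 (fun u => eqm T (autiK A W) \oc u)).
  rewrite !compA eqmVK !comp1m; exact: (sesI s).
have [a ab] := adj_ex b.
pose Q := @coker _ _ T (sus (autV A) M) (yo T (auti A W)) a; pose s' := projT2 (cs Q).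
pose f : mhom (yo T (auti A W)) (yo T (ses_ob s')) := ses_i s' \mo coker_pi a.
exists (auti A W), (ses_ob s'), a, b, (f _ (idm T _)); split=> //.
rewrite -[yom _]yo_full => V y; rewrite -(coker_pi_exact a y); split=> [fy|/= ->].
  by apply: (sesI s'); rewrite mfun0.
exact: (mfun0 (ses_i s')).
Qed.

(** Completion gives a [phi]-exact triangle over [M]; it is also [psi]-exact, and a sequence
    represents only one class. *)
Lemma phi_exact_inj (phi psi : HH0_deg0 A cs sy 3%:Z (Negz 0)) : (forall M, siso (phi M)) ->
  (forall t, phi_exact phi t -> phi_exact psi t) -> forall M, phi M = psi M.
Proof.
move=> phii h M; have [X [Y [a [b [f [bI ab af]]]]]] := presentation M.
have [C [i [q [l [fc r]]]]] := exact_completion hidem hab hfrob phii bI ab af.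
have := exact_transport hab hfrob (h _ (phi_exactI fc r)) fc.
exact: (represents_fun hab hfrob r).
Qed.

Lemma phi_exact_yo (phi : HH0_deg0 A cs sy 3%:Z (Negz 0)) t : phi_exact phi t ->
  [/\ exactm (yom (trif t)) (yom (trii t)), exactm (yom (trii t)) (yom (triq t))
    & exactm (yom (triq t)) (yom (fmor A (trif t)))].
Proof.
move=> [M [l [b [a [lS bI qE ab [[aI af fi il _] _]]]]]]; rewrite qE; split=> //.
  move=> W y; rewrite -(il W y) /=; split=> [h|->]; last exact: (mfun0 b).
  by apply: (bI W); rewrite h mfun0.
have be : exactm b (yom (fmor A (trif t))) by apply/(adj_exact _ ab).
move=> W y; rewrite (be W y); split=> -[x <-]; last by exists (l W x).
by have [z <-] := lS W x; exists z.
Qed.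

Lemma yom_iso X Y (f : T X Y) : injectivem (yom f) -> surjectivem (yom f) -> is_iso f.
Proof.
move=> fI fS; have [g] := fS Y (idm T Y); rewrite [LHS]/= => gE.
by exists g; split=> //; apply: (fI X) => /=; rewrite compA gE comp1m compm1.
Qed.

Lemma five_lemma (phi : HH0_deg0 A cs sy 3%:Z (Negz 0)) X Y (f : T X Y) C C' i q i' q'
    (c : T C' C) :
  phi_exact phi (Triangle f i q : triangle A) -> phi_exact phi (Triangle f i' q') ->
  i = c \oc i' -> q \oc c = q' -> is_iso c.
Proof.
move=> /phi_exact_yo [/= fi iq qf] /phi_exact_yo [/= fi' iq' qf'] ic qc.
apply: yom_iso.
  apply/injectivemP => W z /= cz; have /iq' [y yz] : yom q' W z = 0.
    by rewrite /= -qc -compA cz compm0.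
  have /fi [x xy] : yom i W y = 0 by rewrite /= ic -compA -[i' \oc y]/(yom i' W y) yz.
  by rewrite -yz -xy; apply/fi'; exists x.
move=> W w; have /qf' [z zw] : yom (fmor A f) W (yom q W w) = 0 by apply/qf; exists w.
have /iq [y yE] : yom q W (w - yom c W z) = 0.
  by rewrite mfunB -zw /= compA qc subrr.
exists (z + yom i' W y); rewrite mfunD; move: yE; rewrite /= compA -ic => ->.
by rewrite addrC subrK.
Qed.

Variable D : set (triangle A).
Hypothesis hD : is_puppe D.

Lemma puppe_comp0 t : D t -> trii t \oc trif t = 0.
Proof.
move=> Dt; have [_ D0 _ _ D3] := hD; have [[Z Z0] _] := addcatP T.
have [|c [/= e _]] := D3 (@Triangle _ _ _ A _ _ Z (idm T (triX t)) 0 0) t (idm T (triX t)) (trif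
  t) (D0 (triX t) Z Z0) Dt.
  by [].
by rewrite e compm0.
Qed.

Lemma puppe_exact t : D t -> exactm (yom (trif t)) (yom (trii t)).
Proof.
move=> Dt W y; split=> [/= iy|[x <-]]; last first.
  by rewrite /= compA puppe_comp0 // comp0m.
have [_ D0 _ Dr D3] := hD; have [[Z Z0] _] := addcatP T.
have Drt := proj1 (Dr _) Dt; have Dr0 := proj1 (Dr _) (D0 W Z Z0).
(* The rotated trivial triangle starts with [W -> 0 -> Sigma W]. It maps to the rotation of [t] by
   [y], and the third component, desuspended, is the required preimage of [y]. *)
have [|c [/= _ e]] := D3 (rotate (@Triangle _ _ _ A _ _ Z (idm T W) 0 0)) (rotate t) y (0 : T Z
  (triC t)) Dr0 Drt.
  by rewrite /= iy comp0m.
have [c0 c0E] := fmor_full (c : T (A W) (A (triX t))).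
exists c0; apply: (@fmor_inj _ _ _ A); apply: (etrans (fmorM _ _ _)).
move: e; rewrite compNl compNr fmor1 compm1 => /oppr_inj. by rewrite -c0E.
Qed.

Lemma puppe_exact3 t : D t -> [/\ exactm (yom (trif t)) (yom (trii t)),
  exactm (yom (trii t)) (yom (triq t)) & exactm (yom (triq t)) (yom (fmor A (trif t)))].
Proof.
move=> Dt; have [_ _ _ Dr _] := hD; have Dt1 := proj1 (Dr _) Dt; have Dt2 := proj1 (Dr _) Dt1.
split; [exact: puppe_exact|exact: (puppe_exact Dt1)|].
move=> W y; rewrite -(puppe_exact Dt2 y) /= compNl; split=> [->|/eqP]; first exact: oppr0.
by rewrite oppr_eq0 => /eqP.
Qed.

Lemma puppe_seq4 t M l b a : D t -> @factors _ _ _ A t M l b a ->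
  seq4 a (yom (trif t)) (yom (trii t)) l.
Proof.
move=> /puppe_exact3 [fi iq qf] [lS bI qE ab]; split=> //; first exact/(adj_inj ab).
  apply/(adj_exact _ ab) => W y; rewrite (qf W y) qE; split=> -[x <-]; first by exists (l W x).
  by have [z <-] := lS W x; exists z.
move=> W y; rewrite -(iq W y) qE /=; split=> [->|h]; first exact: (mfun0 b).
by apply: (bI W); rewrite h mfun0.
Qed.

Lemma puppe_over M : exists t l b a, D t /\ @factors _ _ _ A t M l b a.
Proof.
have [X [Y [a [b [f [bI ab af]]]]]] := presentation M.
have [_ _ Dc _ _] := hD; have [C [i [q Dt]]] := Dc X Y f.
have [_ _ /= qf] := puppe_exact3 Dt; have be : exactm b (yom (fmor A f)) by apply/(adj_exact _
  ab).
have [|l lE] := @lift_inj _ _ _ _ _ _ b (yom q) bI.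
  by move=> W x; apply/(be W)/(qf W); exists x.
exists (Triangle f i q), l, b, a; split=> //; split=> // W m.
have /(qf W) [x xm] : yom (fmor A f) W (b W m) = 0 by apply/(be W); exists m.
by exists x; apply: (bI W); rewrite -xm -lE.
Qed.

(** A relation, as it depends on a triangle over [M]; its uniqueness is naturality at the identity
    of [M]. *)
Definition puppe_class M (e : Ext A cs sy 3%:Z (Negz 0) M M) := exists t l b a,
  [/\ D t, @factors _ _ _ A t M l b a & repr4 a (yom (trif t)) (yom (trii t)) l e].
Arguments puppe_class M e : clear implicits.

Lemma puppe_class_ex M : exists e, siso e /\ puppe_class M e.
Proof.
have [t [l [b [a [Dt fc]]]]] := puppe_over M.
have [e [ei r]] := represents_ex hab hfrob cs sy (puppe_seq4 Dt fc).
by exists e; split=> //; exists t, l, b, a.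
Qed.

(** Injectivity of representables extends [m] to [x] and [y], the morphism axiom supplies [z], and
    the monomorphism [b'] forces [z] to lie over [m]. *)
Lemma puppe_class_nat M N (m : mhom M N) e e' : puppe_class M e -> puppe_class N e' ->
  S3 (smor F true (scl m)) \so e = e' \so scl m.
Proof.
move=> [t [l [b [a [Dt fc r]]]]] [t' [l' [b' [a' [Dt' fc' r']]]]].
have [[lS bI qE ab] [lS' bI' qE' ab']] := (fc, fc').
have [aI af _ _ _] := proj1 r; have [aI' af' _ _ _] := proj1 r'.
have [x xE] := yo_inj hfrob (a' \mo susf (autV A) m) aI.
have [B [p [j [pS jI fE]]]] := image_ex hab (yom (trif t)).
have [|u uE] := @desc_surj _ _ _ _ _ _ p (yom (trif t') \mo x) pS.
  move=> W v pv; have /af [n <-] : yom (trif t) W v = 0 by rewrite fE /= pv mfun0.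
  have := mhom_app xE n; rewrite [LHS]/= => e1.
  rewrite -[LHS]/(yom (trif t') W (x W (a W n))) e1.
  by apply/af'; exists (susf (autV A) m W n).
have [y yE] := yo_inj hfrob u jI.
pose x0 : T (triX t) (triX t') := x _ (idm T _); pose y0 : T (triY t) (triY t') := y _ (idm T _).
have x0E : yom x0 = x by rewrite /x0 -[yom _]yo_full.
have y0E : yom y0 = y by rewrite /y0 -[yom _]yo_full.
have yf : yom y0 \mo yom (trif t) = yom (trif t') \mo yom x0.
  by rewrite x0E y0E fE mcomp_assoc yE uE.
have [_ _ _ _ D3] := hD; have [|z [zi zq]] := D3 t t' x0 y0 Dt Dt'.
  by apply: yom_inj; rewrite !yom_comp; exact: esym yf.
have bm : b' \mo m = yom (fmor A x0) \mo b.
  apply: (adj_uniqr (a := yom x0 \mo a)); last exact: adj_yo.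
  rewrite x0E xE; exact: adj_mod.
have lz : m \mo l = l' \mo yom z.
  by apply: (inj_mono bI'); rewrite !mcomp_assoc bm -qE' -mcomp_assoc -qE -!yom_comp zq.
have zi' : yom z \mo yom (trii t) = yom (trii t') \mo yom y0 by rewrite -!yom_comp zi.
rewrite -[smor F true (scl m)]/(ssus (autV A) (scl m)) ssusE; apply: esym.
by apply: (represents_map hab hfrob r r' _ yf zi' lz); rewrite x0E.
Qed.

Lemma puppe_phi : exists phi : HH0_deg0 A cs sy 3%:Z (Negz 0),
  [/\ forall M, siso (phi M), anticomm (theta phi) & forall t, D t <-> phi_exact phi t].
Proof.
pose f M := sval (cid (puppe_class_ex M)).
have fi M : siso (f M) by rewrite /f; case: cid => ? [].
have fc M : puppe_class M (f M) by rewrite /f; case: cid => ? [].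
have fn : natural_ext (f : forall M, Ext A cs sy 3%:Z (Negz 0) M M).
  by move=> M N g; exact: puppe_class_nat.
pose phi := HH0Deg0 (proj1 (natural_hhP hfrob _) fn).
have Dphi t : D t -> phi_exact phi t.
  move=> Dt; have [M [l [b [lS bI qE]]]] := image_ex hab (yom (triq t)).
  have [a ab] := adj_ex b; have tfc : @factors _ _ _ A t M l b a by [].
  have [e [_ r]] := represents_ex hab hfrob cs sy (puppe_seq4 Dt tfc).
  have ce : puppe_class M e by exists t, l, b, a.
  suff ef : f M = e by apply: (phi_exactI tfc); rewrite -[phi M]/(f M) ef.
  have := puppe_class_nat (mid M) ce (fc M).
  by rewrite -[scl _]/(sid M) (smor1 LF) !(smor1 LG) scomp1m scompm1.
have ac : anticomm (theta phi).
  (* A triangle over [M] and its rotation both lie in [D], so the equivalence of [rotate_phi] gives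
     anticommutativity at [Sigma^-1 M]. *)
  have key M : theta phi (G false (F true M)) =
      - (S1 (theta phi (F true M)) \so sig false false (F true M)).
    have [t [l [b [a [Dt tfc]]]]] := puppe_over M.
    have r := exact_transport hab hfrob (Dphi t Dt) tfc.
    have [N [l' [b' [a' [e [tfc' r' [eE _]]]]]]] := rotate_phi hab hfrob phi tfc r.
    rewrite theta_desusp //; apply: eE; have [_ _ _ Dr _] := hD.
    have r2 := exact_transport hab hfrob (Dphi _ (proj1 (Dr _) Dt)) tfc'.
    exact: (represents_fun hab hfrob r2 r').
  move=> K; apply/eqP; rewrite addrC addr_eq0; apply/eqP.
  (* Every [K] is isomorphic to [Sigma^-1 Sigma K]; naturality of [theta] and [sigma] transports the
     equation. *)
  pose u := scancel F true K; have ui : siso u := scancel_iso LF true K.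
  apply: (siso_epic (smor_siso LF false (smor_siso LG false ui))).
  rewrite -(theta_nat hfrob fn) key scompNr scompNl; congr (- _).
  rewrite scompA -(smorM LG) (theta_nat hfrob fn) (smorM LG) -!scompA; congr (_ \so _).
  exact: (sigma_nat hfrob A cs sy false false u).
exists phi; split=> // t; split; first exact: Dphi.
case: t => X Y C g i q tphi; have [Diso _ Dc _ _] := hD.
(* A triangle of [D] on the same map [g] is also [phi]-exact; the comparison map of the two is
   invertible by the five lemma. *)
have [C' [i' [q' Dt']]] := Dc X Y g; have tphi' := Dphi _ Dt'.
have [|c [/= ci cq]] := phi_exact_TR3 hab hfrob (t := Triangle g i' q')
  (t' := Triangle g i q) (x := idm T X) (y := idm T Y) tphi' tphi.
  by rewrite /= comp1m compm1.
rewrite compm1 in ci; rewrite fmor1 comp1m in cq.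
have ciso := five_lemma tphi tphi' ci cq.
apply: (Diso _ _ _ Dt'); exists (idm T X), (idm T Y), c; split; split=> //=.
- by exists (idm T X); rewrite comp1m.
- by exists (idm T Y); rewrite comp1m.
- by rewrite comp1m compm1.
- by rewrite compm1.
by rewrite fmor1 comp1m.
Qed.

End PuppeStructures.

(** * The bijection between units and Puppe structures *)

Local Open Scope classical_set_scope.

Theorem corollary3p4 (k : comPzRingType) (Ob : Type) (T : addcat k Ob)
  (hidem : idempotent_complete T)
  (hab : is_abelian (modcat T)) (hfrob : is_frobenius (modcat T))
  (Sig : automorphism T) (cs : cosyzygies T) (sy : syzygies T) :
  exists Phi : {phi : HH0_graded Sig cs sy 3%:Z (Negz 0) | hh_unit phi /\ heller (istar phi)} ->
               {D : set (triangle Sig) | is_puppe D},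
    (forall phi, sval (Phi phi) = [set t | phi_exact (istar (sval phi)) t]) /\
    bijective Phi.
Proof.
have delta_theta (phi : HH0_graded Sig cs sy 3%:Z (Negz 0)) M :
    delta (istar phi) M = - theta phi M.
  have gr q M' N (g : gHom Sig q M' N) : graded_at phi g.
    by apply/(hhg_graded hfrob phi g); exact: hhgP.
  by apply: (graded_delta hfrob) => // M' N g; apply/(graded0 hfrob); exact: gr.
(* Heller's condition is homogeneous, so it does not see the sign between [delta] and [theta]. *)
have ac (phi : HH0_graded Sig cs sy 3%:Z (Negz 0)) : heller (istar phi) -> anticomm (theta phi).
  move=> h M; have := h M; rewrite !delta_theta (smorN (Scosyz_laws hfrob cs sy)) scompNl.
  by rewrite -opprD => /eqP; rewrite oppr_eq0 => /eqP.
have pup (phi : {phi : HH0_graded Sig cs sy 3%:Z (Negz 0) | hh_unit phi /\ heller (istar phi)}) :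
    is_puppe [set t | phi_exact (istar (sval phi)) t].
  case: phi => phi [u h] /=; apply: (phi_exact_puppe hidem hab hfrob); last exact: ac.
  exact: (unit_siso hfrob).
exists (fun phi => exist _ _ (pup phi)); split=> //.
have surj (D : {D : set (triangle Sig) | is_puppe D}) :
    exists phi, exist _ _ (pup phi) = D.
  case: D => D hD; have [phi [phii pac phiD]] := puppe_phi hab hfrob cs sy hD.
  have pn := hh_natural hfrob phi.
  have dt := theta_delta hfrob pn phii pac.
  (* So far [phi] satisfies the condition in degree 0 only; [dt] extends it to morphisms of all
     degrees. *)
  pose gphi := HH0Graded (fun q M N g => proj2 (hhg_graded hfrob phi g)
    (graded_all hfrob pn dt g)).
  have gu : hh_unit gphi by exact: (siso_unit hfrob).
  have gh : heller (istar gphi).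
    move=> M; rewrite -[delta _ M]/(deltaf phi M) -[delta _ (_ M)]/(deltaf phi _) !dt.
    by rewrite (smorN (Scosyz_laws hfrob cs sy)) scompNl -opprD pac oppr0.
  exists (exist _ gphi (conj gu gh)); apply: eq_exist => /=.
  by apply/predeqP => t; rewrite phiD.
have inj phi psi : exist _ _ (pup phi) = exist _ _ (pup psi) -> phi = psi.
  case: phi psi => [phi [u h]] [psi [v h']] /(congr1 sval) /= e; apply: eq_exist.
  have e' t : phi_exact (istar phi) t -> phi_exact (istar psi) t.
    by move=> ht; have : [set t | phi_exact (istar phi) t] t by []; rewrite e.
  have pp := phi_exact_inj hidem hab hfrob (phi := istar phi) (unit_siso hfrob u) e'.
  case: phi psi {u v h h' e e'} pp => [f fP] [g gP] /= pp.
  have e : f = g by apply: functional_extensionality_dep.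
  by case: _ / e in gP {pp} *; congr HH0Graded; exact: Prop_irrelevance.
exists (fun D => sval (cid (surj D))) => [phi|D].
  by apply: inj; case: cid.
by case: cid.
Qed.
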